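(* Let $k \geq 3$ be an integer and $\gamma \in (0,1)$. There exist $c>0$ and $n_0 \in \mathbb{N}$ such that the following holds for all integers $n \geq n_0$. (i) For $d \in \{1,\dots,k-1\}$, if $n \equiv s \pmod{k}$ with $s \in \{0,\dots,k-1\}$, then every $k$-uniform $n$-vertex hypergraph $\mathcal{H}$ with $\delta_{d}(\mathcal{H}) \geq \left(\overline{\mu_d}^{(s)}(k) + \gamma\right) \binom{n-d}{k-d}$ has at least $\exp((1-1/k) n \log n - cn)$ optimal matchings. (ii) If $k \mid n$, then every $k$-uniform $n$-vertex hypergraph $\mathcal{H}$ with $\delta_{k-1}(\mathcal{H}) \geq m_{k-1}(k,n)$ has at least $\exp((1-1/k) n \log n - cn)$ perfect matchings.
   Context: A $k$-uniform hypergraph $\mathcal{H}$ consists of a finite vertex set $V(\mathcal{H})$ and a set of edges, each a $k$-element subset of $V(\mathcal{H})$. A matching is a set of pairwise disjoint edges. An optimal matching of a $k$-uniform hypergraph $\mathcal{H}$ is a matching with exactly $\lfloor |V(\mathcal{H})|/k \rfloor$ edges; it is called perfect if $k$ divides $|V(\mathcal{H})|$. The minimum $d$-degree $\delta_d(\mathcal{H})$ is the minimum, over all sets $S$ of $d$ distinct vertices, of the number of edges containing $S$. For $n \geq k > d \geq 1$, $m_d(k,n)$ is the minimum integer $D \geq 0$ such that every $k$-uniform $n$-vertex hypergraph $\mathcal{H}$ with $\delta_d(\mathcal{H}) \geq D$ has an optimal matching. For $s \in \{0,\dots,k-1\}$, $$\overline{\mu_d}^{(s)}(k) := \limsup_{n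 \to \infty,\; n \equiv s \ (\mathrm{mod}\ k)} \frac{m_d(k,n)}{\binom{n-d}{k-d}}.$$ Here $\log$ is the natural logarithm. *)

(* Defs.v *)
From HB Require Import structures.
From mathcomp Require Import all_boot all_order all_algebra.
From mathcomp Require Import all_classical all_reals all_analysis.

Set Implicit Arguments.
Unset Strict Implicit.
Unset Printing Implicit Defensive.
Import Order.TTheory GRing.Theory Num.Theory.

(* A hypergraph is its edge set E : {set {set V}} over a finite vertex type V. *)
Section Hypergraph.
Variable V : finType.
Implicit Types (E M : {set {set V}}) (S : {set V}) (k d : nat).

Definition uniform k E : bool := [forall e in E, #|e| == k].

Definition degree E S : nat := #|[set e in E | S \subset e]|.

(* Since degree E S <= #|E|, the default value #|E| does not affect the
   minimum when there is a d-element set, i.e. when d <= #|V|. *)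
Definition min_degree d E : nat :=
  \big[minn/#|E|]_(S : {set V} | #|S| == d) degree E S.

Definition matching E M : bool := (M \subset E) && finset.trivIset M.

Definition optimal_matching k E M : bool :=
  matching E M && (#|M| == #|V| %/ k).

Definition perfect_matching k E M : bool :=
  (k %| #|V|) && optimal_matching k E M.

Definition num_optimal_matchings k E : nat :=
  #|[set M : {set {set V}} | optimal_matching k E M]|.

Definition num_perfect_matchings k E : nat :=
  #|[set M : {set {set V}} | perfect_matching k E M]|.

End Hypergraph.

Definition forces_optimal_matching (d k n D : nat) : Prop :=
  forall (V : finType) (E : {set {set V}}),
    #|V| = n -> uniform k E -> D <= min_degree d E ->
    exists M : {set {set V}}, optimal_matching k E M.

Lemma min_degree_le_card (V : finType) d (E : {set {set V}}) :
  min_degree d E <= #|E|.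
Proof.
rewrite /min_degree; elim/big_ind: _ => [//|x y xE _|S _].
  exact: leq_trans (geq_minl x y) xE.
by apply: subset_leq_card; apply/fintype.subsetP => e; rewrite inE => /andP[].
Qed.

(* No hypergraph on n vertices has more than 2 ^ n edges. *)
Lemma forces_optimal_matching_ex d k n :
  exists D, `[< forces_optimal_matching d k n D >].
Proof.
exists (2 ^ n).+1; apply/asboolP => V E Vn _ /leq_trans.
move=> /(_ _ (min_degree_le_card d E)).
by rewrite ltnNge -Vn -cardsT -card_powerset powersetT cardsT max_card.
Qed.

(* m_d(k,n) *)
Definition m_ (d k n : nat) : nat := ex_minn (forces_optimal_matching_ex d k n).

Local Open Scope classical_set_scope.
Local Open Scope ring_scope.

(* The limsup is along the filter of n tending to infinity within the residue
   class of s modulo k. *)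
Definition mu_sup (R : realType) (d k s : nat) : \bar R :=
  limf_esup (fun n : nat => ((m_ d k n)%:R / ('C(n - d, k - d))%:R : R)%:E)
            (within [set n : nat | (n = s %[mod k])%N] \oo).

(* Main.v *)
Require Import Defs.
From mathcomp Require Import all_boot all_order all_algebra.
From mathcomp Require Import all_classical all_reals all_analysis.
From mathcomp Require Import ring lra zify.
From mathcomp.boot Require Import ssrbool eqtype ssrnat seq fintype bigop.
From mathcomp.boot Require Import binomial finset.

(* Counting is by random halving.  If the condition that every small root set S has at least
   theta * |W|^b extensions inside W guarantees an optimal matching as soon as W is large, then
   a random half of W and its complement inherit it up to a loss |W|^(-1/4), by a bounded
   differences inequality and a union bound.  Matchings of the two halves combine, and a matching
   arises at most exp(O(|W|)) times, so log N(m) >= 2 log N(m/2) + (1 - 1/k) m log 2 - O(log m):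
   recursing down to constant size gives exp((1 - 1/k) n log n - O(n)).

   For (i) the condition is the d-degree and existence is the definition of the limsup.  For (ii)
   the parity construction gives m_(k-1)(k,n) >= n/2 - k, so codegrees exceed 9n/20 and among any
   three vertices two have many common (k-1)-sets in their links.  Hence either all vertices can be
   exchanged for one another by bounded configurations, or there are two such classes A, ~A and the
   typical edges are exactly those with |e :&: A| = tau mod 2.  In both cases every vertex set of
   size at most k^2 with the right parity has a positive density of absorbers, a property which
   again passes to random halves and yields a perfect matching.  If the parity of V itself is wrong,
   the perfect matching provided by the definition of m_(k-1)(k,n) has an edge of the wrong
   parity, and that edge is removed first. *)

Set Implicit Arguments.
Unset Strict Implicit.
Unset Printing Implicit Defensive.
Import Order.TTheory GRing.Theory Num.Theory.
Local Open Scope ring_scope.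

(** * Random subsets *)

Section RandomSubset.
Variables (R : realType) (V : finType).
Implicit Types (U W X : {set V}) (f : {set V} -> R).

(** The exponent 1 - 1/k is a balance of two counts: a set of m vertices has 2^m halves up to
    polynomial factors, while a matching of m/k edges splits into two matchings in at most 2^(m/k)
    ways. Each level of the recursion thus gains (1 - 1/k) m log 2, and about log n levels add up to
    (1 - 1/k) n log n.

    The depth is also the obstacle, since a condition has to survive all these halvings. Losses of
    order m^(-1/4) grow geometrically as m shrinks, so their total is governed by the last level and
    is small once the recursion stops at a large constant size. Failure probabilities exp(-sqrt m /
    2) beat the polynomially many roots.

    In (i) the margin gamma pays for the losses. In (ii) the degree may sit exactly at the
    threshold, which random halves cannot inherit. The threshold is therefore traded once, at the
    top, for codegrees and for the one matching that settles the parity; only codegrees and absorber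
    densities, which have room to spare, are handed down. *)

Lemma sum_subsets_setU1 (M : nmodType) x W (F : {set V} -> M) : x \notin W ->
  \sum_(U : {set V} | U \subset x |: W) F U =
  \sum_(U : {set V} | U \subset W) (F U + F (x |: U)).
Proof.
move=> xW; rewrite (bigID (fun U => x \notin U)) /= big_split /=; congr (_ + _).
  apply: eq_bigl => U; apply/andP/idP => [[UxW xU]|UW].
    apply/subsetP => y yU; have := subsetP UxW y yU; rewrite !inE.
    by case/orP=> // /eqP yx; rewrite -yx yU in xU.
  split; first by apply: subset_trans UW _; apply: subsetU1.
  by apply: contra xW; apply: (subsetP UW).
rewrite (reindex_onto (fun U => x |: U) (fun U => U :\ x)) /=; last first.
  by move=> U /andP[_]; rewrite negbK => xU; rewrite setD1K.
apply: eq_bigl => U; rewrite negbK setU11 andbT.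
apply/andP/idP => [[UxW /eqP xU]|UW].
  apply/subsetP => y yU; have := subsetP UxW y.
  rewrite !inE yU orbT => /(_ isT)/orP[/eqP yx|//].
  by move: yU; rewrite -xU yx !inE eqxx.
split; first exact: setUS.
by rewrite setU1K //; apply: contra xW; apply: (subsetP UW).
Qed.

(** A weak form of Hoeffding's lemma. For small [z] the bound [expR z <= 1 + z + 2 * z ^+ 2] follows
    from [(1 - z) * expR z <= 1], and the linear terms cancel; for [|y| > 1/2] both exponents are
    already at most [2 * y ^+ 2]. *)
Lemma cosh_le (y : R) : expR y + expR (- y) <= 2 * expR (2 * y ^+ 2).
Proof.
have small (z : R) : `|z| <= 1 / 2 -> expR z <= 1 + z + 2 * z ^+ 2.
  rewrite ler_norml => /andP[z1 z2].
  have e0 := expR_gt0 z; have e1 := expR_ge1Dx (- z).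
  have e2 : expR (- z) * expR z = 1 by rewrite -expRD addrC subrr expR0.
  have e3 : (1 - z) * expR z <= 1 by nra.
  have e4 : 1 <= (1 - z) * (1 + z + 2 * z ^+ 2).
    have -> : (1 - z) * (1 + z + 2 * z ^+ 2) = 1 + z ^+ 2 * (1 - 2 * z) by ring.
    have : 0 <= z ^+ 2 * (1 - 2 * z); last by lra.
    by apply: mulr_ge0; [exact: sqr_ge0 | lra].
  have : (1 - z) * expR z <= (1 - z) * (1 + z + 2 * z ^+ 2) by lra.
  by rewrite ler_pM2l //; lra.
have [yle|ylt] := lerP `|y| (1 / 2).
  have h1 := small _ yle; have h2 : `|- y| <= 1 / 2 by rewrite normrN.
  have {}h2 := small _ h2; rewrite sqrrN in h2.
  have := expR_ge1Dx (2 * y ^+ 2); lra.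
have le_abs : `|y| <= 2 * y ^+ 2.
  rewrite -[y ^+ 2]real_normK ?num_real // expr2.
  by move: ylt; set a := `|y| => ?; nra.
have [h1 h2] : expR y <= expR (2 * y ^+ 2) /\ expR (- y) <= expR (2 * y ^+ 2).
  split; rewrite ler_expR; apply: le_trans le_abs; first exact: ler_norm.
  by rewrite -normrN; apply: ler_norm.
lra.
Qed.

(** The bounded differences inequality without martingales: averaging [f] over the membership of one
    element [x] gives a function [g] on subsets of [W :\ x] with the same mean and the same
    Lipschitz constant, and [cosh_le] at [l * d / 2] pays the factor for [x]. *)
Lemma mgf_subsets W f (c l : R) : 0 <= c ->
  (forall U x, U \subset W -> x \in W -> `|f (x |: U) - f U| <= c) ->
  \sum_(U : {set V} | U \subset W) expR (l * f U) <=
  2 ^+ #|W| * expR (l * ((\sum_(U : {set V} | U \subset W) f U) / 2 ^+ #|W|)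
                    + l ^+ 2 * c ^+ 2 / 2 * #|W|%:R).
Proof.
move=> c0; elim: {W}#|W| {-2}W (erefl #|W|) f => [|m IHm] W cW f fc.
  move/eqP: cW; rewrite cards_eq0 => /eqP ->.
  rewrite !(big_pred1 finset.set0) => [|U|U]; rewrite ?subset0 //.
  by rewrite cards0 expr0 mul1r divr1 mulr0 addr0.
have /card_gt0P[x xW] : (0 < #|W|)%N by rewrite cW.
have cW' : #|W :\ x| = m.
  by move: (cardsD1 x W); rewrite xW cW add1n => -[].
have defW : W = x |: (W :\ x) by rewrite setD1K.
have xW' : x \notin W :\ x by rewrite !inE eqxx.
rewrite {1 3}defW !sum_subsets_setU1 //.
have subW U : U \subset W :\ x -> U \subset W.
  by move/subset_trans; apply; apply: subsetDl.
pose g U : R := (f U + f (x |: U)) / 2.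
have gc U y : U \subset W :\ x -> y \in W :\ x -> `|g (y |: U) - g U| <= c.
  move=> UW' /setD1P[yx yW]; rewrite /g.
  have h1 : `|f (y |: U) - f U| <= c by apply: fc => //; apply: subW.
  have h2 : `|f (y |: (x |: U)) - f (x |: U)| <= c.
    by apply: fc => //; rewrite defW; apply: setUS.
  rewrite setUCA in h2.
  by move: h1 h2; rewrite !ler_norml => /andP[? ?] /andP[? ?]; apply/andP; split; lra.
have := IHm _ cW' g gc.
have -> : (\sum_(U : {set V} | U \subset W :\ x) g U) / 2 ^+ #|W :\ x| =
  (\sum_(U : {set V} | U \subset W :\ x) (f U + f (x |: U))) / 2 ^+ #|W|.
  by rewrite -mulr_suml cW' cW exprS -mulrA -invfM.
set mu := (_ / _); rewrite cW cW'.
rewrite -(ler_pM2l (_ : 0 < 2 * expR (l ^+ 2 * c ^+ 2 / 2))); last first.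
  by rewrite mulr_gt0 ?expR_gt0.
move=> H; apply: le_trans (le_trans _ H) _; last first.
  set A := l ^+ 2 * _ / _; have -> : l * mu + A * m.+1%:R = A + (l * mu + A * m%:R).
    by rewrite -[m.+1%:R]natr1; ring.
  rewrite [in leRHS]expRD exprS; set a := expR A; set b := expR _.
  by rewrite [leLHS](_ : _ = 2 * 2 ^+ m * (a * b)) //; ring.
rewrite mulr_sumr; apply: ler_sum => U UW'.
have dc : `|f (x |: U) - f U| <= c by apply: fc; rewrite ?subW.
set d := f (x |: U) - f U in dc.
have -> : l * f U = l * g U + - (l * d / 2) by rewrite /g /d; field.
have -> : l * f (x |: U) = l * g U + l * d / 2 by rewrite /g /d; field.
rewrite !expRD -mulrDr [X in _ <= X]mulrC ler_pM2l ?expR_gt0 //.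
rewrite addrC; apply: le_trans (cosh_le _) _.
rewrite ler_pM2l // ler_expR.
have : d ^+ 2 <= c ^+ 2 by rewrite -[d ^+ 2]real_normK ?num_real // ler_sqr ?nnegrE.
have := sqr_ge0 l; nra.
Qed.

(** Markov's inequality for [expR (- l * f)], with counts in place of probabilities. *)
Lemma lower_tail_subsets W f (c l t : R) : 0 <= c -> 0 <= l ->
  (forall U x, U \subset W -> x \in W -> `|f (x |: U) - f U| <= c) ->
  #|[set U : {set V} | (U \subset W) &&
       (f U <= (\sum_(U' : {set V} | U' \subset W) f U') / 2 ^+ #|W| - t)]|%:R
    <= 2 ^+ #|W| * expR (- (l * t) + l ^+ 2 * c ^+ 2 / 2 * #|W|%:R).
Proof.
move=> c0 l0 fc; set mu := (\sum_(_ | _) _) / _.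
have /(mgf_subsets l c0) : forall U x, U \subset W -> x \in W ->
    `|- f (x |: U) - - f U| <= c.
  by move=> U x UW xW; rewrite -opprD normrN; apply: fc.
rewrite sumrN mulNr mulrN -/mu => H.
rewrite -(ler_pM2r (expR_gt0 (l * (t - mu)))) -[leRHS]mulrA -expRD.
rewrite (_ : _ + l * (t - mu) = - (l * mu) + l ^+ 2 * c ^+ 2 / 2 * #|W|%:R);
  last by ring.
apply: le_trans _ H; rewrite mulr_natl -sumr_const.
rewrite [leRHS](bigID (fun U => f U <= mu - t)) /= -[leLHS]addr0.
apply: lerD; last by apply: sumr_ge0 => U _; apply: expR_ge0.
rewrite big_set /=; apply: ler_sum => U /andP[_ fU].
by rewrite ler_expR ler_wpM2l //; lra.
Qed.

Lemma card_sup_subsets W X : X \subset W ->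
  #|[set U : {set V} | (X \subset U) && (U \subset W)]| = (2 ^ (#|W| - #|X|))%N.
Proof.
move=> XW; rewrite -(cardsDS XW) -card_powerset.
rewrite -(@card_in_imset _ _ (fun U => U :|: X) (powerset (W :\: X))).
  congr #|pred_of_set _|; apply/setP => U; rewrite !inE; apply/andP/imsetP.
    move=> [XU UW]; exists (U :\: X); first by rewrite powersetE setSD.
    by rewrite setUC setDE setUIr setUCr setIT; apply/esym/setUidPr.
  case=> U'; rewrite powersetE subsetD => /andP[UW _] ->.
  by rewrite subsetUr subUset UW.
move=> U1 U2; rewrite !powersetE !subsetD => /andP[_ d1] /andP[_ d2] E.
have : (U1 :|: X) :\: X = (U2 :|: X) :\: X by rewrite E.
rewrite !setDUl !setDv !setU0.
by move/setDidPl: d1 => ->; move/setDidPl: d2 => ->.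
Qed.

Lemma mean_subset_count W (G : {set {set V}}) b :
  (forall X, X \in G -> X \subset W /\ #|X| = b) ->
  (\sum_(U : {set V} | U \subset W) (#|[set X in G | X \subset U]|%:R : R))
    / 2 ^+ #|W| = #|G|%:R / 2 ^+ b.
Proof.
move=> GW; apply: (@mulIf _ (2 ^+ #|W|)); first by rewrite expf_neq0 ?pnatr_eq0.
rewrite divfK ?expf_neq0 ?pnatr_eq0 //.
have -> : \sum_(U : {set V} | U \subset W) (#|[set X in G | X \subset U]|%:R : R)
   = \sum_(X in G) \sum_(U : {set V} | (U \subset W)) (X \subset U)%:R.
  rewrite exchange_big /=; apply: eq_bigr => U _.
  rewrite -sum1_card natr_sum big_set big_mkcondr /=.
  by apply: eq_bigr => X _; case: ifP.
have -> : \sum_(X in G) \sum_(U : {set V} | (U \subset W)) (X \subset U)%:R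
   = \sum_(X in G) (2 ^+ (#|W| - b) : R).
  apply: eq_bigr => X /GW[XW cX].
  have := card_sup_subsets XW; rewrite cX => cc.
  have -> : 2 ^+ (#|W| - b) = (2 ^ (#|W| - b))%N%:R :> R by rewrite natrX.
  rewrite -cc -sum1_card natr_sum big_set [RHS]big_mkcondl /= -big_mkcondr /=.
  rewrite [RHS]big_mkcond [LHS]big_mkcond; apply: eq_bigr => U _.
  by case: (U \subset W); case: (X \subset U).
rewrite sumr_const -[LHS]mulr_natl.
have [->|/set0Pn[X /GW[XW cX]]] := eqVneq G finset.set0.
  by rewrite cards0 !mul0r.
have bW : (b <= #|W|)%N by rewrite -cX subset_leq_card.
have -> : 2 ^+ #|W| = 2 ^+ (#|W| - b) * 2 ^+ b :> R by rewrite -exprD subnK.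
by field; rewrite expf_neq0 ?pnatr_eq0.
Qed.

Lemma bin_le_expn n b : ('C(n, b) <= n ^ b)%N.
Proof.
rewrite -(leq_pmul2r (fact_gt0 b)) bin_ffact.
apply: (@leq_trans (n ^ b)%N); last by rewrite leq_pmulr ?fact_gt0.
elim: b => [|b IHb]; first by rewrite ffactn0.
by rewrite ffactnSr expnSr leq_mul ?leq_subr.
Qed.

Lemma card_sets_of_size_le W b (G : {set {set V}}) :
  (forall X, X \in G -> X \subset W /\ #|X| = b) -> (#|G| <= #|W| ^ b)%N.
Proof.
move=> GW; apply: leq_trans (bin_le_expn _ _); rewrite -cards_draws.
by apply: subset_leq_card; apply/subsetP => X /GW[XW cX]; rewrite inE XW cX eqxx.
Qed.

(** The sets gained all contain [x], and deleting [x] leaves distinct [b]-subsets of [W]. *)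
Lemma subset_count_lipschitz W (G : {set {set V}}) b U x :
  (forall X, X \in G -> X \subset W /\ #|X| = b.+1) ->
  `|(#|[set X in G | X \subset x |: U]|%:R : R) - #|[set X in G | X \subset U]|%:R|
    <= (#|W| ^ b)%:R.
Proof.
move=> GW.
set G1 := [set X in G | X \subset x |: U]; set G0 := [set X in G | X \subset U].
have sub : G0 \subset G1.
  apply/subsetP => X; rewrite !inE => /andP[-> /subset_trans]; apply.
  exact: subsetU1.
rewrite -natrB ?subset_leq_card // normr_nat ler_nat -cardsDS //.
have xX X : X \in G1 :\: G0 -> x \in X /\ X \in G.
  rewrite !inE => /andP[XU /andP[XG XxU]]; rewrite XG in XU *; split=> //.
  apply: contraR XU => xX /=; apply/subsetP => y yX.
  by have := subsetP XxU y yX; rewrite !inE => /orP[/eqP yx|//]; rewrite -yx yX in xX.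
rewrite -(@card_in_imset _ _ (fun X => X :\ x)); last first.
  by move=> X Y /xX[xX1 _] /xX[xY _] E; rewrite -(setD1K xX1) -(setD1K xY) E.
apply: card_sets_of_size_le => Y /imsetP[X /xX[xX1 /GW[XW cX]] ->]; split.
  by apply: subset_trans XW; apply: subsetDl.
by have := cardsD1 x X; rewrite xX1 cX add1n => -[].
Qed.

Lemma subset_count_tail W (G : {set {set V}}) b (q : R) : 0 < q -> (0 < b)%N ->
  (0 < #|W|)%N ->
  (forall X, X \in G -> X \subset W /\ #|X| = b) ->
  #|[set U : {set V} | (U \subset W) &&
      (#|[set X in G | X \subset U]|%:R <=
         (#|G|%:R / 2 ^+ b - #|W|%:R ^+ b / q : R))]|%:R
    <= 2 ^+ #|W| * expR (- (#|W|%:R / (2 * q ^+ 2))).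
Proof.
case: b => // b q0 _ W0 GW; rewrite -(mean_subset_count GW).
set m := #|W|; have m0 : 0 < m%:R :> R by rewrite ltr0n.
(* This [l] minimises the exponent [- (l * t) + l ^+ 2 * c ^+ 2 / 2 * m] for [t = m ^ b.+1 / q] and
   [c = m ^ b]; after the case split [b] is one less than the size of the sets. *)
have l0 : 0 <= (q * m%:R ^+ b)^-1 by rewrite invr_ge0 mulr_ge0 ?exprn_ge0 // ltW.
have := @lower_tail_subsets W (fun U => #|[set X in G | X \subset U]|%:R)
  (m ^ b)%:R _ (m%:R ^+ b.+1 / q) (ler0n _ _) l0.
move=> /(_ (fun U x _ _ => subset_count_lipschitz U x GW)) /le_trans; apply.
rewrite ler_pM2l ?exprn_gt0 // ler_expR natrX exprS -/m.
rewrite [leLHS](_ : _ = - (m%:R / (2 * q ^+ 2))) //.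
have mb0 : m%:R ^+ b != 0 :> R by rewrite expf_neq0 // lt0r_neq0.
by field; rewrite mb0 lt0r_neq0.
Qed.

Lemma subset_count_tailC W (G : {set {set V}}) b (q : R) : 0 < q -> (0 < b)%N ->
  (0 < #|W|)%N ->
  (forall X, X \in G -> X \subset W /\ #|X| = b) ->
  #|[set U : {set V} | (U \subset W) &&
      (#|[set X in G | X \subset W :\: U]|%:R <=
         (#|G|%:R / 2 ^+ b - #|W|%:R ^+ b / q : R))]|%:R
    <= 2 ^+ #|W| * expR (- (#|W|%:R / (2 * q ^+ 2))).
Proof.
move=> q0 b0 W0 GW; apply: le_trans _ (subset_count_tail q0 b0 W0 GW).
rewrite ler_nat -(@card_in_imset _ _ (fun U => W :\: U)).
  apply: subset_leq_card; apply/subsetP => U' /imsetP[U].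
  by rewrite !inE => /andP[UW H] ->; rewrite subsetDl.
move=> U1 U2; rewrite !inE => /andP[U1W _] /andP[U2W _] E.
have := congr1 (fun U => W :\: U) E.
by rewrite /= !setDDr !setDv !set0U (setIidPr U1W) (setIidPr U2W).
Qed.

End RandomSubset.

(** * Half-sized subsets with even trace *)

Section HalfSizedSubsets.
Variable V : finType.
Implicit Types (U W A X : {set V}).

Lemma leq_bin_mid m j : (j.*2 < m)%N -> ('C(m, j) <= 'C(m, j.+1))%N.
Proof.
move=> jm; rewrite -(leq_pmul2l (ltn0Sn j)) mul_bin_left leq_mul2r.
by apply/orP; right; lia.
Qed.

Lemma bin_le_mid m j : ('C(m, j) <= 'C(m, m./2))%N.
Proof.
have low i d : (i + d = m./2)%N -> ('C(m, i) <= 'C(m, m./2))%N.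
  elim: d i => [|d IHd] i e; first by rewrite -e addn0.
  apply: leq_trans (leq_bin_mid _) (IHd i.+1 _); lia.
have [jm|jm] := leqP j m./2; first by apply: (low _ (m./2 - j)%N); rewrite subnKC.
have [jm'|jm'] := leqP j m; last by rewrite bin_small.
rewrite -bin_sub //; apply: (low _ (m./2 - (m - j))%N); lia.
Qed.

(** The central coefficient is at least 2^m / (m + 1), and each of the at most [i] steps from the
    middle to [h] costs a factor of at most m + 1. *)
Lemma expn2_le_bin_near_mid m h i :
  (h <= m)%N -> (m <= h.*2 + i.*2)%N -> (h.*2 <= m + i.*2)%N ->
  (2 ^ m <= m.+1 ^ i.+1 * 'C(m, h))%N.
Proof.
move=> hm h1 h2.
have tot : (2 ^ m <= m.+1 * 'C(m, m./2))%N.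
  have -> : (2 ^ m = \sum_(j < m.+1) 'C(m, j))%N.
    rewrite -[2%N]/(1 + 1)%N expnDn; apply: eq_bigr => j _.
    by rewrite !exp1n !muln1.
  rewrite -[X in (_ <= X * _)%N]card_ord -sum_nat_const.
  by apply: leq_sum => j _; apply: bin_le_mid.
have step d g : (g <= m)%N -> (m <= g.*2 + d.*2.+1)%N -> (g.*2 <= m + d.*2)%N ->
    ('C(m, m./2) <= m.+1 ^ d * 'C(m, g))%N.
  elim: d g => [|d IHd] g gm g1 g2.
    have -> : g = m./2 by lia.
    by rewrite expn0 mul1n.
  have [/eqP gE|gE] := boolP (g == m./2).
    by rewrite gE leq_pmull // expn_gt0.
  have [gm2|gm2] := ltnP g m./2.
    apply: leq_trans (IHd g.+1 _ _ _) _; [lia | lia | lia |].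
    rewrite expnSr -mulnA leq_mul2l; apply/orP; right.
    have := mul_bin_left m g; nia.
  have g0 : (0 < g)%N by lia.
  apply: leq_trans (IHd g.-1 _ _ _) _; [lia | lia | lia |].
  rewrite expnSr -mulnA leq_mul2l; apply/orP; right.
  have := mul_bin_left m g.-1; rewrite (prednK g0); nia.
apply: leq_trans tot _; rewrite expnS -mulnA leq_mul2l /=.
by apply: step => //; lia.
Qed.

(** Exchanging [x] for [y] flips the parity of [|U :&: A|]. An even [U] with an odd trace has
    vertices on both sides of [A], so any [y] of [W] outside [U] has a partner in [U]. *)
Lemma swap_parity W A U : U \subset W -> ~~ odd #|U| -> (#|U| < #|W|)%N ->
  odd #|U :&: A| ->
  exists x y, [/\ x \in U, y \in W, y \notin U & (x \in A) != (y \in A)].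
Proof.
move=> UW evU ltUW oddUA.
have [x] : exists x, x \in U :&: A.
  by apply/set0Pn; apply: contraTneq oddUA => ->; rewrite cards0.
rewrite inE => /andP[xU xA].
have [|] := set_0Vmem ((W :\: A) :\: U); last first.
  move=> [y]; rewrite !inE => /and3P[yU yA yW].
  by exists x, y; rewrite xU yW yU xA (negPf yA).
move=> WAU.
have [z] : exists z, z \in U :\: A.
  apply/set0Pn; apply: contraNneq evU => UA0.
  by rewrite -(cardsID A U) UA0 cards0 addn0.
rewrite inE => /andP[zA zU].
have /set0Pn[y] : W :\: U != finset.set0.
  by rewrite -card_gt0 cardsDS // subn_gt0.
rewrite inE => /andP[yU yW].
have yA : y \in A.
  apply: contraT => yA; have : y \in (W :\: A) :\: U by rewrite !inE yU yA yW.
  by rewrite WAU inE.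
by exists z, y; rewrite zU yW yU yA (negPf zA).
Qed.

Definition even_halves W A h : {set {set V}} :=
  [set U : {set V} | [&& U \subset W, #|U| == h & ~~ odd #|U :&: A|]].

(** Every [h]-set of odd trace is one exchange away from a set of even trace, and there are at most
    [|W|^2] exchanges: prescribing the parity costs only a polynomial factor. *)
Lemma card_even_halves W A h : ~~ odd h -> (h < #|W|)%N ->
  ('C(#|W|, h) <= #|W|.+1 ^ 2 * #|even_halves W A h|)%N.
Proof.
move=> evh hW; rewrite -cards_draws.
set all := [set B : {set V} | (B \subset W) && (#|B| == h)]; set ev := even_halves W A h.
have sub : all \subset ev :|:
    [set u.1.1 |: (u.2 :\ u.1.2) | u in setX (setX W W) ev].
  apply/subsetP => U; rewrite !inE => /andP[UW /eqP cU]; rewrite UW cU eqxx /=.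
  have [oddU /=|//] := boolP (odd _).
  have [||x [y [xU yW yU xyA]]] := swap_parity UW _ _ oddU; rewrite ?cU //.
  have xy : x != y by apply: contraNneq yU => <-.
  apply/imsetP; exists ((x, y), y |: (U :\ x)); last first.
    apply/setP => z; rewrite !inE /=; have [->//|zx] := eqVneq z x.
    by have [->|//] := eqVneq z y; rewrite (negPf yU).
  rewrite !inE /= (subsetP UW _ xU) yW /=; apply/and3P; split.
  - by rewrite subUset sub1set yW (subset_trans (subsetDl _ _) UW).
  - have := cardsD1 x U; rewrite xU cU => ->.
    by rewrite cardsU1 !inE (negPf yU) andbF.
  - have c1 : (#|(y |: U :\ x) :&: A| + (x \in A) = #|U :&: A| + (y \in A))%N.
      rewrite setIUl.
      have dis : [disjoint [set y] :&: A & (U :\ x) :&: A].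
        rewrite -setI_eq0; apply/eqP/setP => z; rewrite !inE.
        by have [->|//] := eqVneq z y; rewrite (negPf yU) !andbF.
      rewrite cardsU (disjoint_setI0 dis) cards0 subn0.
      have -> : #|[set y] :&: A| = (y \in A).
        have [yA|yA] := boolP (y \in A).
          by rewrite (setIidPl _) ?sub1set ?cards1.
        by rewrite disjoint_setI0 ?cards0 // disjoints1.
      rewrite [in RHS](cardsD1 x) !inE xU /= -addnA [RHS]addnC; congr (_ + _)%N.
      by rewrite setIDAC addnC.
    move/(congr1 odd): c1; rewrite !oddD oddU /=.
    by move: xyA; case: (x \in A); case: (y \in A); case: (odd _).
apply: leq_trans (subset_leq_card sub) _.
apply: leq_trans (leq_card_setU _ _) _.
have := leq_imset_card (fun u => u.1.1 |: (u.2 :\ u.1.2)) (setX (setX W W) ev).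
rewrite !cardsX => H; apply: leq_trans (leq_add (leqnn _) H) _.
rewrite -{1}[#|ev|]mul1n -mulnDl leq_mul2r expnS expn1; apply/orP; right; nia.
Qed.

Lemma card_small_subsets W D :
  (#|[set S : {set V} | (S \subset W) && (#|S| <= D)]| <= #|W|.+1 ^ D)%N.
Proof.
elim: D => [|D IHD].
  rewrite expn0 -(cards1 (finset.set0 : {set V})); apply: subset_leq_card.
  by apply/subsetP => S; rewrite !inE leqn0 cards_eq0 => /andP[].
have -> : [set S : {set V} | (S \subset W) && (#|S| <= D.+1)%N] =
  [set S : {set V} | (S \subset W) && (#|S| <= D)%N] :|:
  [set S : {set V} | (S \subset W) && (#|S| == D.+1)].
  by apply/setP => S; rewrite !inE leq_eqVlt ltnS orbC andb_orr.
apply: leq_trans (leq_card_setU _ _) _; apply: leq_trans (leq_add IHD _) _.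
  by apply: (@card_sets_of_size_le _ W D.+1) => X; rewrite inE => /andP[? /eqP].
have : (#|W| ^ D <= #|W|.+1 ^ D)%N by case: (D) => // d; rewrite leq_exp2r.
rewrite !expnS; nia.
Qed.

End HalfSizedSubsets.

(** * Counting matchings by random halving *)

Section InnerMatchings.
Variables (V : finType) (k : nat) (E : {set {set V}}).
Hypotheses (k_gt0 : (0 < k)%N) (uniE : uniform k E).
Implicit Types (U W : {set V}) (M : {set {set V}}).

(** Optimal matchings of the hypergraph induced on [W], kept as families of subsets of [V], so that
    the recursion never changes the vertex type. *)
Definition inner_matchings W : {set {set {set V}}} :=
  [set M : {set {set V}} | [&& M \subset E, trivIset M, cover M \subset W
                             & #|M| == #|W| %/ k]%N].

Lemma card_edge e : e \in E -> #|e| = k.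
Proof. by move=> eE; apply/eqP; apply: (forall_inP uniE). Qed.

Lemma card_cover_edges M : M \subset E -> trivIset M -> #|cover M| = (#|M| * k)%N.
Proof.
move=> ME tM; apply: card_uniform_partition; last first.
  rewrite /partition eqxx tM /=; apply: contraL (k_gt0) => /(subsetP ME).
  by move/card_edge; rewrite cards0 => <-.
by move=> e /(subsetP ME)/card_edge.
Qed.

Lemma disjoint_matchings M1 M2 : M1 \subset E -> [disjoint cover M1 & cover M2] ->
  [disjoint M1 & M2].
Proof.
move=> M1E dis; rewrite -setI_eq0; apply: contraLR dis => /set0Pn[e].
rewrite inE => /andP[e1 e2]; have /card_gt0P[x xe] : (0 < #|e|)%N.
  by rewrite (card_edge (subsetP M1E _ e1)).
rewrite -setI_eq0; apply/set0Pn; exists x; rewrite inE.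
by apply/andP; split; apply/bigcupP; exists e.
Qed.

Lemma matching_setU M1 M2 : M1 \subset E -> trivIset M1 ->
  M2 \subset E -> trivIset M2 -> [disjoint cover M1 & cover M2] ->
  [/\ M1 :|: M2 \subset E, trivIset (M1 :|: M2),
      cover (M1 :|: M2) = cover M1 :|: cover M2
    & #|M1 :|: M2| = (#|M1| + #|M2|)%N].
Proof.
move=> M1E t1 M2E t2 dis; split.
- by rewrite subUset M1E.
- exact: trivIsetU.
- by rewrite /cover bigcup_setU.
- by rewrite cardsU disjoint_setI0 ?cards0 ?subn0 // disjoint_matchings.
Qed.

(** [M2] lives on [W :\: cover M1] and not on [W :\: U]: the vertices of [U] missed by [M1] are used
    again, so no edge is lost to rounding. *)
Lemma inner_matchings_setU W U M1 M2 : U \subset W -> #|U| = #|W| %[mod k] ->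
  M1 \in inner_matchings U -> M2 \in inner_matchings (W :\: cover M1) ->
  M1 :|: M2 \in inner_matchings W /\ [disjoint M1 & M2].
Proof.
move=> UW mUW; rewrite !inE => /and4P[M1E t1 c1 /eqP n1] /and4P[M2E t2 c2 /eqP n2].
have dis : [disjoint cover M1 & cover M2].
  rewrite disjoint_sym; apply: disjointWl c2 _; rewrite -setI_eq0.
  by rewrite setIDAC setDIl setDv setI0.
have [-> -> -> ->] := matching_setU M1E t1 M2E t2 dis.
split; last exact: disjoint_matchings.
have c1W := subset_trans c1 UW.
rewrite subUset c1W (subset_trans c2 (subsetDl _ _)) /= n2 n1.
rewrite cardsDS // card_cover_edges // n1.
have le1 := leq_divM #|U| k; have leUW := subset_leq_card UW.
rewrite -(divnMDl _ _ k_gt0) subnKC //; exact: leq_trans leUW.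
Qed.

(* The union of [M] and a matching of the rest determines [M] up to [2 ^ (#|W| %/ k)] choices, and
   [M] determines [U] up to the choice of its vertices missed by [M]. *)
Lemma card_inner_matchings_ge W h (Us : {set {set V}}) : h = #|W| %[mod k] ->
  (forall U, U \in Us -> U \subset W /\ #|U| = h) ->
  (\sum_(U in Us) \sum_(M in inner_matchings U)
      #|inner_matchings (W :\: cover M)| <=
   #|W|.+1 ^ (#|W| %% k) * (2 ^ (#|W| %/ k) * #|inner_matchings W|))%N.
Proof.
move=> hW UsW.
pose Ms := [set M : {set {set V}} | [&& M \subset E, trivIset M, cover M \subset W
                             & #|M| == h %/ k]%N].
have fibU M : M \in Ms ->
    (#|[set U in Us | M \in inner_matchings U]| <= #|W|.+1 ^ (#|W| %% k))%N.
  rewrite inE => /and4P[ME tM cM /eqP nM].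
  rewrite -(@card_in_imset _ _ (fun U => U :\: cover M)); last first.
    move=> U1 U2; rewrite !inE => /and5P[_ _ _ c1 _] /and5P[_ _ _ c2 _] EU.
    by rewrite -(setID U1 (cover M)) -(setID U2 (cover M)) EU !(setIidPr _).
  apply: leq_trans (_ : #|W| ^ (#|W| %% k) <= _)%N; last first.
    by case: (_ %% _)%N => // d; rewrite leq_exp2r.
  apply: card_sets_of_size_le => X /imsetP[U]; rewrite !inE.
  move=> /and5P[/UsW[UW cU] _ _ c1 _] ->; split.
    by rewrite (subset_trans (subsetDl _ _) UW).
  by rewrite cardsDS // card_cover_edges // nM cU -hW {1}(divn_eq h k) addKn.
have memMs U M : U \in Us -> M \in inner_matchings U -> M \in Ms.
  move=> /UsW[UW cU]; rewrite !inE cU => /and4P[-> -> cM ->].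
  by rewrite (subset_trans cM UW).
rewrite (exchange_big_dep (mem Ms)) /=; last by move=> U M; apply: memMs.
(* The sum now runs over [M]. A matching lying in no [U] of [Us] is given no continuation, so that
   [inner_matchings_setU] applies to every pair counted. *)
apply: (@leq_trans (\sum_(M in Ms) #|W|.+1 ^ (#|W| %% k) *
   #|if [exists U in Us, M \in inner_matchings U]
     then inner_matchings (W :\: cover M) else finset.set0|)%N).
  apply: leq_sum => M MMs; rewrite sum_nat_const.
  have -> : #|[pred U | (U \in Us) && (M \in inner_matchings U)]|
     = #|[set U in Us | M \in inner_matchings U]|.
    by apply: eq_card => U; rewrite !inE.
  case: ifP => [_|/negbT noU]; first by rewrite leq_mul2r fibU ?orbT.
  rewrite (_ : [set _ in _ | _] = finset.set0) ?cards0 //.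
  apply/setP => U; rewrite !inE; apply/negbTE; apply: contra noU => /andP[UUs MU].
  by apply/existsP; exists U; rewrite UUs inE.
rewrite -big_distrr /= leq_mul2l; apply/orP; right.
pose P := [set u : {set {set V}} * {set {set V}} | (u.1 \in Ms) &&
  (u.2 \in if [exists U in Us, u.1 \in inner_matchings U]
     then inner_matchings (W :\: cover u.1) else finset.set0)].
have -> : (\sum_(M in Ms)
   #|if [exists U in Us, M \in inner_matchings U]
     then inner_matchings (W :\: cover M) else finset.set0| = #|P|)%N.
  under eq_bigr do rewrite -sum1_card.
  by rewrite pair_big_dep /= -sum1_card; apply: eq_bigl => u; rewrite !inE.
pose Q := [set u : {set {set V}} * {set {set V}} |
   (u.1 \in inner_matchings W) && (u.2 \subset u.1)].
have Pdis u : u \in P -> u.1 :|: u.2 \in inner_matchings W /\ [disjoint u.1 & u.2].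
  rewrite inE => /andP[u1]; case: ifP; last by rewrite inE.
  case/existsP => U /andP[/UsW[UW cU] uU] u2.
  by apply: (inner_matchings_setU UW) => //; rewrite cU.
apply: (@leq_trans #|Q|).
  rewrite -(@card_in_imset _ _ (fun u => (u.1 :|: u.2, u.1))); last first.
    move=> [a1 b1] [a2 b2] /Pdis[_ /= d1] /Pdis[_ /= d2] [EU Ea]; subst a2.
    congr (_, _); have := congr1 (fun M => M :\: a1) EU; rewrite /= !setDUl setDv !set0U.
    by rewrite !(setDidPl _) // disjoint_sym.
  apply: subset_leq_card; apply/subsetP => w /imsetP[u /Pdis[uM _] ->].
  by rewrite inE /= uM subsetUl.
rewrite -[#|Q|]sum1_card.
have -> : (\sum_(u in Q) 1 =
   \sum_(M in inner_matchings W) \sum_(M' : {set {set V}} | M' \subset M) 1)%N.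
  by rewrite pair_big_dep /=; apply: eq_bigl => u; rewrite inE.
rewrite mulnC -sum_nat_const; apply: leq_sum => M.
rewrite inE => /and4P[_ _ _ /eqP <-]; rewrite sum1_card -card_powerset.
by apply: subset_leq_card; apply/subsetP => M'; rewrite powersetE.
Qed.

End InnerMatchings.

(** * Elementary estimates for the recursion *)

Section Asymptotics.
Variable R : realType.

Lemma exists_nat_ge (x : R) : exists n, x <= n%:R.
Proof.
exists (Num.bound `|x|); apply: le_trans (ler_norm _) _.
exact/ltW/archi_boundP/normr_ge0.
Qed.

(** One term of the exponential series is enough: the power [2 * (a + 1)] of [eps * Num.sqrt m] is a
    constant times [m ^ (a + 1)]. *)
Lemma poly_le_expR_sqrt (a : nat) (C eps : R) : 0 < eps ->
  exists n1, forall m, (n1 <= m)%N ->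
    C * (m%:R + 1) ^+ a <= expR (eps * Num.sqrt m%:R).
Proof.
move=> e0; pose F : R := ((a.+1).*2)`!%:R.
have F0 : 0 < F by rewrite ltr0n fact_gt0.
have [n1 n1P] := exists_nat_ge (`|C| * F * 2 ^+ a / eps ^+ (a.+1).*2).
exists n1.+1 => m n1m; have m1 : 1 <= m%:R :> R.
  by rewrite ler1n; apply: leq_trans n1m.
set x := eps * _; have x0 : 0 <= x by rewrite mulr_ge0 ?sqrtr_ge0 // ltW.
have := expR_ge1Dxn (a.+1).*2.-1 x0; rewrite prednK ?double_gt0 // -/F => H.
apply: le_trans (le_trans _ H); last first.
  by rewrite [_ ^+ _ / F](_ : _ = x ^+ (a.+1).*2 / F).
have -> : x ^+ (a.+1).*2 = eps ^+ (a.+1).*2 * m%:R ^+ a.+1.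
  rewrite /x exprMn; congr (_ * _).
  by rewrite -mul2n exprM sqr_sqrtr ?ler0n.
have ep0 : 0 < eps ^+ (a.+1).*2 by rewrite exprn_gt0.
have h1 : (m%:R + 1) ^+ a <= 2 ^+ a * m%:R ^+ a :> R.
  rewrite -exprMn lerXn2r ?nnegrE //; lra.
have h2 : `|C| * F * 2 ^+ a / eps ^+ (a.+1).*2 <= m%:R.
  by apply: le_trans n1P _; rewrite ler_nat ltnW.
rewrite ler_pdivrMr // in h2.
have h3 : C * (m%:R + 1) ^+ a <= `|C| * (2 ^+ a * m%:R ^+ a).
  apply: le_trans (_ : `|C| * (m%:R + 1) ^+ a <= _).
    by rewrite ler_wpM2r ?ler_norm // exprn_ge0 //; lra.
  by rewrite ler_wpM2l.
apply: le_trans h3 _; rewrite -[leLHS]add0r; apply: lerD => //.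
rewrite ler_pdivlMr // exprS.
have ma0 : 0 <= m%:R ^+ a :> R by rewrite exprn_ge0 // ler0n.
have -> : `|C| * (2 ^+ a * m%:R ^+ a) * F = (`|C| * F * 2 ^+ a) * m%:R ^+ a by ring.
have -> : eps ^+ (a.+1).*2 * (m%:R * m%:R ^+ a) =
  (m%:R * eps ^+ (a.+1).*2) * m%:R ^+ a by ring.
by rewrite ler_wpM2r.
Qed.

(** By convexity of [x ln x]: the left-hand side is its tangent at [a]. *)
Lemma xlnx_ge (x a : R) : 0 < x -> 0 < a -> x * ln a + x - a <= x * ln x.
Proof.
move=> x0 a0; have := le_ln1Dx (x := a / x - 1) _.
have -> : 1 + (a / x - 1) = a / x by ring.
have /[swap] /[apply] : -1 < a / x - 1 by have := divr_gt0 a0 x0; lra.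
rewrite ln_div ?posrE // => H.
have : x * (ln a - ln x) <= x * (a / x - 1) by rewrite ler_wpM2l // ltW.
have -> : x * (a / x - 1) = a - x by field; rewrite lt0r_neq0.
lra.
Qed.

Lemma xlnx_convex (x y : R) : 0 < x -> 0 < y ->
  (x + y) * ln ((x + y) / 2) <= x * ln x + y * ln y.
Proof.
move=> x0 y0; have a0 : 0 < (x + y) / 2 by lra.
have := xlnx_ge x0 a0; have := xlnx_ge y0 a0; lra.
Qed.

(** The fluctuation scale: deviations of relative size [1 / qrt m] have probability about
    [expR (- Num.sqrt m / 2)], small enough for a union bound over polynomially many roots, and they
    are summable along the halvings. *)
Definition qrt (m : nat) : R := Num.sqrt (Num.sqrt m%:R).

Lemma qrt_gt0 m : (0 < m)%N -> 0 < qrt m.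
Proof. by move=> m0; rewrite !sqrtr_gt0 ltr0n. Qed.

Lemma qrt_sqr m : qrt m ^+ 2 = Num.sqrt m%:R.
Proof. by rewrite sqr_sqrtr ?sqrtr_ge0. Qed.

Lemma qrt_exp4 m : qrt m ^+ 4 = m%:R.
Proof. by rewrite (exprM _ 2 2) qrt_sqr sqr_sqrtr ?ler0n. Qed.

Lemma le_qrt (x : R) m : 0 <= x -> (x <= qrt m) = (x ^+ 4 <= m%:R).
Proof. by move=> x0; rewrite -qrt_exp4 ler_pXn2r // nnegrE ?sqrtr_ge0. Qed.

(** Because (9/10)^4 > 3/5. *)
Lemma qrt_shrink m m1 : (5 * m1 <= 3 * m)%N -> qrt m1 <= 9 / 10 * qrt m.
Proof.
move=> h; have : qrt m1 ^+ 4 <= (9 / 10 * qrt m) ^+ 4.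
  rewrite exprMn !qrt_exp4.
  have : 5 * m1%:R <= 3 * m%:R :> R by rewrite -!natrM ler_nat.
  have := ler0n R m1; have := ler0n R m; lra.
rewrite ler_pXn2r // nnegrE ?sqrtr_ge0 //.
by apply: mulr_ge0; rewrite ?sqrtr_ge0 //; lra.
Qed.

(** The factor 9 matches [qrt_shrink]: one halving multiplies the slack by at least 10/9, that is,
    raises it by at least [(1 + 2 ^+ r) / qrt m], which is what [half_density] spends. *)
Definition slack (r m : nat) : R := 9 * (1 + 2 ^+ r) / qrt m.

Lemma slack_ge0 r m : 0 <= slack r m.
Proof.
apply: divr_ge0; last exact: sqrtr_ge0.
by apply: mulr_ge0 => //; apply: addr_ge0 => //; apply: exprn_ge0.
Qed.

Lemma exp1Dx_le (x : R) b : 0 <= x -> x <= 1 -> (1 + x) ^+ b <= 1 + 2 ^+ b * x.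
Proof.
move=> x0 x1; suff : (1 + x) ^+ b <= 1 + (2 ^+ b - 1) * x by lra.
elim: b => [|b IHb]; first by rewrite !expr0; lra.
rewrite !exprS; have : 1 <= 2 ^+ b :> R by rewrite exprn_ege1 // ler1n.
move: IHb; set t := 2 ^+ b; set u := (1 + x) ^+ b => h t1.
have h2 : (1 + x) * u <= (1 + x) * (1 + (t - 1) * x) by rewrite ler_wpM2l //; lra.
apply: le_trans h2 _.
have : (t - 1) * (x * (1 - x)) >= 0 by rewrite mulr_ge0 ?mulr_ge0 //; lra.
lra.
Qed.

(** [N] and [N'] count extensions in [W] and in its half. Relative to [(m / 2) ^+ b], the
    fluctuation costs at most [2 ^+ r / qrt m] and the excess of [m1] over [m / 2] at most
    [1 / qrt m]; together they stay within the increase of the slack. A negative left-hand side is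
    trivial, as [0 <= N']. *)
Lemma half_density (k r b m m1 : nat) (theta N N' : R) :
  (b <= r)%N -> theta <= 1 -> (0 < m1)%N -> (m1.*2 <= m + 6 * k)%N ->
  (30 * k <= m)%N -> (2 ^ r * (6 * k)) %:R <= qrt m -> 1 <= qrt m ->
  (theta - slack r m) * m%:R ^+ b <= N ->
  N / 2 ^+ b - m%:R ^+ b / qrt m <= N' -> 0 <= N' ->
  (theta - slack r m1) * m1%:R ^+ b <= N'.
Proof.
move=> br th1 m1gt0 m1le mk.
have m0 : (0 < m)%N by lia.
have m1m : (5 * m1 <= 3 * m)%N by lia.
have km : (6 * k <= m)%N by lia.
have m1m' : (m1 * 2 <= m + 6 * k)%N by lia.
move=> qK q1 NN NN' N'0.
have q0 := qrt_gt0 m0; have q10 := qrt_gt0 m1gt0.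
have mR0 : 0 < m%:R :> R by rewrite ltr0n.
have [zle|zgt] := lerP (theta - slack r m1) 0.
  by apply: le_trans N'0; rewrite mulr_le0_ge0 // exprn_ge0 // ler0n.
pose t : R := 2 ^+ r; have t1 : 1 <= t by rewrite exprn_ege1 // ler1n.
pose y := theta - slack r m.
pose iq := (qrt m)^-1; have iq0 : 0 < iq by rewrite invr_gt0.
have sl : slack r m = 9 * (1 + t) * iq by [].
have sl1 : 10 * (1 + t) * iq <= slack r m1.
  have h : qrt m1 <= 9 / 10 * qrt m by apply: qrt_shrink.
  rewrite /slack -/t ler_pdivlMr //.
  have : iq * qrt m1 <= 9 / 10.
    have e : iq * qrt m = 1 by rewrite mulVf // lt0r_neq0.
    have : iq * qrt m1 <= iq * (9 / 10 * qrt m) by rewrite ler_wpM2l // ltW.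
    lra.
  by move=> h2; rewrite -mulrA; nra.
pose z := theta - slack r m1.
have z1 : z <= 1 by rewrite /z; have := slack_ge0 r m1; lra.
have zy : z <= y - (1 + t) * iq by rewrite /z /y sl; lra.
pose x : R := (6 * k)%:R / m%:R.
have x0 : 0 <= x by rewrite divr_ge0 ?ler0n.
have x1 : x <= 1 by rewrite ler_pdivrMr // mul1r ler_nat.
pose Mb : R := (m%:R / 2) ^+ b.
have Mb0 : 0 <= Mb by rewrite exprn_ge0 // divr_ge0 // ltW.
have m1b : m1%:R ^+ b <= Mb * (1 + t * x).
  apply: le_trans (_ : (m%:R / 2 * (1 + x)) ^+ b <= _).
    rewrite lerXn2r ?nnegrE ?ler0n //; first by rewrite mulr_ge0 ?divr_ge0 //; lra.
    have -> : m%:R / 2 * (1 + x) = (m%:R + (6 * k)%:R) / 2.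
      by rewrite /x; field; rewrite lt0r_neq0.
    by rewrite ler_pdivlMr // -natrD -[2]/(2%:R) -natrM ler_nat.
  rewrite exprMn ler_wpM2l //; apply: le_trans (exp1Dx_le b x0 x1) _.
  by rewrite lerD2l ler_wpM2r // /t ler_weXn2l // ler1n.
have tx : t * x <= iq.
  have e : t * x = (2 ^ r * (6 * k))%:R / m%:R by rewrite natrM natrX mulrA.
  rewrite e ler_pdivrMr //; apply: le_trans qK _.
  rewrite -qrt_exp4 /iq -[leLHS]mul1r.
  have -> : (qrt m)^-1 * qrt m ^+ 4 = qrt m ^+ 2 * qrt m.
    by field; rewrite lt0r_neq0.
  by rewrite ler_wpM2r ?(ltW q0) // exprn_ege1.
have e2 : N / 2 ^+ b >= y * Mb.
  rewrite /Mb expr_div_n mulrA ler_wpM2r // invr_ge0 exprn_ge0 //.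
have e3 : m%:R ^+ b / qrt m = Mb * (2 ^+ b * iq).
  rewrite /Mb expr_div_n /iq; field.
  by rewrite lt0r_neq0 // expf_neq0 // pnatr_eq0.
have e4 : 2 ^+ b <= t by rewrite /t ler_weXn2l // ler1n.
apply: le_trans NN'; rewrite e3.
apply: le_trans (_ : y * Mb - Mb * (2 ^+ b * iq) <= _); last by rewrite lerD2r.
apply: le_trans (_ : z * (Mb * (1 + t * x)) <= _); first by rewrite ler_wpM2l // ltW.
have -> : y * Mb - Mb * (2 ^+ b * iq) = Mb * (y - 2 ^+ b * iq) by ring.
rewrite mulrCA ler_wpM2l //.
have e5 : 2 ^+ b * iq <= t * iq by rewrite ler_wpM2r // ltW.
have e6 : z * (t * x) <= 1 * (t * x) by rewrite ler_wpM2r // mulr_ge0 //; lra.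
lra.
Qed.

(* The term [c * sqrt m] pays for the polynomial factors lost in each halving. *)
Definition target (k : nat) (c : R) (m : nat) : R :=
  (1 - 1 / k%:R) * m%:R * ln m%:R - c * m%:R + c * Num.sqrt m%:R.

Lemma sqrt_ge_part (m m1 : nat) (u : R) : 0 <= u -> u ^+ 2 * m%:R <= m1%:R ->
  u * Num.sqrt m%:R <= Num.sqrt m1%:R.
Proof.
move=> u0 h; rewrite -[u](ger0_norm u0) -sqrtr_sqr -sqrtrM ?sqr_ge0 //.
exact: ler_wsqrtr.
Qed.

(** Convexity of [x ln x] yields the main term, and [2 ^+ (m %/ k)] takes at most the share [1 / k]
    of the exponent of [2 ^+ m]. Both parts have at least [2 * m / 5] vertices, so their square
    roots add up to at least [126/100 * sqrt m]. The surplus [26/100 * c * sqrt m] covers the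
    polynomial factor and the [c * s] lost because the parts share [s] vertices. *)
Lemma target_step (k p : nat) : (0 < k)%N ->
  exists n1, forall c m m1 m2 s, 1 <= c -> (n1 <= m)%N -> (s < k)%N ->
    (m1 + m2 = m + s)%N -> (m <= m1.*2 + 4 * k)%N -> (m <= m2.*2 + 4 * k)%N ->
    2 * (m%:R + 1) ^+ p * 2 ^+ (m %/ k) * expR (target k c m) <=
    2 ^+ m * (expR (target k c m1) * expR (target k c m2)).
Proof.
move=> k0.
have [|n1 n1P] := @poly_le_expR_sqrt p (2 * expR k%:R) (1 / 4); first by lra.
exists (maxn (20 * k) n1) => c m m1 m2 s c1; rewrite geq_max => /andP[mk nm] sk m12 hm1 hm2.
have m0 : (0 < m)%N by lia.
have m10 : (0 < m1)%N by lia.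
have m20 : (0 < m2)%N by lia.
have m1m : (4 * m <= 10 * m1)%N by lia.
have m2m : (4 * m <= 10 * m2)%N by lia.
have m_ge2 : (2 <= m)%N by lia.
pose L2 : R := ln 2; have eL2 : expR L2 = 2 by rewrite lnK // posrE.
have L20 : 0 <= L2 by rewrite ln_ge0 // ler1n.
pose Q : R := Num.sqrt m%:R.
have H0 : 2 * (m%:R + 1) ^+ p <= expR (1 / 4 * Q - k%:R).
  rewrite expRB ler_pdivlMr ?expR_gt0 //.
  by apply: le_trans _ (n1P _ nm); rewrite mulrAC.
have Q1 : 0 <= 1 / 4 * Q - k%:R.
  rewrite -ler_expR expR0; apply: le_trans _ H0.
  have : 1 <= (m%:R + 1) ^+ p :> R by apply: exprn_ege1; have := ler0n R m; lra.
  lra.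
rewrite -eL2 -!expRM_natl -!expRD.
have -> : expR L2 * (m%:R + 1) ^+ p = 2 * (m%:R + 1) ^+ p by rewrite eL2.
rewrite -mulrA -expRD; apply: le_trans (ler_wpM2r (expR_ge0 _) H0) _.
rewrite -expRD ler_expR.
pose kap : R := 1 - 1 / k%:R.
have kR : 1 <= k%:R :> R by rewrite ler1n.
have kap0 : 0 <= kap by rewrite subr_ge0 ler_pdivrMr ?mul1r //; lra.
have mdivk : (m %/ k)%:R * L2 <= (1 - kap) * (m%:R * L2).
  rewrite /kap opprB addrC subrK mulrA ler_wpM2r //.
  rewrite mul1r mulrC ler_pdivlMr; last by lra.
  by rewrite -natrM ler_nat leq_divM.
have mR : 1 <= m%:R / 2 :> R.
  by rewrite ler_pdivlMr // mul1r ler_nat.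
have xy : m1%:R + m2%:R = m%:R + s%:R :> R by rewrite -!natrD m12.
have sR : s%:R <= k%:R :> R by rewrite ler_nat ltnW.
have m1R : 0 < m1%:R :> R by rewrite ltr0n.
have m2R : 0 < m2%:R :> R by rewrite ltr0n.
have conv : kap * (m%:R * ln m%:R - m%:R * L2) <=
            kap * (m1%:R * ln m1%:R + m2%:R * ln m2%:R).
  rewrite ler_wpM2l //; apply: le_trans (xlnx_convex m1R m2R).
  rewrite -mulrBr -ln_div ?posrE ?ltr0n // xy.
  have s0 := ler0n R s.
  apply: ler_pM; [exact: ler0n | exact: ln_ge0 | by lra |].
  by rewrite ler_ln ?posrE //; lra.
have q1 : 63 / 100 * Q <= Num.sqrt m1%:R.
  apply: sqrt_ge_part; first by lra.
  have : 4 * m%:R <= 10 * m1%:R :> R by rewrite -!natrM ler_nat.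
  have := ler0n R m; lra.
have q2 : 63 / 100 * Q <= Num.sqrt m2%:R.
  apply: sqrt_ge_part; first by lra.
  have : 4 * m%:R <= 10 * m2%:R :> R by rewrite -!natrM ler_nat.
  have := ler0n R m; lra.
rewrite /target -/kap -/Q.
set q1' := Num.sqrt m1%:R in q1 *; set q2' := Num.sqrt m2%:R in q2 *.
have e1 : c * (q1' + q2') >= c * (126 / 100 * Q) by rewrite ler_wpM2l; lra.
have e2 : 1 / 4 * Q - k%:R <= c * (1 / 4 * Q - k%:R).
  by rewrite -[leLHS]mul1r ler_wpM2r.
have e3 : c * (m1%:R + m2%:R) = c * m%:R + c * s%:R by rewrite xy mulrDr.
have e4 : c * s%:R <= c * k%:R by rewrite ler_wpM2l //; lra.
have e5 : 0 <= c * Q by rewrite mulr_ge0 ?sqrtr_ge0 //; lra.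
lra.
Qed.

End Asymptotics.

(** * One random halving *)

Section Splitting.
Variables (R : realType) (V : finType) (k s r D : nat).
Variables (E : {set {set V}}) (A : {set V}) (tau : nat).
Variables (G : {set V} -> {set {set V}}) (b : {set V} -> nat) (theta : {set V} -> R).
Implicit Types (S U W X : {set V}).

(* The slack grows when [W] shrinks: its increase pays for the fluctuations of a random half. *)
Definition dense_in W := forall S, S \subset W -> (#|S| <= D)%N ->
  (theta S - slack R r #|W|) * #|W|%:R ^+ b S
    <= #|[set X in G S | X \subset W]|%:R.

(* For [s != 0] no parity is needed: the vertices missed in one half are handed to the other. *)
Definition balanced W := (s == 0%N) ==> ~~ odd (#|W :&: A| + tau * (#|W| %/ k)).

Hypotheses (k_gt0 : (0 < k)%N) (uniE : uniform k E).
Hypothesis b_range : forall S, (0 < b S <= r)%N.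
Hypothesis card_G : forall S X, X \in G S -> #|X| = b S.
Hypothesis theta_le1 : forall S, theta S <= 1.

Definition split_threshold W S : R :=
  #|[set X in G S | X \subset W]|%:R / 2 ^+ b S - #|W|%:R ^+ b S / qrt R #|W|.

Definition good_split W U := [forall S : {set V}, (S \subset W) && (#|S| <= D)%N ==>
  (split_threshold W S < #|[set X in G S | X \subset U]|%:R) &&
  (split_threshold W S < #|[set X in G S | X \subset W :\: U]|%:R)].

(** Union bound over at most [(|W| + 1) ^ D] roots and both sides; with [q = qrt |W|] the exponent
    of each tail is [- sqrt |W| / 2]. *)
Lemma card_bad_splits W : (0 < #|W|)%N ->
  #|[set U : {set V} | (U \subset W) && ~~ good_split W U]|%:R <=
  (#|W|.+1 ^ D)%:R * (2 * (2 ^+ #|W| * expR (- (Num.sqrt #|W|%:R / 2)))) :> R.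
Proof.
move=> W0; set small := [set S : {set V} | (S \subset W) && (#|S| <= D)%N].
pose G' S := [set X in G S | X \subset W].
pose b1 S := [set U : {set V} | (U \subset W) &&
  (#|[set X in G' S | X \subset U]|%:R <= split_threshold W S)].
pose b2 S := [set U : {set V} | (U \subset W) &&
  (#|[set X in G' S | X \subset W :\: U]|%:R <= split_threshold W S)].
have restr S U : U \subset W ->
    [set X in G' S | X \subset U] = [set X in G S | X \subset U].
  move=> UW; apply/setP => X; rewrite !inE -andbA; congr (_ && _).
  by rewrite andb_idl // => XU; apply: subset_trans UW.
apply: le_trans (_ : (\sum_(S in small) (#|b1 S| + #|b2 S|))%N%:R <= _).
  rewrite ler_nat; apply: leq_trans (_ : #|\bigcup_(S in small) (b1 S :|: b2 S)| <= _)%N.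
    apply: subset_leq_card; apply/subsetP => U; rewrite inE => /andP[UW].
    case/forallPn => S; rewrite negb_imply negb_and -!leNgt => /andP[Ssm bad].
    apply/bigcupP; exists S; first by rewrite inE.
    rewrite !inE UW !restr ?subsetDl //.
  elim/big_rec2: _ => [|S n U' _ IH]; first by rewrite cards0.
  apply: leq_trans (leq_card_setU _ _) _; apply: leq_add => //.
  exact: leq_card_setU.
have q0 := qrt_gt0 R W0.
have e : #|W|%:R / (2 * qrt R #|W| ^+ 2) = Num.sqrt #|W|%:R / 2 :> R.
  have sq0 : Num.sqrt #|W|%:R != 0 :> R by rewrite sqrtr_eq0 -ltNge ltr0n.
  rewrite qrt_sqr -[in LHS](sqr_sqrtr (ler0n R #|W|)) sqrtr_sqr ger0_norm ?sqrtr_ge0 //.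
  by field.
have tails S : #|b1 S|%:R + #|b2 S|%:R <=
    2 * (2 ^+ #|W| * expR (- (Num.sqrt #|W|%:R / 2))) :> R.
  have GW X : X \in G' S -> X \subset W /\ #|X| = b S.
    by rewrite inE => /andP[/card_G-> ->].
  have /andP[bS _] := b_range S.
  have := subset_count_tail q0 bS W0 GW; have := subset_count_tailC q0 bS W0 GW.
  by rewrite e -/(split_threshold W S) -/(b1 S) -/(b2 S); lra.
rewrite natr_sum; apply: le_trans (_ : \sum_(S in small)
   2 * (2 ^+ #|W| * expR (- (Num.sqrt #|W|%:R / 2))) <= _).
  by apply: ler_sum => S _; rewrite natrD.
rewrite sumr_const -[leLHS]mulr_natl ler_wpM2r //; last by rewrite ler_nat card_small_subsets.
Qed.

(** Stated for sets [W'] containing one of the two sides, because the second part of the recursion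
    is [W :\: cover M], which exceeds [W :\: U] by the vertices that [M] misses. *)
Lemma good_split_dense W U W' : (30 * k <= #|W|)%N ->
  (2 ^ r * (6 * k))%:R <= qrt R #|W| -> 1 <= qrt R #|W| ->
  dense_in W -> good_split W U -> U \subset W ->
  W' \subset W -> U \subset W' \/ W :\: U \subset W' ->
  (0 < #|W'|)%N -> (#|W'|.*2 <= #|W| + 6 * k)%N -> dense_in W'.
Proof.
move=> Wk Wq q1 dW gU UW W'W UW' W'0 W'le S SW' SD.
have SW := subset_trans SW' W'W.
have /andP[_ br] := b_range S.
apply: (half_density br (theta_le1 S) W'0 W'le Wk Wq q1 (dW S SW SD)) => //.
have := forallP gU S; rewrite SW SD /= => /andP[/ltW h1 /ltW h2].
case: UW' => sub; [apply: le_trans h1 _ | apply: le_trans h2 _]; rewrite ler_nat;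
  apply: subset_leq_card; apply/subsetP => X; rewrite !inE => /andP[->] XU;
  by rewrite (subset_trans XU).
Qed.

(** For [s = 0] the half has [2 * k * a] vertices, so [|U| / k] is even and the balance of [U] is
    just the evenness of [|U :&: A|]; [M] then covers all of [U], and the parity of the rest follows
    by subtraction. *)
Lemma balanced_split W U M : balanced W -> #|W| = s %[mod k] ->
  U \subset W -> #|U| = (2 * k * (#|W| %/ (4 * k)) + s)%N ->
  (s == 0%N) ==> ~~ odd #|U :&: A| ->
  balanced U /\
  (M \in inner_matchings k E U -> balanced (W :\: cover M)).
Proof.
rewrite /balanced; case: eqP => [s0 balW mW UW cU parU|//] /=.
move: cU; rewrite s0 addn0 => cU.
have kU : (k %| #|U|)%N by rewrite cU -mulnA dvdn_mull // dvdn_mulr.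
have kW : (k %| #|W|)%N by rewrite /dvdn mW s0 mod0n.
have ev : ~~ odd (#|U| %/ k).
  by rewrite cU -mulnA mulnCA mulKn // mul2n odd_double.
split; first by rewrite oddD oddM (negPf ev) andbF addbF.
rewrite inE => /and4P[ME tM cM /eqP nM].
have -> : cover M = U.
  by apply/eqP; rewrite eqEcard cM (card_cover_edges k_gt0 uniE) // nM divnK /=.
have -> : (#|(W :\: U) :&: A| = #|W :&: A| - #|U :&: A|)%N.
  by rewrite setIDAC cardsD setIAC (setIidPr UW).
rewrite cardsDS //.
have le1 : (#|U :&: A| <= #|W :&: A|)%N by apply: subset_leq_card; apply: setSI.
rewrite oddD oddB // (negPf parU) addbF divnB // ?modn_dvd //.
rewrite (eqP kU) ltn0 subn0 oddM oddB ?leq_div2r ?subset_leq_card // (negPf ev) addbF.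
by move: balW; rewrite oddD oddM.
Qed.

End Splitting.

(** * The recursion *)

Section Counting.
Variable R : realType.

(** Base case of the recursion: for [c] this large the linear term outweighs the rest up to size
    [n], so a single matching meets the target. From [m >= 4] comes [sqrt m <= m / 2]. *)
Lemma target_le0 k (c : R) n m : (0 < k)%N -> (4 <= m)%N -> (m <= n)%N ->
  2 * ln n%:R <= c -> target k c m <= 0.
Proof.
move=> k0 m4 mn hc; have m0 : (0 < m)%N by apply: leq_trans m4.
have mR : 4 <= m%:R :> R by rewrite ler_nat.
have lmn : ln m%:R <= ln n%:R :> R.
  by rewrite ler_ln ?posrE ?ltr0n ?ler_nat //; apply: leq_trans mn.
have lm0 : 0 <= ln m%:R :> R by rewrite ln_ge0 //; lra.
pose kap : R := 1 - 1 / k%:R; rewrite /target -/kap.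
have kR : 1 <= k%:R :> R by rewrite ler1n.
have kap0 : 0 <= kap by rewrite subr_ge0 ler_pdivrMr ?mul1r //; lra.
have kap1 : kap <= 1 by rewrite /kap; have : 0 <= 1 / k%:R :> R by rewrite divr_ge0 ?ler0n.
have sm : Num.sqrt m%:R <= m%:R / 2 :> R.
  rewrite -[leRHS]ger0_norm ?divr_ge0 ?ler0n // -sqrtr_sqr ler_wsqrtr //.
  rewrite expr2; nra.
have e1 : kap * (m%:R * ln m%:R) <= m%:R * ln m%:R.
  by rewrite -[leRHS]mul1r ler_wpM2r // mulr_ge0 ?ler0n.
have e2 : m%:R * ln m%:R <= m%:R * (c / 2) by rewrite ler_wpM2l ?ler0n //; lra.
have e3 : c * Num.sqrt m%:R <= c * (m%:R / 2) by rewrite ler_wpM2l //; lra.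
lra.
Qed.

(** The sizes of the two parts add up to [m + s]: the [s] vertices that a matching of the first part
    misses belong to both. *)
Lemma half_sizes (k s m n : nat) : (0 < k)%N -> (s < k)%N -> (30 * k <= m)%N ->
  (3 * n <= m)%N ->
  let h := (2 * k * (m %/ (4 * k)) + s)%N in
  let m2 := (m - 2 * k * (m %/ (4 * k)))%N in
  [/\ [/\ h < m, h.*2 <= m + 2 * k, m <= h.*2 + 4 * k & n <= h],
      [/\ m2 < m, m2.*2 <= m + 6 * k, m <= m2.*2 + 4 * k & n <= m2]
    & h + m2 = m + s]%N.
Proof.
move=> k0 sk mk mn.
have dm := divn_eq m (4 * k); have rm : (m %% (4 * k) < 4 * k)%N.
  by rewrite ltn_mod; lia.
move: (m %/ (4 * k))%N (m %% (4 * k))%N dm rm => a r dm rm h m2.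
have ka : (2 * k * a = k * a + k * a)%N by lia.
have dm' : (m = 4 * (k * a) + r)%N by rewrite dm; lia.
by rewrite /h /m2 ka; move: (k * a)%N dm' => c dm'; split; [split|split|]; lia.
Qed.

Lemma card_parity_halves (V : finType) (k s : nat) (A W : {set V}) :
  (0 < k)%N -> (s < k)%N -> (30 * k <= #|W|)%N ->
  (2 ^ #|W| <= #|W|.+1 ^ (2 * k + 3) * #|[set U : {set V} | [&& U \subset W,
     #|U| == (2 * k * (#|W| %/ (4 * k)) + s)%N
     & (s == 0%N) ==> ~~ odd #|U :&: A|]]|)%N.
Proof.
move=> k0 sk Wk; set h := (2 * k * _ + s)%N.
have [[hW h1 h2 _] _ _] := half_sizes k0 sk Wk (leq0n #|W| : 3 * 0 <= #|W|)%N.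
have mid : (2 ^ #|W| <= #|W|.+1 ^ (2 * k).+1 * 'C(#|W|, h))%N.
  by apply: expn2_le_bin_near_mid; move: h1 h2 hW; rewrite -/h; clear; lia.
apply: leq_trans mid _; have -> : (2 * k + 3 = (2 * k).+1 + 2)%N by lia.
rewrite expnD -mulnA leq_mul2l; apply/orP; right.
have [s0|s0] := eqVneq s 0%N.
  have evh : ~~ odd h by rewrite /h s0 addn0 -mulnA mul2n odd_double.
  apply: leq_trans (card_even_halves A evh hW) _; rewrite leq_mul2l.
  by apply/orP; right; apply: subset_leq_card; apply/subsetP => U; rewrite !inE.
rewrite -cards_draws; apply: leq_trans (leq_pmull _ (_ : 0 < #|W|.+1 ^ 2)%N).
  apply: subset_leq_card; apply/subsetP => U; rewrite !inE.
  by case/andP=> -> ->; rewrite ?andbT.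
by rewrite expn_gt0.
Qed.

(** Existence at every size above [n0], together with inheritance by random halves, gives the count.
    The constant is fixed before [V], [E] and [theta]. *)
Theorem inner_matchings_count (k s r D n0 : nat) :
  (0 < k)%N -> (s < k)%N -> (4 <= n0)%N ->
  exists2 c : R, 0 < c &
  forall (V : finType) (E : {set {set V}}) (A : {set V}) (tau : nat)
    (G : {set V} -> {set {set V}}) (b : {set V} -> nat) (theta : {set V} -> R),
    uniform k E -> (forall S, 0 < b S <= r)%N ->
    (forall S X, X \in G S -> #|X| = b S) -> (forall S, theta S <= 1) ->
    (forall W : {set V}, (n0 <= #|W|)%N -> #|W| = s %[mod k] ->
       balanced k s A tau W -> dense_in r D G b theta W ->
       (0 < #|inner_matchings k E W|)%N) ->
    forall W : {set V}, (n0 <= #|W|)%N -> #|W| = s %[mod k] ->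
       balanced k s A tau W -> dense_in r D G b theta W ->
       expR ((1 - 1 / k%:R) * #|W|%:R * ln #|W|%:R - c * #|W|%:R)
         <= #|inner_matchings k E W|%:R.
Proof.
move=> k0 sk n04; pose p := (2 * k + 3)%N.
have [n1 n1P] := @target_step R k (p + k) k0.
have [|n2 n2P] := @poly_le_expR_sqrt R (D + p) 4 (1 / 2); first by lra.
pose K := (2 ^ r * (6 * k))%N.
(* Halving stops at [n3]: the term [K ^ 4] gives [K <= qrt m], and [3 * n0] keeps both parts above
   [n0]. The constant [c] makes the target non-positive up to [n3], where one matching suffices. *)
pose n3 := (n1 + n2 + K ^ 4 + 30 * k + 3 * n0)%N.
pose c : R := 1 + 2 * ln n3%:R.
have n31 : 1 <= n3%:R :> R by rewrite ler1n /n3; lia.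
have ln0 := ln_ge0 n31.
exists c => [|V E A tau G b theta uniE b_range card_G theta_le1 base W]; first by rewrite /c; lra.
move=> Wn Ws Wb Wd.
apply: le_trans (_ : expR (target k c #|W|) <= _).
  rewrite ler_expR /target lerDl mulr_ge0 ?sqrtr_ge0 // /c; lra.
suff main m : forall W : {set V}, #|W| = m -> (n0 <= #|W|)%N ->
    #|W| = s %[mod k] -> balanced k s A tau W -> dense_in r D G b theta W ->
    expR (target k c m) <= #|inner_matchings k E W|%:R by exact: main.
elim/ltn_ind: m => m IHm {Wn Ws Wb Wd}W cW Wn Ws Wb Wd.
have base1 : 1 <= #|inner_matchings k E W|%:R :> R.
  by rewrite ler1n; apply: base.
rewrite cW in Wn; have [mn|nm] := leqP m n3.
  apply: le_trans base1; rewrite -expR0 ler_expR.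
  by apply: (target_le0 k0 (leq_trans n04 Wn) mn); rewrite /c; lra.
have mk : (30 * k <= m)%N by rewrite /n3 in nm; lia.
have mn1 : (n1 <= m)%N by rewrite /n3 in nm; lia.
have mn2 : (n2 <= m)%N by rewrite /n3 in nm; lia.
have mn0 : (3 * n0 <= m)%N by rewrite /n3 in nm; lia.
have mK : (K ^ 4 <= m)%N by rewrite /n3 in nm; lia.
have K1 : (1 <= K)%N by rewrite /K !muln_gt0 expn_gt0.
have m0 : (0 < m)%N by lia.
have qK : K%:R <= qrt R m by rewrite le_qrt ?ler0n // -natrX ler_nat.
have q1 : 1 <= qrt R m by apply: le_trans qK; rewrite ler1n.
pose h := (2 * k * (m %/ (4 * k)) + s)%N; pose m2 := (m - 2 * k * (m %/ (4 * k)))%N.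
have [[hm hm2 h2 hn0] [m2m m22 m2h m2n0] m2s] := half_sizes k0 sk mk mn0.
have {}hm2 : (h.*2 <= m + 6 * k)%N.
  by apply: leq_trans hm2 _; rewrite leq_add2l leq_mul2r orbT.
rewrite -/h -/m2 in hm h2 hn0 m2m m22 m2h m2n0 m2s.
have h0 : (0 < h)%N by apply: leq_trans hn0; apply: leq_trans n04.
have m20 : (0 < m2)%N by apply: leq_trans m2n0; apply: leq_trans n04.
have hk : h = s %[mod k].
  by rewrite /h mulnAC modnMDl.
have m2k : m2 = s %[mod k].
  have : (h + m2 = m + s)%N by [].
  move/(congr1 (fun n => n %% k)%N); rewrite -modnDml hk modnDml -[in RHS]modnDml -cW Ws modnDml.
  by move/eqP; rewrite eqn_modDl => /eqP.
pose Hs := [set U : {set V} | [&& U \subset W, #|U| == h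
     & (s == 0%N) ==> ~~ odd #|U :&: A|]].
pose Us := [set U in Hs | good_split R D G b W U].
have cHs : 2 ^+ m <= (m%:R + 1) ^+ p * #|Hs|%:R :> R.
  have := card_parity_halves A k0 sk (_ : 30 * k <= #|W|)%N; rewrite cW => /(_ mk).
  by rewrite -(ler_nat R) natrM !natrX -[m.+1%:R]natr1.
have cbad : #|Hs :\: Us|%:R <= (m%:R + 1) ^+ D * (2 * (2 ^+ m * expR (- (Num.sqrt m%:R / 2)))) :> R.
  have W0 : (0 < #|W|)%N by rewrite cW.
  have := card_bad_splits R D b_range card_G W0.
  rewrite cW natrX -[m.+1%:R]natr1; apply: le_trans; rewrite ler_nat.
  apply: subset_leq_card; apply/subsetP => U; rewrite !inE => /andP[nU /and3P[UW cU pU]].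
  by move: nU; rewrite UW cU pU.
(* By the choice of [n2], the bad splits amount to at most half of the lower bound for [Hs]. *)
have cUs : 2 ^+ m <= 2 * (m%:R + 1) ^+ p * #|Us|%:R :> R.
  have cE : #|Hs|%:R = #|Us|%:R + #|Hs :\: Us|%:R :> R.
    rewrite -natrD -(cardsID Us Hs) (setIidPr _) //.
    by apply/subsetP => U; rewrite inE => /andP[].
  have := n2P _ mn2; rewrite exprD => big.
  set x := m%:R + 1 in cHs cbad big *.
  have xp : 0 < x ^+ p by rewrite exprn_gt0 // /x; have := ler0n R m; lra.
  have bad2 : x ^+ p * #|Hs :\: Us|%:R <= 2 ^+ m / 2.
    apply: le_trans (ler_wpM2l (ltW xp) cbad) _.
    have -> : x ^+ p * (x ^+ D * (2 * (2 ^+ m * expR (- (Num.sqrt m%:R / 2))))) =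
      2 ^+ m / 2 * ((4 * (x ^+ D * x ^+ p)) * expR (- (Num.sqrt m%:R / 2))).
      by field.
    rewrite -[leRHS]mulr1 ler_wpM2l ?divr_ge0 ?exprn_ge0 //.
    apply: le_trans (ler_wpM2r (expR_ge0 _) big) _.
    by rewrite -expRD mul1r mulrC subrr expR0.
  rewrite cE mulrDr in cHs; lra.
have UsP U : U \in Us -> [/\ U \subset W, #|U| = h,
    (s == 0%N) ==> ~~ odd #|U :&: A| & good_split R D G b W U].
  by rewrite !inE => /andP[/and3P[-> /eqP -> ->] ->].
have eh0 := expR_ge0 (target k c h); have em0 := expR_ge0 (target k c m2).
have lowU U : U \in Us ->
    expR (target k c h) * expR (target k c m2) <=
    (\sum_(M in inner_matchings k E U) #|inner_matchings k E (W :\: cover M)|)%N%:R.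
  move=> /UsP[UW cU pU gU].
  have cU' : #|U| = (2 * k * (#|W| %/ (4 * k)) + s)%N by rewrite cU cW.
  have Wk : (30 * k <= #|W|)%N by rewrite cW.
  have Wq : (2 ^ r * (6 * k))%:R <= qrt R #|W| by rewrite cW.
  have Wq1 : 1 <= qrt R #|W| by rewrite cW.
  have dW := good_split_dense b_range theta_le1 Wk Wq Wq1 Wd gU UW.
  (* The empty family is a placeholder: the balance of [U] does not involve the matching. *)
  have [bU _] := balanced_split k0 uniE finset.set0 Wb Ws UW cU' pU.
  have IHU : expR (target k c h) <= #|inner_matchings k E U|%:R.
    apply: (IHm h) => //; rewrite ?cU //.
    by apply: dW; rewrite ?cU ?cW //; left.
  apply: le_trans (ler_wpM2r em0 IHU) _.
  rewrite mulr_natl -sumr_const natr_sum; apply: ler_sum => M MU.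
  have [_ /(_ MU) bWM] := balanced_split k0 uniE M Wb Ws UW cU' pU.
  have cWM : #|W :\: cover M| = m2.
    move: (MU); rewrite inE => /and4P[ME tM cM /eqP nM].
    rewrite cardsDS ?(subset_trans cM UW) // (card_cover_edges k0 uniE) // nM cU cW.
    rewrite /h /m2; set q := (m %/ (4 * k))%N.
    by rewrite (mulnAC 2 k q) divnMDl // divn_small // addn0.
  apply: (IHm m2) => //; rewrite ?cWM //.
  apply: dW; rewrite ?subsetDl ?cWM ?cW //; right.
  by move: (MU); rewrite inE => /and4P[_ _ cM _]; apply: setDS.
have := @card_inner_matchings_ge V k E k0 uniE W h Us.
rewrite -(ler_nat R) cW => count.
have {}count := count (etrans hk (esym (etrans (congr1 (modn^~ k) (esym cW)) Ws)))
   (fun U UUs => let: And4 UW cU _ _ := UsP U UUs in conj UW cU).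
have sumlow : #|Us|%:R * (expR (target k c h) * expR (target k c m2)) <=
    (\sum_(U in Us) \sum_(M in inner_matchings k E U)
        #|inner_matchings k E (W :\: cover M)|)%N%:R :> R.
  by rewrite mulr_natl -sumr_const natr_sum; apply: ler_sum => U /lowU.
have step := n1P c m h m2 s _ mn1 sk m2s h2 m2h.
have {}step := step ltac:(rewrite /c; lra).
have x1 : 1 <= m%:R + 1 :> R by have := ler0n R m; lra.
have xmod : (m.+1 ^ (m %% k))%:R <= (m%:R + 1) ^+ k :> R.
  by rewrite natrX -[m.+1%:R]natr1 ler_weXn2l // ltnW // ltn_mod.
set e1 := expR (target k c h) in sumlow step eh0 *.
set e2 := expR (target k c m2) in sumlow step em0 *.
set N : R := #|inner_matchings k E W|%:R.
have N0 : 0 <= N by rewrite ler0n.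
set x := m%:R + 1 in cUs step x1 xmod *.
pose F := 2 * x ^+ (p + k) * 2 ^+ (m %/ k).
have F0 : 0 < F by rewrite !mulr_gt0 ?exprn_gt0 //; lra.
rewrite -(ler_pM2l F0); apply: le_trans step _.
have xp0 : 0 <= x ^+ p by rewrite exprn_ge0 //; lra.
apply: le_trans (_ : 2 * x ^+ p * #|Us|%:R * (e1 * e2) <= _).
  by rewrite ler_wpM2r // mulr_ge0.
have t0 : 0 <= 2 ^+ (m %/ k) * N by rewrite mulr_ge0 ?exprn_ge0.
have -> : F * N = 2 * x ^+ p * (x ^+ k * (2 ^+ (m %/ k) * N)).
  by rewrite /F exprD; ring.
rewrite -mulrA ler_wpM2l ?mulr_ge0 //; apply: le_trans sumlow _.
apply: le_trans count _; rewrite !natrM [(2 ^ _)%:R]natrX -/N.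
by rewrite ler_wpM2r.
Qed.

End Counting.

(** * Part (i) *)

Section MinDegree.
Variable V : finType.
Implicit Types (W S : {set V}) (E : {set {set V}}).

Lemma min_degree_le d E S : #|S| = d -> (min_degree d E <= degree E S)%N.
Proof.
move=> cS; rewrite /min_degree; have : S \in index_enum {set V} by rewrite mem_index_enum.
elim: (index_enum _) => // S' Ss IH; rewrite inE big_cons => /orP[/eqP <-|/IH le].
  by rewrite cS eqxx geq_minl.
by case: ifP => // _; apply: leq_trans (geq_minr _ _) le.
Qed.

Lemma min_degree_ge d E D : (d <= #|V|)%N ->
  (forall S, #|S| = d -> (D <= degree E S)%N) -> (D <= min_degree d E)%N.
Proof.
move=> dV degE; rewrite /min_degree; apply: (big_ind (fun x => D <= x)%N).
- have : (0 < #|[set S : {set V} | #|S| == d]|)%N.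
    by rewrite card_draws bin_gt0.
  case/card_gt0P => S; rewrite inE => /eqP/degE/leq_trans; apply.
  by apply: subset_leq_card; apply/subsetP => e; rewrite inE => /andP[].
- by move=> x y Dx Dy; rewrite leq_min Dx.
- by move=> S /eqP; apply: degE.
Qed.

End MinDegree.

Section DegreeExtensions.
Variable V : finType.
Implicit Types (W S : {set V}) (E : {set {set V}}).

(** [forces_optimal_matching] quantifies over whole vertex types, so the hypergraph induced on [W]
    is moved to the subtype of [W] and its matching is moved back along [val]. *)
Lemma inner_matchings_of_forces k d W E D : forces_optimal_matching d k #|W| D ->
  uniform k E -> (d <= #|W|)%N ->
  (forall S, S \subset W -> #|S| = d ->
     (D <= #|[set e in E | (S \subset e) && (e \subset W)]|)%N) ->
  (0 < #|inner_matchings k E W|)%N.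
Proof.
move=> forc uniE dW degW; pose T : finType := {x : V | x \in W}.
pose up (e : {set T}) : {set V} := [set val x | x in e].
have up_inj : injective up by apply: imset_inj; apply: val_inj.
have card_up e : #|up e| = #|e| by apply: card_imset; apply: val_inj.
have upW e : up e \subset W.
  by apply/subsetP => _ /imsetP[x _ ->]; apply: (valP x).
have upK (S : {set V}) : S \subset W -> up (val @^-1: S) = S.
  move=> SW; apply/setP => x; apply/imsetP/idP => [[y]|xS]; first by rewrite inE => ? ->.
  by exists (Sub x (subsetP SW x xS)); rewrite ?inE /=.
have cT : #|T| = #|W| by rewrite card_sig; apply: eq_card => x; rewrite inE.
pose E' := [set e : {set T} | up e \in E].
have uniE' : uniform k E'.
  by apply/forall_inP => e; rewrite inE -card_up => /(forall_inP uniE).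
have [|M] := forc T E' cT uniE'.
  apply: min_degree_ge; first by rewrite cT.
  move=> S cS; apply: leq_trans (degW (up S) (upW S) _) _; first by rewrite card_up.
  rewrite /degree -[X in (_ <= X)%N](card_imset _ up_inj); apply: subset_leq_card; apply/subsetP => e.
  rewrite !inE => /and3P[eE Se eW]; apply/imsetP; exists (val @^-1: e); last by rewrite upK.
  rewrite !inE upK // eE /=; apply/subsetP => x xS; rewrite inE.
  by apply: (subsetP Se); apply/imsetP; exists x.
case/andP => /andP[ME' tM] /eqP nM.
apply/card_gt0P; exists [set up e | e in M]; rewrite inE; apply/and4P; split.
- by apply/subsetP => _ /imsetP[e /(subsetP ME') + ->]; rewrite inE.
- apply/trivIsetP => _ _ /imsetP[e1 e1M ->] /imsetP[e2 e2M ->] ne.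
  have e12 : e1 != e2 by apply: contraNneq ne => ->.
  have := trivIsetP tM _ _ e1M e2M e12; rewrite -!setI_eq0 => /eqP e0.
  by rewrite -(imsetI (in2W val_inj)) e0 imset0.
- by apply/bigcupsP => _ /imsetP[e _ ->]; apply: upW.
- by rewrite card_imset // nM cT.
Qed.

Lemma degree_ext E k d S : uniform k E -> (d <= k)%N -> #|S| = d ->
  degree E S = #|[set X : {set V} | [&& #|X| == (k - d)%N, [disjoint X & S]
                                    & X :|: S \in E]]|.
Proof.
move=> uniE dk cS; rewrite /degree; symmetry.
rewrite -(@card_in_imset _ _ (fun X => X :|: S)).
  apply: eq_card => e; apply/imsetP/idP => [[X]|].
    by rewrite !inE => /and3P[_ _ XE] ->; rewrite XE subsetUr.
  rewrite inE => /andP[eE Se]; exists (e :\: S).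
    rewrite inE cardsDS // (eqP (forall_inP uniE e eE)) cS eqxx /=.
    rewrite -setI_eq0 setIDAC setDIl setDv setI0 eqxx /=.
    by rewrite setUC setDE setUIr setUCr setIT (setUidPr Se).
  by rewrite setUC setDE setUIr setUCr setIT (setUidPr Se).
move=> X Y; rewrite !inE => /and3P[_ dX _] /and3P[_ dY _] E0.
have := congr1 (fun e => e :\: S) E0; rewrite /= !setDUl !setDv !setU0.
by rewrite !(setDidPl _).
Qed.

Lemma degree_le_bin E k d S : uniform k E -> (d <= k)%N -> #|S| = d ->
  (degree E S <= 'C(#|V| - d, k - d))%N.
Proof.
move=> uniE dk cS; rewrite (degree_ext uniE dk cS).
have -> : (#|V| - d)%N = #|~: S| by rewrite -cS -(cardsC S) addKn.
rewrite -cards_draws; apply: subset_leq_card; apply/subsetP => X.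
by rewrite !inE => /and3P[-> + _]; rewrite subsets_disjoint setCK andbT.
Qed.

End DegreeExtensions.

(** * The limsup threshold and the margin gamma *)

Section DegreeThreshold.
Variable R : realType.

Lemma m_forces d k n : forces_optimal_matching d k n (m_ d k n).
Proof. by rewrite /m_; case: ex_minnP => m /asboolP. Qed.

(** Every tail of the residue class contains some [N * k + s], so each supremum is over a nonempty
    set of nonnegative ratios; this rules out the value -oo. *)
Lemma mu_sup_ge0 d k s : (s < k)%N -> (0 <= mu_sup R d k s)%E.
Proof.
move=> sk; apply: le_ereal_inf_tmp => _ [P [N _ NP] <-].
pose n := (N * k + s)%N.
have nP : P n.
  apply: NP; last by rewrite /= /n modnMDl.
  by rewrite /=; apply: leq_trans (leq_addr _ _); rewrite leq_pmulr //; lia.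
apply: le_trans (ereal_sup_ubound _); last by exists n.
by rewrite lee_fin divr_ge0 ?ler0n.
Qed.

Lemma mu_sup_lt d k s (x : R) : (mu_sup R d k s < x%:E)%E ->
  exists N, forall n, (N <= n)%N -> n = s %[mod k] ->
    (m_ d k n)%:R / ('C(n - d, k - d))%:R <= x.
Proof.
move=> /ereal_inf_lt[_ [P [N _ NP] <-]] Px; exists N => n Nn ns.
rewrite -lee_fin; apply: le_trans (ltW Px); apply: ereal_sup_ubound.
by exists n => //; apply: NP.
Qed.

Lemma slack_small r (eps : R) : 0 < eps ->
  exists n, forall m, (n <= m)%N -> slack R r m <= eps.
Proof.
move=> e0; have [n nP] := exists_nat_ge ((9 * (1 + 2 ^+ r) / eps) ^+ 4).
exists n.+1 => m nm; have q0 : 0 < qrt R m by apply: qrt_gt0; apply: leq_trans nm.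
rewrite /slack ler_pdivrMr // [leRHS]mulrC -ler_pdivrMr // le_qrt.
  by apply: le_trans nP _; rewrite ler_nat ltnW.
by rewrite divr_ge0 ?mulr_ge0 ?addr_ge0 ?exprn_ge0 // ltW.
Qed.

Lemma bernoulli_le (x : R) b : 0 <= x -> x <= 1 -> 1 - b%:R * x <= (1 - x) ^+ b.
Proof.
move=> x0 x1; elim: b => [|b IHb]; first by rewrite expr0; lra.
rewrite exprS -[b.+1%:R]natr1.
have : (1 - x) * (1 - b%:R * x) <= (1 - x) * (1 - x) ^+ b by rewrite ler_wpM2l //; lra.
have : 0 <= b%:R * (x * x) by rewrite !mulr_ge0 ?ler0n.
lra.
Qed.

Lemma ffact_ge_expn n b : ((n.+1 - b) ^ b <= n ^_ b)%N.
Proof.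
elim: b => [|b IHb]; first by rewrite expn0 ffactn0.
rewrite ffactnSr expnSr subSS; apply: leq_mul => //; apply: leq_trans IHb.
by case: (b) => // c; rewrite leq_exp2r // leq_sub2r.
Qed.

Lemma bin_fact_ge n d k : (d <= k)%N -> (k <= n)%N ->
  ((n - k) ^ (k - d) <= 'C(n - d, k - d) * (k - d)`!)%N.
Proof.
move=> dk kn; rewrite bin_ffact; apply: leq_trans (ffact_ge_expn _ _).
by case: (k - d)%N (subnK dk) => // c ck; rewrite leq_exp2r //; lia.
Qed.

Lemma bin_fact_le n d k : ('C(n - d, k - d) * (k - d)`! <= n ^ (k - d))%N.
Proof.
rewrite bin_ffact; apply: (@leq_trans ((n - d) ^ (k - d))%N); last first.
  by case: (k - d)%N => // c; rewrite leq_exp2r // leq_subr.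
elim: (k - d)%N => [|b IHb]; first by rewrite ffactn0.
by rewrite ffactnSr expnSr leq_mul ?leq_subr.
Qed.

Theorem optimal_matchings_count (k d s : nat) (gamma : R) :
  (3 <= k)%N -> 0 < gamma -> gamma < 1 -> (1 <= d <= k - 1)%N -> (s < k)%N ->
  exists (c : R) (n0 : nat), 0 < c /\ forall n, (n0 <= n)%N ->
    n = s %[mod k] -> forall (V : finType) (E : {set {set V}}),
    #|V| = n -> uniform k E ->
    ((mu_sup R d k s + gamma%:E) * ('C(n - d, k - d)%:R : R)%:E
       <= ((min_degree d E)%:R : R)%:E)%E ->
    expR ((1 - 1 / k%:R) * n%:R * ln n%:R - c * n%:R)
      <= (num_optimal_matchings k E)%:R.
Proof.
move=> k3 g0 g1 /andP[d1 dk1] sk; have dk : (d < k)%N by lia.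
have k0 : (0 < k)%N by lia.
have mu0 := mu_sup_ge0 d sk; have muP := @mu_sup_lt d k s.
case: (mu_sup R d k s) mu0 muP => [mu|_ _|//]; last first.
  (* With an infinite limsup the degree hypothesis cannot hold. *)
  exists 1, k; split=> // n kn _ V E _ _.
  have C0 : 0 < ('C(n - d, k - d))%:R :> R by rewrite ltr0n bin_gt0; lia.
  by rewrite addye // gt0_mulye ?lte_fin.
rewrite lee_fin => mu0 muP.
have [|N1 N1P] := muP (mu + gamma / 4); first by rewrite lte_fin; lra.
pose b := (k - d)%N; have b0 : (0 < b)%N by rewrite subn_gt0.
have fb0 : 0 < b`!%:R :> R by rewrite ltr0n fact_gt0.
have [|N2 N2P] := @slack_small k (gamma / 4 / b`!%:R); first by rewrite !divr_gt0.
pose n0 := (N1 + N2 + k + 4)%N.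
have [|c c0 cP] := @inner_matchings_count R k s k k n0 k0 sk; first by rewrite /n0; lia.
have [N3 N3P] := exists_nat_ge (k%:R * k%:R * 2 / gamma).
exists c, (n0 + N3)%N; split=> // n nn ns V E cV uniE.
have nn0 : (n0 <= n)%N by move: nn; clear; lia.
have [Nn1 Nn2 kn Nn3] : [/\ (N1 <= n)%N, (N2 <= n)%N, (k <= n)%N & (N3 <= n)%N].
  by move: nn; rewrite /n0; clear; split; lia.
have C0 : 0 < ('C(n - d, k - d))%:R :> R by rewrite ltr0n bin_gt0 leq_sub2r.
rewrite -EFinD -EFinM lee_fin => deg.
have degS (S : {set V}) : #|S| = d ->
    (mu + gamma) * ('C(n - d, k - d))%:R <= (degree E S)%:R.
  by move=> cS; apply: le_trans deg _; rewrite ler_nat; apply: min_degree_le.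
(* A degree never exceeds the binomial coefficient, so the degree hypothesis itself forces this; it
   keeps [theta] at most 1. *)
have mug1 : mu + gamma <= 1.
  have : (0 < #|[set S : {set V} | #|S| == d]|)%N.
    by rewrite card_draws bin_gt0 cV; apply: leq_trans kn; exact: ltnW.
  case/card_gt0P => S; rewrite inE => /eqP cS.
  have := degree_le_bin uniE (ltnW dk) cS; rewrite -(ler_nat R) cV.
  by move/(le_trans (degS S cS)); rewrite -[leRHS]mul1r ler_pM2r.
pose G (S : {set V}) := [set X : {set V} | [&& #|X| == b, [disjoint X & S]
                                    & X :|: S \in E]].
(* Budget for [gamma]: passing from the binomial coefficient to [n ^+ b / b!] on all of [V] costs
   [gamma / 2], the slack costs [gamma / 4], and [gamma / 4] remains above the limsup. Roots of
   other sizes get 0, which makes their condition void. *)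
pose theta (S : {set V}) : R := if #|S| == d then (mu + gamma / 2) / b`!%:R else 0.
have fb1 : 1 <= b`!%:R :> R by rewrite ler1n fact_gt0.
have cG (S X : {set V}) : X \in G S -> #|X| = b by rewrite inE => /and3P[/eqP].
have theta1 S : theta S <= 1.
  rewrite /theta; case: ifP => // _; rewrite ler_pdivrMr // mul1r.
  by apply: le_trans fb1; lra.
have bk (S : {set V}) : (0 < b <= k)%N by rewrite b0 leq_subr.
have trivG (W S : {set V}) : #|S| != d -> (theta S - slack R k #|W|) * #|W|%:R ^+ b
    <= #|[set X in G S | X \subset W]|%:R.
  rewrite /theta => /negPf ->; apply: le_trans (ler0n _ _).
  rewrite sub0r mulNr oppr_le0 mulr_ge0 ?slack_ge0 ?exprn_ge0 ?ler0n //.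
have bal (W : {set V}) : balanced k s finset.set0 0 W.
  by rewrite /balanced setI0 cards0 implybT.
have base (W : {set V}) : (n0 <= #|W|)%N -> #|W| = s %[mod k] ->
    balanced k s finset.set0 0 W -> dense_in k k G (fun=> b) theta W ->
    (0 < #|inner_matchings k E W|)%N.
  move=> W0 Ws _ dW; have [WN1 WN2 Wk] : [/\ (N1 <= #|W|)%N, (N2 <= #|W|)%N & (k <= #|W|)%N].
    by move: W0; rewrite /n0; clear; split; lia.
  have dW' : (d <= #|W|)%N := leq_trans (ltnW dk) Wk.
  have CW : 0 < ('C(#|W| - d, k - d))%:R :> R by rewrite ltr0n bin_gt0 leq_sub2r.
  have mW := N1P _ WN1 Ws; rewrite ler_pdivrMr // in mW.
  apply: (inner_matchings_of_forces (@m_forces d k #|W|) uniE dW') => S SW cS.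
  rewrite -(ler_nat R); apply: le_trans mW _.
  have Sk : (#|S| <= k)%N by rewrite cS ltnW.
  have := dW S SW Sk; rewrite /theta cS eqxx => dWS.
  have -> : #|[set e in E | (S \subset e) && (e \subset W)]| =
            #|[set X in G S | X \subset W]|.
    rewrite -[RHS](@card_in_imset _ _ (fun X => X :|: S)).
      apply: eq_card => e; apply/idP/imsetP.
        rewrite inE => /and3P[eE Se eW]; exists (e :\: S).
          rewrite !inE cardsDS // (eqP (forall_inP uniE e eE)) cS eqxx /=.
          rewrite -setI_eq0 setIDAC setDIl setDv setI0 eqxx /=.
          rewrite (subset_trans (subsetDl _ _) eW) andbT.
          by rewrite setUC setDE setUIr setUCr setIT (setUidPr Se).
        by rewrite setUC setDE setUIr setUCr setIT (setUidPr Se).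
      case=> X; rewrite !inE => /andP[/and3P[_ _ XE] XW] ->.
      by rewrite XE subsetUr subUset XW SW.
    move=> X Y; rewrite !inE => /andP[/and3P[_ dX _] _] /andP[/and3P[_ dY _] _] E0.
    have := congr1 (fun e => e :\: S) E0; rewrite /= !setDUl !setDv !setU0.
    by rewrite !(setDidPl _).
  apply: le_trans dWS; have := bin_fact_le #|W| d k; rewrite -/b -(ler_nat R) natrM natrX.
  set C : R := ('C(_, _))%:R; set mb := #|W|%:R ^+ b => Cle.
  have C00 : 0 <= C by rewrite ler0n.
  have mb0 : 0 <= mb by rewrite exprn_ge0 ?ler0n.
  apply: le_trans (_ : (mu + gamma / 4) / b`!%:R * mb <= _).
    rewrite -mulrA ler_wpM2l //; first by move: mu0 g0; clear; lra.
    by rewrite mulrC ler_pdivlMr.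
  rewrite ler_wpM2r //; have := N2P _ WN2.
  have -> : gamma / 4 / b`!%:R = (mu + gamma / 2) / b`!%:R - (mu + gamma / 4) / b`!%:R.
    by field; rewrite lt0r_neq0.
  by rewrite lerBrDr addrC -lerBrDr.
have top : dense_in k k G (fun=> b) theta [set: V].
  move=> S _ _; have [cS|cS] := eqVneq #|S| d; last exact: trivG.
  rewrite cardsT cV.
  have -> : #|[set X in G S | X \subset [set: V]]| = degree E S.
    rewrite (degree_ext uniE (ltnW dk) cS); apply: eq_card => X.
    by rewrite !inE subsetT andbT.
  apply: le_trans (degS S cS); rewrite /theta cS eqxx.
  apply: le_trans (_ : (mu + gamma / 2) / b`!%:R * n%:R ^+ b <= _).
    by rewrite ler_wpM2r ?exprn_ge0 ?ler0n // gerBl slack_ge0.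
  rewrite mulrAC ler_pdivrMr //.
  have := bin_fact_ge (ltnW dk) kn; rewrite -/b -(ler_nat R) natrM natrX.
  set C : R := ('C(_, _))%:R => Cge.
  have nR : 0 < n%:R :> R by rewrite ltr0n (leq_trans k0).
  have kR : 0 <= k%:R :> R by rewrite ler0n.
  have x1 : k%:R / n%:R <= 1 :> R by rewrite ler_pdivrMr // mul1r ler_nat.
  have x0 : 0 <= k%:R / n%:R :> R by rewrite divr_ge0 // ltW.
  have bern := bernoulli_le b x0 x1.
  have bkR : b%:R <= k%:R :> R by rewrite ler_nat leq_subr.
  have bx : b%:R * (k%:R / n%:R) <= gamma / 2.
    apply: le_trans (_ : k%:R * (k%:R / n%:R) <= _); first by rewrite ler_wpM2r.
    rewrite mulrA ler_pdivrMr //.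
    have : k%:R * k%:R * 2 / gamma <= n%:R by apply: le_trans N3P _; rewrite ler_nat.
    by rewrite ler_pdivrMr //; clear; lra.
  have nk : (n - k)%:R ^+ b = (1 - k%:R / n%:R) ^+ b * n%:R ^+ b :> R.
    by rewrite -exprMn natrB //; congr (_ ^+ _); field; rewrite lt0r_neq0.
  rewrite -mulrA; apply: le_trans (_ : (mu + gamma) * (n - k)%:R ^+ b <= _); last first.
    by rewrite ler_wpM2l //; move: mu0 g0; clear; lra.
  rewrite nk mulrA ler_wpM2r ?exprn_ge0 ?ler0n //.
  move: mu0 g0 mug1 bern bx; clear; set u := (1 - _) ^+ b; set v := b%:R * _.
  move=> mu0 g0 mug1 bern bx.
  have : (mu + gamma) * (1 - gamma / 2) <= (mu + gamma) * u.
    by rewrite ler_wpM2l //; lra.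
  have : (mu + gamma) * (gamma / 2) <= 1 * (gamma / 2) by rewrite ler_wpM2r //; lra.
  lra.
have cT : #|[set: V]| = n by rewrite cardsT cV.
have := cP V E finset.set0 0%N G (fun=> b) theta uniE bk cG theta1 base [set: V].
rewrite cT; move/(_ nn0 ns (bal _) top)/le_trans; apply; rewrite ler_nat.
rewrite /num_optimal_matchings; apply: subset_leq_card; apply/subsetP => M.
rewrite !inE cardsT => /and4P[ME tM _ nM].
by rewrite /optimal_matching /matching ME tM.
Qed.

End DegreeThreshold.

(** * Reachability and absorbers *)

Section Averages.
Variables (R : realType) (V : finType).
Hypothesis V_gt0 : (0 < #|V|)%N.
Implicit Types (f g : seq V -> R) (F : V -> R) (r : nat).

Definition mean F : R := (\sum_x F x) / #|V|%:R.

(** The expectation of [f] over a uniform random [r]-tuple of vertices, repetitions allowed. With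
    ordered tuples, concatenated blocks are independent and densities simply multiply. *)
Fixpoint avg r f : R :=
  if r is r'.+1 then mean (fun x => avg r' (fun s => f (x :: s))) else f [::].

Let n0 : #|V|%:R != 0 :> R.
Proof. by rewrite pnatr_eq0 -lt0n. Qed.

Lemma le_mean F F' : (forall x, F x <= F' x) -> mean F <= mean F'.
Proof. by move=> h; rewrite ler_wpM2r ?invr_ge0 ?ler0n //; apply: ler_sum. Qed.

Lemma meanD F F' : mean (fun x => F x + F' x) = mean F + mean F'.
Proof. by rewrite /mean big_split mulrDl. Qed.

Lemma meanZ c F : mean (fun x => c * F x) = c * mean F.
Proof. by rewrite /mean -mulr_sumr mulrA. Qed.

Lemma mean_cst c : mean (fun=> c) = c.
Proof. by rewrite /mean sumr_const -[_ *+ _]mulr_natl mulrAC divff ?mul1r. Qed.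

Lemma mean_indic (X : {set V}) : mean (fun x => (x \in X)%:R) = #|X|%:R / #|V|%:R.
Proof.
rewrite /mean -sum1_card natr_sum [in RHS]big_mkcond /=.
by congr (_ / _); apply: eq_bigr => x _; case: (x \in X).
Qed.

Lemma avg_ext r f g : (forall s, size s = r -> f s = g s) -> avg r f = avg r g.
Proof.
elim: r f g => [|r IHr] f g h /=; first exact: h.
congr (_ / _); apply: eq_bigr => x _; apply: IHr => s sr.
by apply: h; rewrite /= sr.
Qed.

Lemma le_avg r f g : (forall s, size s = r -> f s <= g s) -> avg r f <= avg r g.
Proof.
elim: r f g => [|r IHr] f g h /=; first exact: h.
by apply: le_mean => x; apply: IHr => s sr; apply: h; rewrite /= sr.
Qed.

Lemma avgD r f g : avg r (fun s => f s + g s) = avg r f + avg r g.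
Proof.
elim: r f g => //= r IHr f g; rewrite -meanD.
by congr (_ / _); apply: eq_bigr => x _; apply: IHr.
Qed.

Lemma avgZ r c f : avg r (fun s => c * f s) = c * avg r f.
Proof.
elim: r f => //= r IHr f; rewrite -meanZ.
by congr (_ / _); apply: eq_bigr => x _; apply: IHr.
Qed.

Lemma avg_cst r c : avg r (fun=> c) = c.
Proof.
elim: r => //= r IHr; rewrite -[RHS]mean_cst.
by congr (_ / _); apply: eq_bigr.
Qed.

Lemma avg_ge0 r f : (forall s, size s = r -> 0 <= f s) -> 0 <= avg r f.
Proof. by move=> h; rewrite -(avg_cst r 0); apply: le_avg. Qed.

Lemma avg_cat r1 r2 f :
  avg (r1 + r2) f = avg r1 (fun s => avg r2 (fun t => f (s ++ t))).
Proof.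
elim: r1 f => //= r1 IHr f.
by congr (_ / _); apply: eq_bigr => x _; apply: IHr.
Qed.

Lemma mean_avg r (f : V -> seq V -> R) :
  mean (fun x => avg r (f x)) = avg r (fun s => mean (f^~ s)).
Proof.
elim: r f => //= r IHr f.
transitivity (mean (fun y => mean (fun x => avg r (fun s => f x (y :: s))))).
  by rewrite /mean -2!mulr_suml exchange_big.
congr (_ / _); apply: eq_bigr => y _.
exact: (IHr (fun x s => f x (y :: s))).
Qed.

Lemma avg_mul_le r1 r2 f g h :
  (forall s, size s = r1 -> 0 <= g s) -> (forall t, size t = r2 -> 0 <= h t) ->
  (forall s t, size s = r1 -> size t = r2 -> g s * h t <= f (s ++ t)) ->
  avg r1 g * avg r2 h <= avg (r1 + r2) f.
Proof.
move=> g0 h0 fgh; rewrite avg_cat mulrC -avgZ; apply: le_avg => s sr.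
by rewrite mulrC -avgZ; apply: le_avg => t tr; apply: fgh.
Qed.

(** Each new entry repeats an earlier one or meets [L] with probability at most
    [(r + size L) / n]. *)
Lemma avg_not_uniq r (L : seq V) : uniq L ->
  avg r (fun s => (~~ uniq (L ++ s))%:R) <= (r * (r + size L))%:R / #|V|%:R.
Proof.
elim: r L => [|r IHr] L uL /=; first by rewrite cats0 uL mul0n mul0r.
apply: le_trans (_ : mean (fun x => (x \in [set y in L])%:R +
    (r * (r + (size L).+1))%:R / #|V|%:R) <= _).
  apply: le_mean => x; rewrite inE; have [xL|xL] := boolP (x \in L).
    rewrite -[leLHS]addr0; apply: lerD; last by rewrite divr_ge0 ?ler0n.
    rewrite -[leRHS](avg_cst r); apply: le_avg => s _.
    by rewrite ler_nat; case: (~~ _).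
  rewrite add0r -(size_rcons L x); apply: le_trans (IHr (rcons L x) _).
    by apply: le_avg => s _; rewrite cat_rcons.
  by rewrite rcons_uniq xL uL.
rewrite meanD mean_cst mean_indic -mulrDl ler_wpM2r ?invr_ge0 ?ler0n //.
have cL : (#|[set y in L]| <= size L)%N.
  by rewrite (eq_card (B := mem L)) ?card_size // => y; rewrite inE.
by rewrite -natrD ler_nat; move: cL; move: #|_| (size L) => a b; clear; nia.
Qed.

End Averages.

(** * Exchanging tuples of vertices *)

Section RobustMatchings.
Variables (R : realType) (V : finType) (k : nat) (E : {set {set V}}).
Hypotheses (V_gt0 : (0 < #|V|)%N) (k_gt0 : (0 < k)%N).
Implicit Types (s S T Q z : seq V).

Definition edge_seq s := (size s == k) && ([set x in s] \in E).

(* Blocks may overlap: disjointness is imposed only at the very end, when the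
   few sequences with repetitions are discarded. *)
Definition pm s := exists2 es : seq (seq V), all edge_seq es & perm_eq s (flatten es).

Lemma pm_nil : pm [::].
Proof. by exists [::]. Qed.

Lemma pm_edge s : edge_seq s -> pm s.
Proof. by move=> e; exists [:: s]; rewrite /= ?e ?cats0. Qed.

Lemma pm_cat s t : pm s -> pm t -> pm (s ++ t).
Proof.
move=> [es1 e1 p1] [es2 e2 p2]; exists (es1 ++ es2); first by rewrite all_cat e1.
by rewrite flatten_cat perm_cat.
Qed.

Lemma pm_perm s t : perm_eq s t -> pm s -> pm t.
Proof. by move=> st [es ees p]; exists es => //; apply: perm_trans p; rewrite perm_sym. Qed.

Lemma edge_seq_perm s t : perm_eq s t -> edge_seq s -> edge_seq t.
Proof.
move=> st /andP[/eqP cs sE]; apply/andP; split; first by rewrite -(perm_size st) cs.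
by rewrite (_ : [set x in t] = [set x in s]) //; apply/setP => x; rewrite !inE (perm_mem st).
Qed.

(* The density of the [r]-tuples completing both [S] and [T]; they allow exchanging [S] for [T]. *)
Definition sigma r S T : R := avg r (fun z => `[< pm (S ++ z) /\ pm (T ++ z) >]%:R).

Lemma sigma_ge0 r S T : 0 <= sigma r S T.
Proof. by apply: avg_ge0 => // s _; rewrite ler0n. Qed.

Lemma le_natb (a b : bool) : (a -> b) -> a%:R <= b%:R :> R.
Proof. by case: a b => [] [] // /(_ isT). Qed.

Lemma natbM (a b : bool) : a%:R * b%:R = (a && b)%:R :> R.
Proof. by case: a b => [] []; rewrite ?mulr1 ?mulr0. Qed.

Lemma sigma_le r S T S' T' : (forall z, pm (S ++ z) -> pm (T ++ z) ->
  pm (S' ++ z) /\ pm (T' ++ z)) -> sigma r S T <= sigma r S' T'.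
Proof.
move=> h; apply: le_avg => z _; apply: le_natb => /asboolP[p1 p2].
by apply/asboolP; apply: h.
Qed.

Lemma sigma_sym r S T : sigma r S T <= sigma r T S.
Proof. by apply: sigma_le. Qed.

Lemma sigma_perm r S T S' T' : perm_eq S S' -> perm_eq T T' ->
  sigma r S T <= sigma r S' T'.
Proof.
move=> pS pT; apply: sigma_le => z p1 p2; split.
  by apply: pm_perm p1; rewrite perm_cat2r.
by apply: pm_perm p2; rewrite perm_cat2r.
Qed.

Lemma sigma_cat r1 r2 S1 T1 S2 T2 :
  sigma r1 S1 T1 * sigma r2 S2 T2 <= sigma (r1 + r2) (S1 ++ S2) (T1 ++ T2).
Proof.
apply: avg_mul_le => //; [by move=> *; rewrite ler0n..|] => z1 z2 _ _.
rewrite natbM; apply: le_natb => /andP[/asboolP[p1 q1] /asboolP[p2 q2]].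
apply/asboolP; split.
  by apply: pm_perm (pm_cat p1 p2); rewrite perm_catACA.
by apply: pm_perm (pm_cat q1 q2); rewrite perm_catACA.
Qed.

(** The tuple [Q z1 z2] completes [S] as [(S z1) (Q z2)] and [T] as [(T z2) (Q z1)]. *)
Lemma sigma_trans q r1 r2 S T :
  avg q (fun Q => sigma r1 S Q * sigma r2 Q T) <= sigma (q + (r1 + r2)) S T.
Proof.
rewrite /sigma avg_cat; apply: le_avg => Q _.
apply: avg_mul_le => //; [by move=> *; rewrite ler0n..|] => z1 z2 _ _.
rewrite natbM; apply: le_natb => /andP[/asboolP[p1 q1] /asboolP[p2 q2]].
apply/asboolP; split.
  apply: pm_perm (pm_cat p1 p2); rewrite -catA perm_cat2l.
  by rewrite perm_catCA.
apply: pm_perm (pm_cat q1 q2).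
by apply/permP => a; rewrite !count_cat; clear; lia.
Qed.

Definition edge_density : R := avg k (fun s => (edge_seq s)%:R).

Lemma sigma_pad r S T : sigma r S T * edge_density <= sigma (r + k) S T.
Proof.
apply: avg_mul_le => //; [by move=> *; rewrite ler0n..|] => z e _ _.
rewrite natbM; apply: le_natb => /andP[/asboolP[p q] /pm_edge pe].
by apply/asboolP; split; rewrite catA; apply: pm_cat.
Qed.

Lemma pm_matching s : uniform k E -> pm s -> uniq s ->
  exists M : {set {set V}}, [/\ M \subset E, trivIset M, cover M = [set x in s]
    & (#|M| * k)%N = size s].
Proof.
move=> uniE [es]; elim: es s => [|e es IHes] s /=.
  move=> _ /perm_nilP -> _; exists finset.set0; rewrite cards0; split=> //.
  - exact: sub0set.
  - by apply/trivIsetP => A B; rewrite inE.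
  - by rewrite /cover big_set0; apply/setP => x; rewrite !inE.
move=> /andP[/andP[/eqP ck eE] aes] ps us.
have := us; rewrite (perm_uniq ps) cat_uniq => /and3P[ue dis ues].
have [M [ME tM cM nM]] := IHes _ aes (perm_refl _) ues.
have c1 : cover [set [set x in e]] = [set x in e] by rewrite /cover big_set1.
have dc : [disjoint cover [set [set x in e]] & cover M].
  rewrite c1 cM -setI_eq0; apply/eqP/setP => x; rewrite !inE; apply/negP.
  by case/andP => xe xes; case/hasP: dis; exists x.
have e1E : [set [set x in e]] \subset E by rewrite sub1set.
have te : trivIset [set [set x in e]].
  by apply/trivIsetP => A B; rewrite !inE => /eqP-> /eqP->; rewrite eqxx.
have [h1 h2 h3 h4] := matching_setU k_gt0 uniE e1E te ME tM dc.
exists ([set [set x in e]] :|: M); split=> //.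
  by rewrite h3 c1 cM; apply/setP => x; rewrite !inE (perm_mem ps) mem_cat.
by rewrite h4 cards1 mulnDl mul1n nM (perm_size ps) size_cat ck.
Qed.

End RobustMatchings.

(** * Reachability between vertices *)

Section Reachability.
Variables (R : realType) (V : finType) (k : nat) (E : {set {set V}}).
Hypotheses (k_ge3 : (3 <= k)%N) (uniE : uniform k E) (V_gt0 : (0 < #|V|)%N).
Local Notation n := (#|V|%:R : R).
Hypothesis codeg : forall S : {set V}, #|S| = k.-1 ->
  9 / 20 * n <= #|[set x | x |: S \in E]|%:R.
Hypothesis V_large : (k * k)%:R / n <= (1 / 50) ^+ k / 100.
Local Notation avg := (@avg R V).
Local Notation mean := (@mean R V).
Local Notation edge_seq := (edge_seq k E).
Local Notation sigma := (sigma R k E).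
Local Notation frac X := (#|X|%:R / n).
Implicit Types (u v w : V) (A X Y Z : {set V}).

Let k_gt0 : (0 < k)%N. Proof. exact: leq_trans k_ge3. Qed.
Let kE : k = k.-1.+1. Proof. by rewrite prednK. Qed.
Let k1E : k.-1 = k.-2.+1. Proof. by case: k k_ge3 => [|[|]]. Qed.
Let n_gt0 : 0 < n. Proof. by rewrite ltr0n. Qed.

Lemma edge_seq_uniq s : edge_seq s -> uniq s.
Proof.
move=> /andP[/eqP cs sE]; apply/card_uniqP; rewrite cs -(eqP (forall_inP uniE _ sE)).
by apply: eq_card => x; rewrite inE.
Qed.

Lemma avg_uniq r (L : seq V) : uniq L -> (r + size L <= k)%N ->
  999 / 1000 <= avg r (fun s => (uniq (L ++ s))%:R).
Proof.
move=> uL rk; have := avg_not_uniq R V_gt0 r uL.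
have : avg r (fun s => (~~ uniq (L ++ s))%:R) + avg r (fun s => (uniq (L ++ s))%:R) = 1.
  rewrite -avgD -[RHS](avg_cst V_gt0 r); apply: avg_ext => s _.
  by case: (uniq (L ++ s)); rewrite /= ?mulr0n ?mulr1n; lra.
have le1 : (r * (r + size L))%:R / n <= (k * k)%:R / n.
  rewrite ler_wpM2r ?invr_ge0 ?ler0n // ler_nat leq_mul //.
  by apply: leq_trans rk; apply: leq_addr.
have : (1 / 50) ^+ k <= 1 / 50 :> R.
  by rewrite kE exprS ler_piMr ?exprn_ile1 //; lra.
move: le1 V_large; lra.
Qed.

Lemma deg_ge (T : seq V) : size T = k.-1 -> uniq T ->
  9 / 20 <= mean (fun x => (edge_seq (x :: T))%:R).
Proof.
move=> cT uT.
have cS : #|[set x in T]| = k.-1.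
  by rewrite -cT -(card_uniqP uT); apply: eq_card => x; rewrite inE.
have := codeg cS; rewrite -ler_pdivlMr // -mean_indic => h; apply: le_trans h _.
apply: le_mean => x; apply: le_natb; rewrite inE /edge_seq /= cT -kE eqxx /=.
by rewrite (_ : [set y in x :: T] = x |: [set y in T]) //; apply/setP => y; rewrite !inE.
Qed.

(** All but one entry of the tuple are free, and the last one is counted by the codegree. The drop
    from 45 to 44 hundredths covers the tuples with repetitions. *)
Lemma link_ge u : 44 / 100 <= avg k.-1 (fun T => (edge_seq (u :: T))%:R).
Proof.
rewrite k1E /= mean_avg.
apply: le_trans (_ : avg k.-2 (fun T => 9 / 20 * (uniq ([:: u] ++ T))%:R) <= _).
  have := @avg_uniq k.-2 [:: u] isT _; rewrite avgZ addn1 -k1E => /(_ (leq_pred _)).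
  by lra.
apply: le_avg => T sT; have [uT|_] := boolP (uniq _); last first.
  by rewrite mulr0 -[leLHS](mean_cst V_gt0); apply: le_mean => x; rewrite ler0n.
rewrite mulr1; have cT : size (u :: T) = k.-1 by rewrite /= sT -k1E.
apply: le_trans (deg_ge cT uT) _; apply: le_mean => x; apply: le_natb.
by apply: edge_seq_perm; rewrite -[x :: _]/([:: x] ++ [:: u] ++ T) perm_catCA.
Qed.

Lemma edge_density_ge : 44 / 100 <= edge_density R k E.
Proof.
rewrite /edge_density kE /= -[leLHS](mean_cst V_gt0) -kE.
exact: (le_mean (fun u => link_ge u)).
Qed.

(** Reachability as in the absorption method: with tuples of length [j * k - 1], each of the two
    vertices is completed to [j] edges. *)
Definition near j (eta : R) u v := eta <= sigma (j * k).-1 [:: u] [:: v].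

Lemma near_sym j eta u v : near j eta u v -> near j eta v u.
Proof. by move=> h; apply: le_trans h _; apply: sigma_sym. Qed.

Lemma near_mono j eta eta' u v : eta' <= eta -> near j eta u v -> near j eta' u v.
Proof. by move=> h1 h2; apply: le_trans h2. Qed.

(** Padding with edges, of density above 2/5, brings different exchanges to a common length. *)
Lemma near_pad j i eta u v : (0 < j)%N -> 0 <= eta -> near j eta u v ->
  near (j + i) (eta * (2 / 5) ^+ i) u v.
Proof.
move=> j0 e0; elim: i => [|i IHi] h; first by rewrite addn0 expr0 mulr1.
rewrite /near addnS mulSn addnC -[((j + i) * k)%N]prednK ?muln_gt0 ?addn_gt0 ?j0 //.
rewrite addSn /=; apply: le_trans (sigma_pad _ _ _ _ _ _).
have q0 : 0 <= 2 / 5 :> R by lra.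
have qd : 2 / 5 <= edge_density R k E by have := edge_density_ge; lra.
move: (2 / 5) q0 qd IHi => q q0 qd IHi.
by rewrite exprSr mulrA; apply: ler_pM; rewrite ?mulr_ge0 ?exprn_ge0 //; exact: IHi.
Qed.

(** The intermediate vertex [w] is part of the exchanging tuple, whose length
    [1 + (i * k - 1) + (j * k - 1)] is [(i + j) * k - 1]. *)
Lemma near_trans i j X (kap e1 e2 : R) u v : (0 < i)%N -> (0 < j)%N ->
  0 <= e1 -> 0 <= e2 -> kap <= frac X ->
  (forall w, w \in X -> near i e1 u w /\ near j e2 w v) ->
  near (i + j) (kap * e1 * e2) u v.
Proof.
move=> i0 j0 e10 e20 kX h; rewrite /near mulnDl.
have -> : (i * k + j * k).-1 = (1 + ((i * k).-1 + (j * k).-1))%N.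
  have : (0 < i * k)%N by rewrite muln_gt0 i0.
  have : (0 < j * k)%N by rewrite muln_gt0 j0.
  by move: (i * k)%N (j * k)%N => a b; lia.
apply: le_trans (sigma_trans _ _ _ _ _ _ _ _).
apply: le_trans (_ : mean (fun w => (e1 * e2) * (w \in X)%:R) <= _).
  by rewrite meanZ mean_indic -mulrA [leLHS]mulrC ler_wpM2l ?mulr_ge0.
apply: le_mean => w /=; have [wX|_] := boolP (w \in X).
  by rewrite mulr1; have [h1 h2] := h w wX; apply: ler_pM.
by rewrite mulr0 mulr_ge0 ?sigma_ge0.
Qed.

(** Inclusion-exclusion: three families of density 44/100 in a space of measure 1 have pairwise
    intersections of total density at least 132/100 - 1. *)
Lemma sigma1_triple u v w : 32 / 100 <= sigma k.-1 [:: u] [:: v] +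
  sigma k.-1 [:: u] [:: w] + sigma k.-1 [:: v] [:: w].
Proof.
have rho_le (x y : V) : avg k.-1 (fun T => (edge_seq (x :: T) && edge_seq (y :: T))%:R)
    <= sigma k.-1 [:: x] [:: y].
  apply: le_avg => T _; apply: le_natb => /andP[ex ey]; apply/asboolP.
  by split; apply: pm_edge.
apply: le_trans (lerD (lerD (rho_le u v) (rho_le u w)) (rho_le v w)).
have := link_ge u; have := link_ge v; have := link_ge w.
pose F x : seq V -> R := fun T => (edge_seq (x :: T))%:R.
rewrite -!avgD; suff : avg k.-1 (F u) + avg k.-1 (F v) + avg k.-1 (F w) <= 1 +
   avg k.-1 (fun T => (edge_seq (u :: T) && edge_seq (v :: T))%:R
   + (edge_seq (u :: T) && edge_seq (w :: T))%:R
   + (edge_seq (v :: T) && edge_seq (w :: T))%:R) by rewrite /F; lra.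
rewrite -!avgD -[X in X + avg _ _](avg_cst V_gt0 k.-1) -avgD.
apply: le_avg => T _; rewrite /F; case: (edge_seq (u :: T)); case: (edge_seq (v :: T));
  case: (edge_seq (w :: T)) => /=; lra.
Qed.

(** The threshold satisfies [32/100 - 2/10 > 1/10], so two non-adjacent pairs sharing a vertex force
    the third pair to be adjacent. *)
Definition adj u v : bool := 1 / 10 <= sigma k.-1 [:: u] [:: v].

Lemma adjC u v : adj u v = adj v u.
Proof. by apply/idP/idP => h; apply: le_trans h _; apply: sigma_sym. Qed.

Lemma adj_near u v : adj u v = (near 1 (1 / 10) u v) :> bool.
Proof. by rewrite /near mul1n. Qed.

Lemma adj_triple u v w : ~~ adj u w -> ~~ adj v w -> adj u v.
Proof. by rewrite /adj -!ltNge; have := sigma1_triple u v w; lra. Qed.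

Definition nbr u : {set V} := [set w | adj u w].

(** The mean exchange density from [u] is at least [9/20 * 44/100]: take a link tuple of [u], then
    another vertex completing it. Non-neighbours contribute at most 1/10 to this mean. *)
Lemma nbr_frac u : 9 / 100 <= frac (nbr u).
Proof.
have avg_adj : 19 / 100 <= mean (fun w => sigma k.-1 [:: u] [:: w]).
  apply: le_trans (_ : mean (fun w => avg k.-1 (fun T =>
      (edge_seq (u :: T) && edge_seq (w :: T))%:R)) <= _); last first.
    apply: le_mean => w; apply: le_avg => T _; apply: le_natb => /andP[ex ey].
    by apply/asboolP; split; apply: pm_edge.
  rewrite mean_avg; apply: le_trans (_ : avg k.-1 (fun T =>
      9 / 20 * (edge_seq (u :: T))%:R) <= _); first by rewrite avgZ; have := link_ge u; lra.
  apply: le_avg => T sT; have [eT|_] := boolP (edge_seq (u :: T)); last first.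
    by rewrite mulr0 -[leLHS](mean_cst V_gt0); apply: le_mean => x; rewrite ler0n.
  rewrite mulr1; apply: deg_ge => //.
  by have := edge_seq_uniq eT; rewrite /= => /andP[].
have : mean (fun w => sigma k.-1 [:: u] [:: w]) <=
    mean (fun w => (w \in nbr u)%:R + 1 / 10).
  apply: le_mean => w; rewrite inE; have [h|h] := boolP (adj u w).
    have : sigma k.-1 [:: u] [:: w] <= 1.
      rewrite -[leRHS](avg_cst V_gt0 k.-1); apply: le_avg => s _.
      by case: asbool; rewrite ?ler01.
    by move=> le1; apply: le_trans le1 _; rewrite lerDl; lra.
  by rewrite add0r ltW // ltNge.
rewrite meanD mean_cst // mean_indic; move: avg_adj; lra.
Qed.

Lemma near_weak i j (eta eta' : R) u v : (0 < i <= j)%N -> 0 <= eta ->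
  eta' <= eta * (2 / 5) ^+ (j - i) -> near i eta u v -> near j eta' u v.
Proof.
move=> /andP[i0 ij] e0 le h; apply: near_mono le _.
by rewrite -(subnKC ij) {2}(subnKC ij); apply: near_pad.
Qed.

Lemma near_of_adj u v : adj u v -> near 1 (1 / 10) u v.
Proof. by rewrite adj_near. Qed.

Lemma frac_subset X Y : X \subset Y -> frac X <= frac Y.
Proof. by move=> XY; rewrite ler_wpM2r ?invr_ge0 ?ler0n // ler_nat subset_leq_card. Qed.

Lemma frac_setU X Y : frac (X :|: Y) <= frac X + frac Y.
Proof.
rewrite -mulrDl ler_wpM2r ?invr_ge0 ?ler0n // -natrD ler_nat.
exact: leq_card_setU.
Qed.

Lemma frac_cover X Y Z : X \subset Y :|: Z -> frac X <= frac Y + frac Z.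
Proof. by move=> /frac_subset/le_trans; apply; apply: frac_setU. Qed.

Definition closed_classes A := forall u v, (u \in A) = (v \in A) ->
  near 3 ((1 / 10) ^+ 7) u v.

(* Two non-adjacent vertices with few common neighbours split the vertices
   into two classes, since adjacency has no independent triple. *)
Lemma reachability_dichotomy :
  (forall u v, near 5 ((1 / 10) ^+ 12) u v) \/
  exists A, [/\ closed_classes A, 1 / 50 <= frac A & 1 / 50 <= frac (~: A)].
Proof.
have [all|] := boolP [forall u, forall v, adj u v ||
    (1 / 100 <= frac (nbr u :&: nbr v))].
  left=> u v; have /orP[/near_of_adj h|h] := forallP (forallP all u) v.
    by apply: near_weak h => //; lra.
  have q0 : 0 <= 1 / 10 :> R by lra.
  have /near_weak : near 2 (1 / 100 * (1 / 10) * (1 / 10)) u v.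
    apply: (near_trans (i := 1) (j := 1) isT isT q0 q0 h) => w.
    by rewrite !inE => /andP[uw vw]; rewrite adjC in vw; split; apply: near_of_adj.
  by apply => //; lra.
case/forallPn => u0 /forallPn[v0]; rewrite negb_or => /andP[uv0 few].
set C := nbr u0 :&: nbr v0 in few; rewrite -ltNge in few.
(* The private neighbours of [u0] all miss [v0], hence form a clique, and likewise for those of
   [v0]; every vertex is adjacent to [u0] or [v0], so the two cliques cover all but the small set
   [C]. *)
pose A' := nbr u0 :\: nbr v0; pose B' := nbr v0 :\: nbr u0.
have cliqueA a1 a2 : a1 \in A' -> a2 \in A' -> adj a1 a2.
  rewrite !inE => /andP[n1 _] /andP[n2 _]; rewrite adjC in n1; rewrite adjC in n2.
  exact: adj_triple n1 n2.
have cliqueB b1 b2 : b1 \in B' -> b2 \in B' -> adj b1 b2.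
  rewrite !inE => /andP[n1 _] /andP[n2 _]; rewrite adjC in n1; rewrite adjC in n2.
  exact: adj_triple n1 n2.
have cov w : w \in A' :|: B' :|: C.
  rewrite !inE; have [h|h] := boolP (adj u0 w); have [g|g] := boolP (adj v0 w) => //=.
  by exfalso; move: uv0; rewrite (adj_triple h g).
have fracA' : 8 / 100 <= frac A'.
  have := nbr_frac u0; have /frac_cover : nbr u0 \subset A' :|: C.
    by apply/subsetP => w; rewrite !inE; case: (adj u0 w) => //=; case: adj.
  by move: few; lra.
(* Otherwise the neighbourhood of [w] would be smaller than [4/100 + 4/100 + 1/100]. *)
have half w : (4 / 100 <= frac (nbr w :&: A')) || (4 / 100 <= frac (nbr w :&: B')).
  rewrite -[_ || _]negbK negb_or -!ltNge; apply/negP => /andP[h1 h2].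
  have := nbr_frac w; have /frac_cover : nbr w \subset ((nbr w :&: A') :|: (nbr w :&: B')) :|: C.
    apply/subsetP => x wx; have := cov x; rewrite [x \in _ :|: C]inE => /orP[xAB|xC].
      by rewrite inE; apply/orP; left; rewrite -setIUr inE wx.
    by rewrite inE xC orbT.
  have := frac_setU (nbr w :&: A') (nbr w :&: B'); move: few h1 h2; lra.
pose A := [set w | 4 / 100 <= frac (nbr w :&: A')].
have A'A : A' \subset A.
  apply/subsetP => a aA'; rewrite inE; apply: le_trans (_ : frac A' <= _); first by lra.
  apply: frac_subset; apply/subsetP => x xA'; rewrite in_setI xA' andbT inE.
  exact: cliqueA.
have fracA : 8 / 100 <= frac A by apply: le_trans fracA' (frac_subset A'A).
have BP w : w \notin A -> 4 / 100 <= frac (nbr w :&: B').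
  by rewrite inE => wA; have := half w; rewrite (negPf wA).
have q0 : 0 <= 1 / 10 :> R by lra.
have qn0 i : 0 <= (1 / 10) ^+ i :> R by rewrite exprn_ge0.
(* A path of length three whose inner vertices lie in the clique [X]; the exponent 7 covers two
   densities 4/100 and three adjacencies of weight 1/10. *)
have via X u v : (forall x y, x \in X -> y \in X -> adj x y) ->
    4 / 100 <= frac (nbr u :&: X) -> 4 / 100 <= frac (nbr v :&: X) ->
    near 3 ((1 / 10) ^+ 7) u v.
  move=> cliqueX uX vX.
  have near2 x : x \in X -> near 2 ((1 / 10) ^+ 4) u x.
    move=> xX; apply: near_mono (near_trans (i := 1) (j := 1) isT isT q0 q0 uX _).
      lra.
    move=> w; rewrite !inE => /andP[uw wX]; split; apply: near_of_adj => //.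
    exact: cliqueX.
  apply: near_mono (near_trans (i := 2) (j := 1) isT isT (qn0 4%N) q0 vX _); first by lra.
  move=> w; rewrite !inE => /andP[vw wX]; split; first exact: near2.
  by apply: near_of_adj; rewrite adjC.
have closedA : closed_classes A.
  move=> u v; have [uA|uB] := boolP (u \in A).
    by move=> /esym vA; apply: (via A') => //; [move: uA | move: vA]; rewrite inE.
  by move=> /esym/negbT vB; apply: (via B') => //; apply: BP.
have [fB|fB] := lerP (1 / 50) (frac (~: A)).
  by right; exists A; split=> //; lra.
left.
(* If the outside of [A] is this small, a vertex [b] there still has a fraction 2/100 of neighbours
   inside [A], which ties it to the whole of [A]. *)
have near4 b a : b \notin A -> a \in A -> near 4 ((1 / 10) ^+ 10) b a.
  move=> bB aA; pose X := nbr b :&: B' :&: A.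
  have fX : 2 / 100 <= frac X.
    have := BP b bB; have /frac_cover : nbr b :&: B' \subset X :|: ~: A.
      by apply/subsetP => x; rewrite /X !inE => /andP[-> ->]; rewrite andTb orbN.
    move: fB; lra.
  apply: near_mono (near_trans (i := 1) (j := 3) isT isT q0 (qn0 7%N) fX _); first by lra.
  move=> w; rewrite inE => /andP[]; rewrite !inE => /andP[bw _] wA; split.
    exact: near_of_adj.
  by apply: closedA; rewrite aA inE.
move=> u v; have [uA|uB] := boolP (u \in A); have [vA|vB] := boolP (v \in A).
- have h : near 3 ((1 / 10) ^+ 7) u v by apply: closedA; rewrite uA.
  by apply: near_weak h => //; lra.
- by have /near_sym h := near4 v u vB uA; apply: near_weak h => //; lra.
- by have h := near4 u v uB vA; apply: near_weak h => //; lra.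
- have h : near 3 ((1 / 10) ^+ 7) u v by apply: closedA; rewrite (negPf uB) (negPf vB).
  by apply: near_weak h => //; lra.
Qed.

End Reachability.

(** * Vertex classes, edge types and absorbing tuples *)

Section Absorbers.
Variables (R : realType) (V : finType) (k : nat) (E : {set {set V}}).
Hypotheses (k_ge3 : (3 <= k)%N) (uniE : uniform k E) (V_gt0 : (0 < #|V|)%N).
Local Notation n := (#|V|%:R : R).
Hypothesis codeg : forall S : {set V}, #|S| = k.-1 ->
  9 / 20 * n <= #|[set x | x |: S \in E]|%:R.
Hypothesis V_large : (k * k)%:R / n <= (1 / 50) ^+ k / 100.
Local Notation avg := (@avg R V).
Local Notation mean := (@mean R V).
Local Notation edge_seq := (edge_seq k E).
Local Notation pm := (pm k E).
Local Notation sigma := (sigma R k E).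
Local Notation frac X := (#|X|%:R / n).
Local Notation cnt A s := (count [in A] s).
Implicit Types (u v w : V) (A X Y Z : {set V}) (s S T L z Q F : seq V).

Let k_gt0 : (0 < k)%N. Proof. exact: leq_trans k_ge3. Qed.
Let kE : k = k.-1.+1. Proof. by rewrite prednK. Qed.
Let n_gt0 : 0 < n. Proof. by rewrite ltr0n. Qed.

Lemma avg_ge_cond r (P : pred (seq V)) (g : seq V -> R) c :
  (forall s, size s = r -> 0 <= g s) ->
  (forall s, size s = r -> P s -> c <= g s) ->
  c * avg r (fun s => (P s)%:R) <= avg r g.
Proof.
move=> g0 h; rewrite -avgZ; apply: le_avg => s sr.
have [Ps|_] := boolP (P s); first by rewrite mulr1; apply: h.
by rewrite mulr0; apply: g0.
Qed.

(** Equal length and equal trace on [A] allow pairing the vertices of [S] with those of [T] within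
    classes; the exchanges of the pairs are concatenated. *)
Lemma class_sigma A j (e : R) : (0 < j)%N -> 0 <= e ->
  (forall u v, (u \in A) = (v \in A) -> near k E j e u v) ->
  forall S T, size S = size T -> cnt A S = cnt A T ->
  e ^+ size S <= sigma (size S * (j * k).-1) S T.
Proof.
move=> j0 e0 cl; elim=> [|x S IHS] T /=.
  move=> /esym/size0nil -> _; rewrite expr0 mul0n /sigma /=.
  by rewrite (_ : `[< _ >] = true) //; apply/asboolP; split; apply: pm_nil.
move=> sz ct.
have [y yT xy] : exists2 y, y \in T & (y \in A) = (x \in A).
  have [xA|xA] := boolP (x \in A).
    have : (0 < cnt A T)%N by rewrite -ct xA.
    by rewrite -has_count => /hasP[y yT yA]; exists y.
  have : (0 < count (predC [in A]) T)%N.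
    have := count_predC [in A] T; rewrite -sz -ct (negPf xA) add0n.
    have := count_size [in A] S; move: (count _ _) (count _ _) (size _) => c1 c2 c3; lia.
  by rewrite -has_count => /hasP[y yT /= yA]; exists y => //; apply/negbTE.
have pT := perm_to_rem yT.
have szT : size S = size (rem y T) by move: sz; rewrite (perm_size pT) => -[].
have ctT : cnt A S = cnt A (rem y T).
  by move: ct; rewrite (seq.permP pT) /= xy => /addnI.
rewrite exprS mulSn; apply: le_trans (_ : sigma (j * k).-1 [:: x] [:: y] *
   sigma (size S * (j * k).-1) S (rem y T) <= _).
  apply: ler_pM; rewrite ?exprn_ge0 //; last exact: IHS.
  by apply: cl; rewrite xy.
apply: le_trans (sigma_cat _ _ _ _ _ _ _ _ _) _.
by apply: sigma_perm; rewrite // perm_sym.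
Qed.

Definition type_density A i : R :=
  avg k (fun s => (edge_seq s && (cnt A s == i))%:R).

Lemma pattern_density A i r : (i <= r)%N -> 1 / 50 <= frac A ->
  1 / 50 <= frac (~: A) -> (1 / 50) ^+ r <= avg r (fun s => (cnt A s == i)%:R).
Proof.
move=> + fA fB; elim: r i => [|r IHr] i ir.
  by move: ir; rewrite leqn0 => /eqP ->; rewrite expr0.
have q0 : 0 <= (1 / 50) ^+ r :> R by rewrite exprn_ge0.
have [X [fX hX]] : exists X, 1 / 50 <= frac X /\ forall x, x \in X ->
    (1 / 50) ^+ r <= avg r (fun s => (cnt A (x :: s) == i)%:R).
  case: i ir => [_|i ir].
    exists (~: A); split=> // x; rewrite inE => /negPf xA.
    by under avg_ext => s _ do rewrite /= xA add0n; apply: IHr.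
  exists A; split=> // x xA.
  by under avg_ext => s _ do rewrite /= xA add1n eqSS; apply: IHr.
rewrite exprS /=; apply: le_trans (_ : mean (fun x => (1 / 50) ^+ r * (x \in X)%:R) <= _).
  by rewrite meanZ mean_indic mulrC ler_wpM2l.
apply: le_mean => x; have [xX|_] := boolP (x \in X); first by rewrite mulr1; apply: hX.
by rewrite mulr0; apply: avg_ge0 => // s _; rewrite ler0n.
Qed.

Local Notation rho := ((1 / 50) ^+ k : R).

(** A [(k-1)]-tuple with [i] entries in [A] extends by the codegree to edges, all of type [i] or
    [i + 1]. The bound [V_large] keeps repetitions negligible against the density of such tuples. *)
Lemma consecutive_types A i : (i < k)%N -> 1 / 50 <= frac A ->
  1 / 50 <= frac (~: A) -> (rho <= type_density A i) || (rho <= type_density A i.+1).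
Proof.
move=> ik fA fB.
suff : 2 * rho <= type_density A i + type_density A i.+1.
  by case: lerP => //= h; case: lerP => //= h2 h3; lra.
rewrite /type_density -avgD {2}kE /=.
have ik1 : (i <= k.-1)%N by rewrite -ltnS -kE.
have pat := pattern_density ik1 fA fB.
have rhoE : rho = 1 / 50 * (1 / 50) ^+ k.-1 by rewrite {1}kE exprS.
apply: le_trans (_ : mean (fun x => avg k.-1 (fun T =>
    ((cnt A T == i) && edge_seq (x :: T))%:R)) <= _); last first.
  apply: le_mean => x; apply: le_avg => T _ /=.
  case: edge_seq; rewrite ?andbF ?addr0 //= andbT.
  case: eqP => [->|_]; last by rewrite addr_ge0 ?ler0n.
  by case: (x \in A); rewrite ?add0n ?add1n eqxx ?lerDl ?lerDr ler0n.
rewrite mean_avg.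
have not_uni : avg k.-1 (fun T => (~~ uniq T)%:R) <= rho / 100.
  have := avg_not_uniq R V_gt0 k.-1 (L := [::]) isT; rewrite addn0 => h.
  apply: le_trans h _; apply: le_trans V_large; rewrite ler_wpM2r ?invr_ge0 ?ler0n //.
  by rewrite ler_nat leq_mul // leq_pred.
apply: le_trans (_ : avg k.-1 (fun T => 9 / 20 * (cnt A T == i)%:R +
    - 1 * (~~ uniq T)%:R) <= _).
  have rho0 : 0 <= rho by rewrite exprn_ge0.
  rewrite avgD !avgZ; move: rhoE pat not_uni rho0; set a := _ ^+ k; set b := _ ^+ k.-1.
  by lra.
apply: le_avg => T sT; have [uT|_] := boolP (uniq T); last first.
  apply: le_trans (_ : 0 <= _); first by case: (_ == _) => /=; lra.
  by rewrite -[leLHS](mean_cst V_gt0); apply: le_mean => x; rewrite ler0n.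
case: eqP => _; last first.
  apply: le_trans (_ : 0 <= _); first by rewrite /=; lra.
  by rewrite -[leLHS](mean_cst V_gt0); apply: le_mean => x.
apply: le_trans (_ : 9 / 20 <= _); first by rewrite /=; lra.
by apply: (@deg_ge R V k E).
Qed.

(** Adding [a] to an edge [s1] of type [i] and [b] to an edge [s2] of type [i + 1] gives two tuples
    of equal trace, exchangeable within classes by some [z]. Then [s1 s2 z] exchanges [a] for [b],
    split as [(a s1 z) s2] and [(b s2 z) s1]. *)
Lemma merge_types A i (e : R) : 0 <= e ->
  (forall u v, (u \in A) = (v \in A) -> near k E 3 e u v) ->
  rho <= type_density A i -> rho <= type_density A i.+1 ->
  forall a b, a \in A -> b \notin A ->
  near k E (3 * k + 4) (e ^+ k.+1 * rho * rho) a b.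
Proof.
move=> e0 cl d1 d2 a b aA bA; rewrite /near.
have -> : ((3 * k + 4) * k).-1 = (k + (k + k.+1 * (3 * k).-1))%N.
  have : (0 < 3 * k)%N by rewrite muln_gt0.
  have -> : ((3 * k + 4) * k = 3 * k * k + 4 * k)%N by lia.
  move: k_gt0; case: (k) => // c _ _; nia.
have rho0 : 0 <= rho by rewrite exprn_ge0.
have c0 : 0 <= e ^+ k.+1 by rewrite exprn_ge0.
rewrite /sigma avg_cat.
apply: le_trans (_ : e ^+ k.+1 * rho * type_density A i <= _).
  by rewrite ler_wpM2l // mulr_ge0.
apply: avg_ge_cond => [s _|s1 _ /andP[es1 /eqP cs1]].
  by apply: avg_ge0 => // z _; rewrite ler0n.
rewrite avg_cat; apply: le_trans (_ : e ^+ k.+1 * type_density A i.+1 <= _).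
  by rewrite ler_wpM2l.
apply: avg_ge_cond => [s _|s2 _ /andP[es2 /eqP cs2]].
  by apply: avg_ge0 => // z _; rewrite ler0n.
have sz1 : size s1 = k by case/andP: es1 => /eqP.
have sz2 : size s2 = k by case/andP: es2 => /eqP.
have := class_sigma (isT : (0 < 3)%N) e0 cl (S := a :: s1) (T := b :: s2).
rewrite /= sz1 sz2 cs1 cs2 aA (negPf bA) => /(_ erefl erefl)/le_trans; apply.
apply: le_avg => z _; apply: le_natb => /asboolP[p1 p2]; apply/asboolP.
have pe1 := pm_edge es1; have pe2 := pm_edge es2; split.
  apply: pm_perm (pm_cat p1 pe2); by apply/seq.permP => x; rewrite /= !count_cat /=; clear; lia.
apply: pm_perm (pm_cat p2 pe1); by apply/seq.permP => x; rewrite /= !count_cat /=; clear; lia.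
Qed.

(** A common lower bound for the exchange densities in all cases of [class_structure]: [rho * rho]
    and the exponent [k.+1] come from [merge_types], the power of 2/5 from padding up to [3 * k + 4]
    edges. *)
Definition eta0 : R := rho * rho * ((1 / 10) ^+ 12) ^+ k.+1 * (2 / 5) ^+ (3 * k + 4).

Let rho_ge0 : 0 <= rho. Proof. by rewrite exprn_ge0. Qed.
Let rho_le1 : rho <= 1. Proof. by rewrite exprn_ile1 //; lra. Qed.

Lemma eta0_le (a e : R) m : (m <= 3 * k + 4)%N -> rho * rho <= a ->
  ((1 / 10) ^+ 12) ^+ k.+1 <= e -> eta0 <= a * e * (2 / 5) ^+ m.
Proof.
move=> mk ha he; have q0 i : 0 <= (1 / 10) ^+ i :> R by rewrite exprn_ge0.
have t0 : 0 <= 2 / 5 :> R by lra.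
have t1 : 2 / 5 <= 1 :> R by lra.
rewrite /eta0; move: (2 / 5) t0 t1 => t t0 t1.
have e0 : 0 <= ((1 / 10) ^+ 12) ^+ k.+1 :> R by rewrite exprn_ge0.
have rr0 : 0 <= rho * rho by rewrite mulr_ge0.
by apply: ler_pM; rewrite ?mulr_ge0 ?exprn_ge0 ?ler_wiXn2l //; apply: ler_pM.
Qed.

Lemma eta0_ge0 : 0 <= eta0.
Proof. by rewrite /eta0 !mulr_ge0 ?exprn_ge0 //; lra. Qed.

(** Two dense consecutive types would merge the classes into one. Otherwise, since one of any two
    consecutive types is dense, dense and sparse types alternate. A single class is encoded by the
    empty [A] and [tau = 0]. *)
Lemma class_structure : exists A tau,
  [/\ forall u v, (u \in A) = (v \in A) -> near k E (3 * k + 4) eta0 u v,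
      rho <= type_density A tau
    & (A = finset.set0 /\ tau = 0%N) \/ ((tau <= 1)%N /\ rho <= type_density A tau.+2)].
Proof.
have q0 i : 0 <= (1 / 10) ^+ i :> R by rewrite exprn_ge0.
have rr1 : rho * rho <= 1 by rewrite mulr_ile1.
have q12 : ((1 / 10) ^+ 12) ^+ k.+1 <= (1 / 10) ^+ 12 :> R.
  by rewrite exprS ler_piMr ?q0 // exprn_ile1 ?q0 // exprn_ile1 //; lra.
have q127 : (1 / 10) ^+ 12 <= (1 / 10) ^+ 7 :> R by lra.
have k5 : (5 <= 3 * k + 4)%N by rewrite -[5%N]/(1 + 4)%N leq_add2r muln_gt0.
have single : (forall u v, near k E (3 * k + 4) eta0 u v) -> exists A tau,
  [/\ forall u v, (u \in A) = (v \in A) -> near k E (3 * k + 4) eta0 u v,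
      rho <= type_density A tau
    & (A = finset.set0 /\ tau = 0%N) \/ ((tau <= 1)%N /\ rho <= type_density A tau.+2)].
  move=> all_near; exists finset.set0, 0%N; split; [by move=> u v _ | | by left].
  apply: le_trans (_ : edge_density R k E <= _).
    have := edge_density_ge k_ge3 V_gt0 codeg V_large.
    have : rho <= 1 / 50 by rewrite kE exprS ler_piMr ?exprn_ile1 //; lra.
    lra.
  apply: le_avg => s _; apply: le_natb => ->; rewrite andTb.
  rewrite (eq_count (a2 := pred0)) ?count_pred0 // => x; by rewrite inE.
have [all5|[A [cl fA fB]]] := reachability_dichotomy k_ge3 uniE V_gt0 codeg V_large.
  apply: single => u v.
  apply: (near_weak k_ge3 V_gt0 codeg V_large (i := 5)) (all5 u v) => //.
  by rewrite -[X in X * _]mul1r; apply: eta0_le; rewrite ?leq_subr.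
have cl' u v : (u \in A) = (v \in A) -> near k E (3 * k + 4) eta0 u v.
  move=> uv; apply: (near_weak k_ge3 V_gt0 codeg V_large (i := 3)) (cl u v uv) => //.
    exact: ltnW (ltnW k5).
  rewrite -[X in X * _]mul1r; apply: eta0_le; rewrite ?leq_subr //.
  exact: le_trans q12 q127.
have [|none] := boolP [exists i : 'I_k, (rho <= type_density A i)
                                     && (rho <= type_density A i.+1)].
  case/existsP => i /andP[d1 d2]; apply: single.
  have cross a b : a \in A -> b \notin A -> near k E (3 * k + 4) eta0 a b.
    move=> aA bA; apply: near_mono (merge_types (q0 7%N) cl d1 d2 aA bA).
    rewrite -mulrA [leRHS]mulrC -[leRHS]mulr1 -[X in _ * X](expr0 (2 / 5)).
    apply: eta0_le => //; apply: lerXn2r; rewrite ?nnegrE //.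
  move=> u v; have [uA|uA] := boolP (u \in A); have [vA|vA] := boolP (v \in A).
  - by apply: cl'; rewrite uA.
  - exact: cross.
  - exact/near_sym/cross.
  - by apply: cl'; rewrite (negPf uA) (negPf vA).
have noneP i : (i < k)%N -> rho <= type_density A i -> ~~ (rho <= type_density A i.+1).
  move=> ik d1; apply: contra none => d2; apply/existsP; exists (Ordinal ik).
  by rewrite /= d1.
(* The truth value read as a number: 0 if type 0 is dense, and 1 otherwise. *)
pose tau : nat := ~~ (rho <= type_density A 0).
have dtau : rho <= type_density A tau.
  rewrite /tau; have [//|d0] := boolP (rho <= type_density A 0).
  by have := consecutive_types k_gt0 fA fB; rewrite (negPf d0).
have tau1 : (tau <= 1)%N by rewrite /tau; case: (~~ _).
exists A, tau; split=> //; right; split=> //.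
have t1k : (tau.+1 < k)%N by apply: leq_trans k_ge3; rewrite !ltnS.
have tk : (tau < k)%N := ltnW t1k.
by have := consecutive_types t1k fA fB; rewrite (negPf (noneP _ tk dtau)).
Qed.

Lemma block_density A ts : (forall i, i \in ts -> rho <= type_density A i) ->
  rho ^+ size ts <= avg (size ts * k) (fun Q => `[< pm Q /\ cnt A Q = sumn ts >]%:R).
Proof.
elim: ts => [|i ts IHts] h /=.
  rewrite expr0 /= (_ : `[< _ >] = true) //.
  by apply/asboolP; split=> //; apply: pm_nil.
rewrite exprS ?mulSn; apply: le_trans (_ : type_density A i *
  avg (size ts * k) (fun Q => `[< pm Q /\ cnt A Q = sumn ts >]%:R) <= _).
  apply: ler_pM; rewrite ?exprn_ge0 //; first by apply: h; rewrite mem_head.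
  by apply: IHts => j jts; apply: h; rewrite in_cons jts orbT.
apply: avg_mul_le => [s _|s _|s t _ _]; rewrite ?ler0n // natbM.
apply: le_natb => /andP[/andP[es /eqP cs] /asboolP[pt ct]]; apply/asboolP.
by split; [apply: pm_cat => //; apply: pm_edge | rewrite count_cat cs ct].
Qed.

(** The number of edges in [Q]. Replacing type [tau] by [tau + 2] raises the trace by two; at most
    [k * k] replacements are needed, and they must still fit when [j <= k] edges are set aside. *)
Definition num_blocks : nat := (k * k + k)%N.

Definition absorber_size : nat :=
  (2 * (num_blocks * k) + num_blocks * k * ((3 * k + 4) * k).-1)%N.

(* Add edges to [L] so that it meets [A] as often as a family [Q] of further edges, which is possible
   with the edge types [tau] and [tau + 2]; then exchange [Q] for the result within classes. *)
Lemma absorber_density A tau L j :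
  (forall u v, (u \in A) = (v \in A) -> near k E (3 * k + 4) eta0 u v) ->
  rho <= type_density A tau ->
  (A = finset.set0 /\ tau = 0%N) \/ ((tau <= 1)%N /\ rho <= type_density A tau.+2) ->
  (j <= k)%N -> size L = (j * k)%N -> odd (cnt A L) = odd (tau * j) ->
  rho ^+ num_blocks * rho ^+ num_blocks * eta0 ^+ (num_blocks * k) <=
  avg absorber_size (fun z => `[< pm z /\ pm (L ++ z) >]%:R).
Proof.
move=> cl dtau types jk szL parL; set P := num_blocks.
have cL : (cnt A L <= j * k)%N by rewrite -szL count_size.
have jP : (j <= P)%N by apply: leq_trans jk (leq_addl _ _).
have [ts [ts' [rts rts' szts szts' sums]]] : exists ts ts' : seq nat,
  [/\ forall i, i \in ts -> rho <= type_density A i,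
      forall i, i \in ts' -> rho <= type_density A i, size ts = P,
      size ts' = (P - j)%N & (sumn ts = cnt A L + sumn ts')%N].
  case: types => [[A0 tau0]|[tau1 dtau2]].
    rewrite tau0 in dtau; exists (nseq P 0%N), (nseq (P - j) 0%N); split; rewrite ?size_nseq //.
    - by move=> i /nseqP[-> _].
    - by move=> i /nseqP[-> _].
    - rewrite !sumn_nseq !mul0n addn0 A0 (eq_count (a2 := pred0)) ?count_pred0 //.
      by move=> x; rewrite inE.
  (* [N] types with sum [tau * N + 2 * t]. With [t] raised types in [Q] and [t'] in [F], the
     requirement reads [2 * (t - t') = cnt A L - tau * j]; the right-hand side is even by
     hypothesis, and its sign decides which of [t], [t'] is zero. *)
  pose mk t N := nseq t tau.+2 ++ nseq (N - t) tau.
  have mkP t N : (t <= N)%N -> [/\ forall i, i \in mk t N -> rho <= type_density A i,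
      size (mk t N) = N & sumn (mk t N) = (tau * N + 2 * t)%N].
    move=> tN; split.
    - by move=> i; rewrite mem_cat => /orP[] /nseqP[-> _].
    - by rewrite size_cat !size_nseq subnKC.
    - rewrite sumn_cat !sumn_nseq -addn2 mulnDl -addnA [(2 * t + _)%N]addnC addnA.
      by rewrite -mulnDr subnKC.
  have [le|lt] := leqP (tau * j) (cnt A L).
    pose t := (cnt A L - tau * j)./2.
    have tE : (tau * j + 2 * t = cnt A L)%N.
      rewrite mul2n -[X in (_ + X)%N]add0n; have : ~~ odd (cnt A L - tau * j).
        by rewrite oddB // parL addbb.
      move=> ev; rewrite /t -[X in (X + _.*2)%N]/(nat_of_bool false) add0n.
      by rewrite even_halfK // subnKC.
    have [tP t0P] : (t <= P)%N /\ (0 <= P - j)%N.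
      split=> //; apply: leq_trans (_ : cnt A L <= _)%N; first by rewrite -tE; lia.
      by apply: leq_trans cL _; rewrite /P /num_blocks; nia.
    have [h1 h2 h3] := mkP t P tP; have [g1 g2 g3] := mkP 0%N (P - j)%N t0P.
    exists (mk t P), (mk 0%N (P - j)%N); split=> //; rewrite h3 g3 muln0 addn0 -tE.
    by rewrite addnAC -mulnDr subnKC.
  pose t := (tau * j - cnt A L)./2.
  have tE : (cnt A L + 2 * t = tau * j)%N.
    have ev : ~~ odd (tau * j - cnt A L) by rewrite (oddB (ltnW lt)) parL addbb.
    by rewrite mul2n /t (even_halfK ev) (subnKC (ltnW lt)).
  have tP : (t <= P - j)%N.
    have : (tau * j <= j)%N by rewrite -[X in (_ <= X)%N]mul1n leq_mul2r tau1 orbT.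
    have : (3 * k <= k * k)%N by rewrite leq_mul2r k_ge3 orbT.
    by move: tE jk; rewrite /P /num_blocks; clear; move: (cnt A L) => c; lia.
  have [h1 h2 h3] := mkP 0%N P (leq0n P); have [g1 g2 g3] := mkP t (P - j)%N tP.
  exists (mk 0%N P), (mk t (P - j)%N); split=> //; rewrite h3 g3 muln0 addn0.
  by rewrite addnCA tE -mulnDr subnK.
have r0 : (1 <= 3 * k + 4)%N by rewrite addn_gt0 orbT.
set r1 := ((3 * k + 4) * k).-1.
have -> : absorber_size = (P * k + ((P - j) * k + (j * k + P * k * r1)))%N.
  rewrite /absorber_size -/P -/r1 mul2n -addnn -addnA; congr (_ + _)%N.
  by rewrite addnA -mulnDl subnK.
have e0 := eta0_ge0; have eP : 0 <= eta0 ^+ (P * k) by rewrite exprn_ge0.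
have rP i : 0 <= rho ^+ i by rewrite exprn_ge0.
pose c1 := rho ^+ j * eta0 ^+ (P * k); pose c2 := rho ^+ (P - j) * c1.
have -> : rho ^+ P * rho ^+ P * eta0 ^+ (P * k) = c2 * rho ^+ P.
  have : rho ^+ P = rho ^+ (P - j) * rho ^+ j by rewrite -exprD subnK.
  rewrite /c2 /c1; move: (rho ^+ P) (rho ^+ (P - j)) (rho ^+ j) (eta0 ^+ _).
  by move=> a b c d ->; ring.
have c10 : 0 <= c1 by rewrite mulr_ge0.
have c20 : 0 <= c2 by rewrite mulr_ge0.
have blkQ := block_density rts; have blkF := block_density rts'.
rewrite szts in blkQ; rewrite szts' in blkF.
rewrite avg_cat; apply: le_trans (ler_wpM2l c20 blkQ) _.
apply: avg_ge_cond => [Q _|Q szQ /asboolP[pQ cQ]].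
  by apply: avg_ge0 => // z _; rewrite ler0n.
rewrite avg_cat /c2 mulrC; apply: le_trans (ler_wpM2l c10 blkF) _.
apply: avg_ge_cond => [F _|F szF /asboolP[pF cF]].
  by apply: avg_ge0 => // z _; rewrite ler0n.
rewrite avg_cat /c1 mulrC.
have := @block_density A (nseq j tau) _; rewrite size_nseq => blk.
have {}blk := blk (fun i ij => let: conj e _ := elimT nseqP ij in
  eq_ind_r (fun i => rho <= type_density A i) dtau e).
apply: le_trans (ler_wpM2l eP blk) _.
apply: avg_ge_cond => [G _|G szG /asboolP[pG cG]].
  by apply: avg_ge0 => // z _; rewrite ler0n.
have szLF : size (L ++ F) = (P * k)%N.
  by rewrite size_cat szL szF -mulnDl subnKC.
have := class_sigma r0 e0 cl (S := L ++ F) (T := Q); rewrite szLF szQ -/r1.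
rewrite count_cat cF cQ sums => /(_ erefl erefl)/le_trans; apply.
(* The tuple is [Q F G z]. Alone it splits as [(Q z) F G], and together with [L] as [(L F z) Q G];
   the [j] edges of [G] make its length independent of [j]. *)
apply: le_avg => z _; apply: le_natb => /asboolP[p1 p2]; apply/asboolP; split.
  apply: pm_perm (pm_cat (pm_cat p2 pF) pG); apply/seq.permP => x.
  by rewrite !count_cat; clear; lia.
apply: pm_perm (pm_cat (pm_cat p1 pQ) pG); apply/seq.permP => x.
by rewrite !count_cat; clear; lia.
Qed.

End Absorbers.

(** * From absorbing tuples to absorbing sets *)

Section AbsorbingSets.
Variables (R : realType) (V : finType).
Hypothesis V_gt0 : (0 < #|V|)%N.
Local Notation n := (#|V|%:R : R).
Local Notation avg := (@avg R V).
Local Notation mean := (@mean R V).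
Implicit Types (A X L Y : {set V}) (E G : {set {set V}}).

Let n_gt0 : 0 < n. Proof. by rewrite ltr0n. Qed.

Definition coverable E Y : bool :=
  [exists M : {set {set V}}, [&& M \subset E, trivIset M & cover M == Y]].

(** The even trace on [A] lets absorbers be set aside without changing the parity of what
    remains. *)
Definition absorbers E r A L : {set {set V}} :=
  [set X : {set V} | [&& #|X| == r, [disjoint X & L], ~~ odd #|X :&: A|,
                         coverable E X & coverable E (X :|: L)]].

Lemma avg_sum (I : finType) (B : {set I}) r (f : I -> seq V -> R) :
  avg r (fun s => \sum_(i in B) f i s) = \sum_(i in B) avg r (f i).
Proof.
elim: r f => //= r IHr f; rewrite /mean -mulr_suml; congr (_ / _).
by rewrite exchange_big /=; apply: eq_bigr => x _; apply: IHr.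
Qed.

Lemma avg_all_in X r : avg r (fun s => (all [in X] s)%:R) = (#|X|%:R / n) ^+ r.
Proof.
elim: r => [|r IHr] //=; rewrite exprS -IHr -mean_indic mulrC -meanZ.
congr (_ / _); apply: eq_bigr => x _; have [xX|_] := boolP (x \in X).
  by rewrite mulr1.
by rewrite mulr0 /= -[RHS](avg_cst V_gt0 r).
Qed.

(** All tuples with underlying set [X] lie in [X ^ r], which has density [(r / n) ^ r]. *)
Lemma avg_set_of_seq G r : (forall X, X \in G -> #|X| = r) ->
  avg r (fun s => ([set x in s] \in G)%:R) <= #|G|%:R * (r%:R / n) ^+ r.
Proof.
move=> cG; apply: le_trans (_ : avg r (fun s =>
    \sum_(X in G) (all [in X] s)%:R) <= _).
  apply: le_avg => s _; have [sG|_] := boolP (_ \in G); last first.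
    by apply: sumr_ge0 => X _; rewrite ler0n.
  rewrite (bigD1 [set x in s]) //= -[leLHS]addr0; apply: lerD.
    by rewrite (_ : all _ _ = true) //; apply/allP => x xs; rewrite inE.
  by apply: sumr_ge0 => X _; rewrite ler0n.
rewrite avg_sum mulr_natl -sumr_const; apply: ler_sum => X XG.
by rewrite avg_all_in cG.
Qed.

(* Two absorbers of equal parity together form an even one. *)
Lemma parity_doubling r (P : pred (seq V)) (c : seq V -> nat) :
  (forall s t, c (s ++ t) = (c s + c t)%N) ->
  avg r (fun s => (P s)%:R) ^+ 2 / 2 <=
  avg (r + r) (fun s => [&& P (take r s), P (drop r s) & ~~ odd (c s)]%:R).
Proof.
move=> cD; pose p b := avg r (fun s => (P s && (odd (c s) == b))%:R).
have pE : avg r (fun s => (P s)%:R) = p true + p false.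
  rewrite /p -avgD; apply: avg_ext => s _.
  by case: (P s); case: (odd _); rewrite /= ?addr0 ?add0r.
apply: le_trans (_ : p true * p true + p false * p false <= _).
  by rewrite pE; have := sqr_ge0 (p true - p false); lra.
rewrite avg_cat /p -!avgZ -avgD; apply: le_avg => s sr.
rewrite mulrC -avgZ [X in _ + X]mulrC -avgZ -avgD; apply: le_avg => t tr.
rewrite take_size_cat // drop_size_cat // cD oddD.
by case: (P s); case: (P t); case: (odd (c s)); case: (odd (c t)) => /=; lra.
Qed.

Lemma absorber_of_seq k E A L r z : (0 < k)%N -> uniform k E ->
  size z = r -> uniq (enum L ++ z) -> pm k E z -> pm k E (enum L ++ z) ->
  ~~ odd (count [in A] z) -> [set x in z] \in absorbers E r A L.
Proof.
move=> k0 uniE sz uLz pz pLz ev.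
have uz : uniq z by move: uLz; rewrite cat_uniq => /and3P[].
have cz : #|[set x in z]| = r.
  by rewrite -sz -(card_uniqP uz); apply: eq_card => x; rewrite inE.
rewrite inE cz eqxx /=; apply/and4P; split.
- rewrite -setI_eq0; apply/eqP/setP => x; rewrite !inE; apply/negP => /andP[xz xL].
  move: uLz; rewrite cat_uniq => /and3P[_ /hasPn/(_ x xz)].
  by rewrite mem_enum xL.
- rewrite (_ : #|_| = count [in A] z) // -size_filter -(card_uniqP (filter_uniq _ uz)).
  by apply: eq_card => x; rewrite !inE mem_filter andbC.
- have [M [ME tM cM _]] := pm_matching k0 uniE pz uz.
  by apply/existsP; exists M; rewrite ME tM cM eqxx.
- have [M [ME tM cM _]] := pm_matching k0 uniE pLz uLz.
  apply/existsP; exists M; rewrite ME tM cM /=; apply/eqP/setP => x.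
  by rewrite !inE mem_cat mem_enum orbC.
Qed.

(** The first half of the tuple absorbs [L]; the second is only matched by itself and corrects the
    parity. Tuples with a repetition or a vertex of [L] cost at most half of the density
    [alpha ^+ 2 / 2]. *)
Lemma card_absorbers_ge k E A L r (alpha : R) : (0 < k)%N -> uniform k E ->
  0 <= alpha -> (0 < r)%N ->
  alpha <= avg r (fun z => `[< pm k E z /\ pm k E (enum L ++ z) >]%:R) ->
  (2 * r * (2 * r + #|L|))%:R / n <= alpha ^+ 2 / 4 ->
  alpha ^+ 2 / 4 / (2 * r)%:R ^+ (2 * r) * n ^+ (2 * r) <=
    #|absorbers E (2 * r) A L|%:R.
Proof.
move=> k0 uniE a0 r0 ha large.
pose P z := `[< pm k E z /\ pm k E (enum L ++ z) >].
have dbl := @parity_doubling r P (fun z => count [in A] z) (count_cat _).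
rewrite addnn -mul2n in dbl; set r2 := (2 * r)%N in large dbl *.
have nu := avg_not_uniq R V_gt0 r2 (enum_uniq L); rewrite -cardE in nu.
have cG X : X \in absorbers E r2 A L -> #|X| = r2 by rewrite inE => /andP[/eqP].
have := avg_set_of_seq cG.
have r20 : 0 < (r2%:R : R) ^+ r2 by rewrite exprn_gt0 // ltr0n muln_gt0.
have nr20 : 0 < n ^+ r2 by rewrite exprn_gt0.
rewrite expr_div_n mulrA ler_pdivlMr // => up.
rewrite mulrAC ler_pdivrMr //; apply: le_trans up; rewrite ler_wpM2r ?(ltW nr20) //.
have a2 : alpha ^+ 2 <= avg r (fun s => (P s)%:R) ^+ 2.
  by rewrite ler_sqr ?nnegrE //; apply: le_trans ha.
suff : avg r2 (fun s => [&& P (take r s), P (drop r s) & ~~ odd (count [in A] s)]%:R)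
    <= avg r2 (fun s => ([set x in s] \in absorbers E r2 A L)%:R)
     + avg r2 (fun s => (~~ uniq (enum L ++ s))%:R).
  by move: a2 dbl nu large; lra.
rewrite -avgD; apply: le_avg => z sz.
have [uz|_] := boolP (uniq _); last first.
  by rewrite -[leLHS]add0r; apply: lerD; rewrite ?ler0n //; case: andP; rewrite ?ler01.
rewrite addr0; apply: le_natb => /and3P[/asboolP[p1 q1] /asboolP[p2 _] ev].
apply: (absorber_of_seq k0) => //.
  by rewrite -[z](cat_take_drop r); apply: pm_cat.
by rewrite -[z](cat_take_drop r) catA; apply: pm_cat.
Qed.

End AbsorbingSets.

(** The constants depend on [k] alone. By [2 * k %| r] an absorber consists of an even number of
    edges, so it is neutral for the parity whatever [tau] is. *)
Lemma absorbing_structure (R : realType) k : (3 <= k)%N ->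
  exists (theta : R) (r N : nat),
  [/\ 0 < theta, theta <= 1, (0 < r)%N, (2 * k %| r)%N &
  forall (V : finType) (E : {set {set V}}), (N <= #|V|)%N -> uniform k E ->
    (forall S : {set V}, #|S| = k.-1 ->
      9 / 20 * #|V|%:R <= #|[set x | x |: S \in E]|%:R :> R) ->
    exists (A : {set V}) (tau : nat), forall (L : {set V}) j,
      (j <= k)%N -> #|L| = (j * k)%N -> odd #|L :&: A| = odd (tau * j) ->
      theta * #|V|%:R ^+ r <= #|absorbers E r A L|%:R].
Proof.
move=> k3; have k0 : (0 < k)%N by apply: leq_trans k3.
pose r := absorber_size k.
pose rho : R := (1 / 50) ^+ k.
pose alpha : R := rho ^+ num_blocks k * rho ^+ num_blocks k *
  eta0 R k ^+ (num_blocks k * k).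
have q0 : 0 < 1 / 50 :> R by lra.
have rho0 : 0 < rho by rewrite exprn_gt0.
have rho1 : rho <= 1 by rewrite exprn_ile1 //; lra.
have eta_gt0 : 0 < eta0 R k.
  by rewrite /eta0 !mulr_gt0 ?exprn_gt0 //; lra.
have a0 : 0 < alpha by rewrite !mulr_gt0 ?exprn_gt0.
have r0 : (0 < r)%N by rewrite /r /absorber_size addn_gt0 !muln_gt0 /num_blocks addn_gt0 k0 orbT.
have [N1 N1P] := exists_nat_ge ((k * k)%:R / (rho / 100)).
have [N2 N2P] := exists_nat_ge ((2 * r * (2 * r + k * k))%:R / (alpha ^+ 2 / 4)).
pose theta := Num.min 1 (alpha ^+ 2 / 4 / (2 * r)%:R ^+ (2 * r)).
exists theta, (2 * r)%N, (N1 + N2 + 1)%N; split.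
- by rewrite lt_min ltr01 !divr_gt0 ?exprn_gt0 // ltr0n muln_gt0.
- by rewrite ge_min lexx.
- by rewrite muln_gt0.
- rewrite dvdn_pmul2l // /r /absorber_size; apply: dvdn_add.
    by rewrite dvdn_mull // dvdn_mull.
  by rewrite dvdn_mulr // dvdn_mull.
move=> V E NV uniE codeg.
have [V0 NV1 NV2] : [/\ 0 < #|V|, N1 <= #|V| & N2 <= #|V|]%N.
  by move: NV; clear; move: #|V| => n; split; lia.
have n0 : 0 < #|V|%:R :> R by rewrite ltr0n.
have large N (x y : R) : 0 < y -> x / y <= N%:R -> (N <= #|V|)%N -> x / #|V|%:R <= y.
  move=> y0 xy NV'; rewrite ler_pdivrMr // mulrC -ler_pdivrMr //.
  by apply: le_trans xy _; rewrite ler_nat.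
have V_large : (k * k)%:R / #|V|%:R <= (1 / 50) ^+ k / 100 :> R.
  by apply: large N1P NV1; rewrite divr_gt0.
have [A [tau [cl dtau types]]] := class_structure k3 uniE V0 codeg V_large.
exists A, tau => L j jk cL parL.
have Lkk : (#|L| <= k * k)%N by rewrite cL leq_mul2r jk orbT.
have cntL : count [in A] (enum L) = #|L :&: A|.
  rewrite -size_filter cardE; congr size; rewrite /enum_mem -filter_predI.
  by apply: eq_filter => x; rewrite /= !inE andbC.
apply: le_trans (_ : alpha ^+ 2 / 4 / (2 * r)%:R ^+ (2 * r) * #|V|%:R ^+ (2 * r) <= _).
  by rewrite ler_wpM2r ?exprn_ge0 ?ler0n // ge_min lexx orbT.
apply: (card_absorbers_ge V0 A k0 uniE (ltW a0) r0).
  by apply: (absorber_density k3 uniE V0 V_large cl dtau types jk); rewrite -?cardE // cntL.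
have a40 : 0 < alpha ^+ 2 / 4 by rewrite divr_gt0 ?exprn_gt0.
have L2 := large _ _ _ a40 N2P NV2.
apply: (le_trans _ L2); rewrite ler_wpM2r ?invr_ge0 ?ler0n // ler_nat.
by rewrite leq_mul2l leq_add2l Lkk orbT.
Qed.

(** * Part (ii) *)

Section SetFamilies.
Variable V : finType.
Implicit Types (X Y Z W L S : {set V}) (E M F P : {set {set V}}).

Lemma exists_subset_card X c : (c <= #|X|)%N -> exists2 S : {set V}, S \subset X & #|S| = c.
Proof.
move=> cX; have : (0 < #|[set S : {set V} | S \subset X & #|S| == c]|)%N.
  by rewrite cards_draws bin_gt0.
by case/card_gt0P => S; rewrite inE => /andP[SX /eqP]; exists S.
Qed.

Lemma disjoint_setUl X Y Z : [disjoint X :|: Y & Z] = [disjoint X & Z] && [disjoint Y & Z].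
Proof. by rewrite !disjoints_subset subUset. Qed.

Lemma disjoint_setU1l x X Z : [disjoint x |: X & Z] = (x \notin Z) && [disjoint X & Z].
Proof. by rewrite disjoint_setUl disjoints1. Qed.

Lemma cover_setU1 X P : cover (X |: P) = X :|: cover P.
Proof. by rewrite /cover bigcup_setU big_set1. Qed.

Lemma trivIset_setU1 X P : [disjoint X & cover P] -> trivIset P -> trivIset (X |: P).
Proof.
move=> dis tP; apply: trivIsetU => //; last by rewrite /cover big_set1.
by apply/trivIsetP => B C; rewrite !inE => /eqP-> /eqP->; rewrite eqxx.
Qed.

Lemma card_setU1_disjoint X P : (0 < #|X|)%N -> [disjoint X & cover P] ->
  #|X |: P| = #|P|.+1.
Proof.
move=> /card_gt0P[x xX] dis; rewrite cardsU1 (_ : X \notin P) //.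
apply/negP => XP; have xP : x \in cover P by apply/bigcupP; exists X.
by have := disjointFr dis xX; rewrite xP.
Qed.

Lemma disjoint_subsets_of_card c i L : (0 < c)%N -> (i * c <= #|L|)%N ->
  exists P, [/\ #|P| = i, trivIset P, cover P \subset L
              & forall S, S \in P -> #|S| = c].
Proof.
move=> c0; elim: i => [|i IHi] iL.
  exists finset.set0; rewrite cards0 /cover big_set0 sub0set; split=> // [|S].
    by apply/trivIsetP => A B; rewrite inE.
  by rewrite inE.
have [|P [cP tP PL Pc]] := IHi; first by apply: leq_trans iL; rewrite leq_mul2r leqnSn orbT.
have cov : #|cover P| = (i * c)%N.
  have -> : #|cover P| = (\sum_(S in P) #|S|)%N.
    by apply/esym/eqP; rewrite eq_sym; have := leq_card_cover P; rewrite tP => -[_ ->].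
  by rewrite (eq_bigr (fun=> c)) ?sum_nat_const ?cP.
have [|S SL cS] := @exists_subset_card (L :\: cover P) c.
  by rewrite cardsDS // cov; move: iL; rewrite mulSn; lia.
have dis : [disjoint S & cover P].
  by rewrite disjoints_subset; apply: subset_trans SL _; rewrite setDE subsetIr.
exists (S |: P); split.
- by rewrite card_setU1_disjoint ?cS ?cP.
- exact: trivIset_setU1.
- by rewrite cover_setU1 subUset PL (subset_trans SL (subsetDl _ _)).
- by move=> S'; rewrite !inE => /orP[/eqP->|/Pc].
Qed.

Lemma coverable_set0 E : coverable E finset.set0.
Proof.
apply/existsP; exists finset.set0; rewrite sub0set /cover big_set0 eqxx andbT /=.
by apply/trivIsetP => A B; rewrite inE.
Qed.

Lemma coverable_setU E Y Z : [disjoint Y & Z] -> coverable E Y -> coverable E Z ->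
  coverable E (Y :|: Z).
Proof.
move=> dis /existsP[M1 /and3P[M1E t1 /eqP c1]] /existsP[M2 /and3P[M2E t2 /eqP c2]].
apply/existsP; exists (M1 :|: M2); apply/and3P; split.
- by rewrite subUset M1E.
- by apply: trivIsetU => //; rewrite c1 c2.
- by rewrite /cover bigcup_setU -/(cover M1) -/(cover M2) c1 c2.
Qed.

Lemma coverable_cover E M : M \subset E -> trivIset M -> coverable E (cover M).
Proof. by move=> ME tM; apply/existsP; exists M; rewrite ME tM eqxx. Qed.

Lemma trivIset_setD1 F X : trivIset F -> X \in F -> [disjoint X & cover (F :\ X)].
Proof.
move=> tF XF; rewrite -setI_eq0; apply/eqP/setP => x; rewrite !inE.
apply/negP => /andP[xX /bigcupP[Y]]; rewrite !inE => /andP[YX YF] xY.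
move/trivIsetP: tF => /(_ _ _ XF YF); rewrite eq_sym YX => /(_ isT) dis.
by have := disjointFr dis xX; rewrite xY.
Qed.

Lemma coverable_family E F : trivIset F -> (forall X, X \in F -> coverable E X) ->
  coverable E (cover F).
Proof.
elim: {F}#|F| {-2}F (erefl #|F|) => [|i IHi] F cF tF Fc.
  by move/eqP: cF; rewrite cards_eq0 => /eqP->; rewrite /cover big_set0 coverable_set0.
have /card_gt0P[X XF] : (0 < #|F|)%N by rewrite cF.
rewrite -(setD1K XF) cover_setU1; apply: coverable_setU; [exact: trivIset_setD1|exact: Fc|].
apply: IHi.
- by move: cF; rewrite (cardsD1 X) XF add1n => -[].
- by apply: trivIsetS tF; apply: subsetDl.
- by move=> Y; rewrite !inE => /andP[_ /Fc].
Qed.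

Lemma inner_matchings_of_coverable k E W : (0 < k)%N -> uniform k E ->
  coverable E W -> (0 < #|inner_matchings k E W|)%N.
Proof.
move=> k0 uniE /existsP[M /and3P[ME tM /eqP cM]]; apply/card_gt0P; exists M.
by rewrite inE ME tM cM subxx -cM (card_cover_edges k0 uniE ME tM) mulnK ?eqxx.
Qed.

Variables (k : nat) (E : {set {set V}}).
Hypotheses (k_ge2 : (2 <= k)%N) (uniE : uniform k E).

Let k_gt0 : (0 < k)%N. Proof. exact: ltnW. Qed.

(* A maximum matching is found by augmentation: if [k] disjoint [(k-1)]-sets
   are left over, their neighbourhoods together hit some matching edge more
   than [k] times, so two of them can be completed inside that edge. *)
Lemma near_perfect_matching W :
  (forall S, S \subset W -> #|S| = k.-1 ->
     (#|W| <= k * #|[set x in W | x |: S \in E]|)%N) ->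
  exists M, [/\ M \subset E, trivIset M, cover M \subset W
              & (#|W :\: cover M| < k * k.-1)%N].
Proof.
move=> codeg.
pose ok M := [&& M \subset E, trivIset M & cover M \subset W].
have ok0 : ok finset.set0.
  rewrite /ok /cover big_set0 !sub0set andbT /=.
  by apply/trivIsetP => B C; rewrite inE.
case: (arg_maxnP (fun M : {set {set V}} => #|M|) ok0) => M /and3P[ME tM cM] maxM.
have {}maxM M' : ok M' -> (#|M'| <= #|M|)%N by apply: maxM.
exists M; split=> //; rewrite ltnNge; apply/negP; set L := W :\: cover M => Lbig.
have k1 : (0 < k.-1)%N by rewrite -ltnS prednK.
have [P [cP tP PL Pc]] := disjoint_subsets_of_card k1 Lbig.
pose N S := [set x in W | x |: S \in E].
have LM : [disjoint L & cover M].
  by rewrite -setI_eq0 setIDAC setDIl setDv setI0.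
have SL S : S \in P -> S \subset L.
  by move=> SP; apply: subset_trans PL; apply: (bigcup_max S).
have SW S : S \in P -> S \subset W.
  by move/SL/subset_trans; apply; apply: subsetDl.
have NM S : S \in P -> N S \subset cover M.
  move=> SP; apply/subsetP => x; rewrite inE => /andP[xW xSE].
  apply: contraT => xM; exfalso.
  have dis : [disjoint x |: S & cover M].
    apply: disjointWl LM; by rewrite subUset (SL S SP) sub1set inE xM xW.
  have /maxM : ok ((x |: S) |: M).
    apply/and3P; split.
    - by rewrite subUset sub1set xSE.
    - exact: trivIset_setU1.
    - by rewrite cover_setU1 subUset cM andbT subUset sub1set xW SW.
  by rewrite card_setU1_disjoint ?ltnn // (card_edge uniE xSE).
have cW : (#|M| * k < #|W|)%N.
  rewrite -(card_cover_edges k_gt0 uniE ME tM).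
  have : (0 < #|L|)%N by apply: leq_trans Lbig; rewrite muln_gt0 k_gt0.
  by rewrite cardsDS // subn_gt0.
have NS S : S \in P -> #|N S| = (\sum_(e in M) #|N S :&: e|)%N.
  move=> SP; rewrite -[in LHS](setIidPl (NM S SP)).
  rewrite -sum1_card (eq_bigl (fun x => (x \in cover M) && (x \in N S))); last first.
    by move=> x; rewrite inE andbC.
  rewrite big_trivIset_cond //=; apply: eq_bigr => e _.
  by rewrite sum1dep_card; congr #|pred_of_set _|; apply/setP => x; rewrite !inE andbC.
have [e eM big] : exists2 e, e \in M & (k < \sum_(S in P) #|N S :&: e|)%N.
  apply/exists_inP; apply: contraLR cW => /exists_inPn small; rewrite -leqNgt.
  apply: (@leq_trans (\sum_(S in P) #|N S|)%N).
    rewrite -(leq_pmul2l k_gt0) big_distrr /=.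
    apply: leq_trans (_ : \sum_(S in P) #|W| <= _)%N; first by rewrite sum_nat_const cP.
    by apply: leq_sum => S SP; apply: codeg; [exact: SW | exact: Pc].
  rewrite (eq_bigr (fun S => \sum_(e in M) #|N S :&: e|)%N) // exchange_big /=.
  rewrite -sum_nat_const; apply: leq_sum => e /small.
  by rewrite -leqNgt.
have ce : #|e| = k by apply: card_edge uniE _ (subsetP ME _ eM).
have [x xe dx] : exists2 x, x \in e & (1 < #|[set S in P | x \in N S]|)%N.
  apply/exists_inP; apply: contraLR big => /exists_inPn small; rewrite -leqNgt.
  rewrite (eq_bigr (fun S => \sum_(x in e) (x \in N S))%N); last first.
    move=> S _; rewrite -sum1_card big_mkcond [RHS]big_mkcond; apply: eq_bigr => x _.
    by rewrite inE andbC; case: (x \in e).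
  rewrite exchange_big /= -ce -sum1_card; apply: leq_sum => x /small.
  rewrite -leqNgt; apply: leq_trans.
  rewrite -sum1_card big_set big_mkcondr /=.
  by apply: leq_sum => S _; case: (x \in N S).
(* Without such a [y] all hits would be at [x], at most one for each of the [k] sets of [P]. As [x]
   lies in two neighbourhoods, [S] can then be chosen different from [T]. *)
have [y ye /andP[yx /exists_inP[T TP yT]]] :
    exists2 y, y \in e & (y != x) && [exists T in P, y \in N T].
  apply/exists_inP; apply: contraLR big => /exists_inPn small; rewrite -leqNgt.
  rewrite -cP -sum1_card; apply: leq_sum => S SP.
  rewrite -(cards1 x); apply: subset_leq_card; apply/subsetP => y.
  rewrite in_setI in_set1 => /andP[yS ye]; have := small y ye; rewrite negb_and negbK.
  by case/orP=> // /exists_inP[]; exists S.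
have [S SP /andP[ST xS]] : exists2 S, S \in P & (S != T) && (x \in N S).
  have : (0 < #|[set S in P | x \in N S] :\ T|)%N.
    by move: dx; rewrite (cardsD1 T); case: (T \in _); [rewrite add1n | rewrite add0n => /ltnW].
  by case/card_gt0P => S; rewrite !inE => /and3P[ST SP xS]; exists S; rewrite // ST inE.
have eM' : e \subset cover M by apply: (bigcup_max e).
have disM Z : Z \subset L -> [disjoint Z & cover M] by move/disjointWl; apply.
have notL z : z \in e -> z \notin L.
  by move=> /(subsetP eM') zM; rewrite inE zM.
pose C0 := cover (M :\ e).
have C0M : C0 \subset cover M by apply: subset_trans (subsetUr e _) _; rewrite -cover_setU1 setD1K.
have eC0 : [disjoint e & C0] by apply: trivIset_setD1.
have disC z Z : z \in e -> Z \in P -> [disjoint z |: Z & C0].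
  move=> ze ZP; rewrite disjoint_setU1l (disjointFr eC0 ze) /=.
  by apply: disjointWr C0M (disM _ (SL Z ZP)).
have d1 := disC y T ye TP.
have tE Z z : Z \in P -> z \in N Z -> z |: Z \in E by move=> _; rewrite inE => /andP[].
have c1 : (0 < #|y |: T|)%N by rewrite (card_edge uniE (tE _ _ TP yT)).
have c2 : (0 < #|x |: S|)%N by rewrite (card_edge uniE (tE _ _ SP xS)).
have t1 : trivIset ((y |: T) |: (M :\ e)).
  by apply: trivIset_setU1 => //; apply: trivIsetS tM; apply: subsetDl.
have d2 : [disjoint x |: S & cover ((y |: T) |: (M :\ e))].
  rewrite cover_setU1 disjoint_sym disjoint_setUl [X in _ && X]disjoint_sym (disC x S xe SP) andbT.
  rewrite disjoint_setU1l !inE negb_or yx; apply/andP; split.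
    by apply: contra (notL y ye); apply: (subsetP (SL S SP)).
  rewrite disjoint_sym disjoint_setU1l; apply/andP; split.
    by apply: contra (notL x xe); apply: (subsetP (SL T TP)).
  by have := trivIsetP tP S T SP TP ST.
have LW : L \subset W := subsetDl _ _.
have zW z Z : z \in e -> Z \in P -> z |: Z \subset W.
  move=> ze ZP; rewrite subUset sub1set (subset_trans (SL Z ZP) LW) andbT.
  by apply: (subsetP cM); apply: (subsetP eM').
have /maxM : ok ((x |: S) |: ((y |: T) |: (M :\ e))).
  apply/and3P; split; last 2 first.
  - exact: trivIset_setU1.
  - by rewrite !cover_setU1 subUset (zW x S) // subUset (zW y T) // (subset_trans C0M cM).
  - by rewrite subUset sub1set tE // subUset sub1set tE //= (subset_trans (subsetDl _ _) ME).
by rewrite !card_setU1_disjoint // (cardsD1 e M) eM add1n ltnn.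
Qed.

End SetFamilies.

(** * Greedy choice of disjoint absorbers *)

Section GreedyFamily.
Variables (R : realType) (V : finType) (r : nat) (W : {set V}).
Variables (Ls : {set {set V}}) (Ab : {set V} -> {set {set V}}) (theta : R).
Local Notation m := (#|W|%:R : R).
Hypotheses (r_gt0 : (0 < r)%N) (W_gt0 : (0 < #|W|)%N) (theta_gt0 : 0 < theta).
Hypothesis theta_le1 : theta <= 1.
Hypothesis card_Ab : forall L X, X \in Ab L -> #|X| = r.
Hypothesis many_Ab : forall L, L \in Ls ->
  theta * m ^+ r <= #|[set X in Ab L | X \subset W]|%:R.
Implicit Types (X Y L : {set V}) (F : {set {set V}}).

Lemma card_sets_meeting Y : (#|[set X : {set V} | [&& X \subset W, #|X| == r
   & ~~ [disjoint X & Y]]]| <= #|Y| * #|W| ^ r.-1)%N.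
Proof.
pose B := [set Z : {set V} | (Z \subset W) && (#|Z| == r.-1)].
apply: (@leq_trans #|[set u.1 |: u.2 | u in setX Y B]|).
  apply: subset_leq_card; apply/subsetP => X; rewrite inE => /and3P[XW /eqP cX].
  rewrite -setI_eq0 => /set0Pn[y]; rewrite inE => /andP[yX yY].
  apply/imsetP; exists (y, X :\ y); last by rewrite setD1K.
  rewrite !inE /= yY (subset_trans (subsetDl _ _) XW) /=.
  by have := cardsD1 y X; rewrite yX cX => ->; rewrite add1n.
apply: leq_trans (leq_imset_card _ _) _; rewrite cardsX leq_mul2l; apply/orP; right.
by apply: card_sets_of_size_le => X; rewrite inE => /andP[? /eqP].
Qed.

Definition uncovered F := [set L in Ls | [forall X in F, X \notin Ab L]].

(** Double counting of pairs [(L, X)]. Avoiding [cover F] costs each uncovered [L] at most half of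
    its absorbers, and there are at most [m ^+ r] candidates [X], so some [X] serves a fraction
    [theta / 4] of all uncovered [L]. *)
Lemma greedy_step F : trivIset F -> cover F \subset W ->
  (2 * #|cover F|)%:R <= theta * m -> uncovered F != finset.set0 ->
  exists X, [/\ X \subset W, #|X| = r, [disjoint X & cover F],
     exists2 L, L \in Ls & X \in Ab L &
     theta / 4 * #|uncovered F|%:R <= #|[set L in uncovered F | X \in Ab L]|%:R].
Proof.
move=> tF FW small ne; set U := uncovered F in ne *; set Y := cover F in small *.
have U0 : 0 < #|U|%:R :> R by rewrite ltr0n card_gt0.
have m0 : 0 < m by rewrite ltr0n.
have mr0 : 0 < m ^+ r by rewrite exprn_gt0.
pose XX := [set X : {set V} | [&& X \subset W, #|X| == r & [disjoint X & Y]]].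
have cXX : (#|XX| <= #|W| ^ r)%N.
  by apply: card_sets_of_size_le => X; rewrite inE => /and3P[? /eqP].
have lowL L : L \in U -> theta / 2 * m ^+ r <= #|[set X in XX | X \in Ab L]|%:R.
  rewrite inE => /andP[LLs _]; have := many_Ab LLs => manyL.
  have split : (#|[set X in Ab L | X \subset W]| <=
      #|[set X in XX | X \in Ab L]| + #|Y| * #|W| ^ r.-1)%N.
    apply: leq_trans (leq_add (leqnn _) (card_sets_meeting Y)).
    apply: leq_trans (leq_card_setU _ _); apply: subset_leq_card.
    apply/subsetP => X; rewrite !inE => /andP[XA XW].
    by rewrite XA XW (card_Ab XA) eqxx /= andbT orbN.
  rewrite -(ler_nat R) natrD natrM natrX in split.
  have : (2 * #|Y|)%:R * m ^+ r.-1 <= theta * m * m ^+ r.-1.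
    by rewrite ler_wpM2r // exprn_ge0 // ltW.
  rewrite -mulrA -exprS prednK // natrM.
  by move: split manyL; move: (m ^+ r.-1) => a; lra.
suff [X XXX cX] : exists2 X, X \in XX &
    theta / 4 * #|U|%:R <= #|[set L in U | X \in Ab L]|%:R.
  move: (XXX); rewrite inE => /and3P[XW /eqP cardX dis]; exists X; split=> //.
  have : 0 < #|[set L in U | X \in Ab L]|%:R :> R.
    by apply: lt_le_trans cX; rewrite mulr_gt0 // divr_gt0.
  rewrite ltr0n => /card_gt0P[L]; rewrite !inE => /andP[/andP[LLs _] XA].
  by exists L.
apply: contrapT => none.
have up : \sum_(X in XX) (#|[set L in U | X \in Ab L]|%:R : R) <=
    m ^+ r * (theta / 4 * #|U|%:R).
  apply: le_trans (_ : \sum_(X in XX) (theta / 4 * #|U|%:R) <= _).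
    apply: ler_sum => X XXX; rewrite leNgt; apply/negP => /ltW h.
    by apply: none; exists X.
  rewrite sumr_const -[leLHS]mulr_natl ler_wpM2r //.
    by rewrite mulr_ge0 ?ler0n // divr_ge0 // ltW.
  by rewrite -natrX ler_nat.
have low : #|U|%:R * (theta / 2 * m ^+ r) <=
    \sum_(X in XX) (#|[set L in U | X \in Ab L]|%:R : R).
  rewrite -natr_sum (_ : (\sum_(X in XX) #|[set L in U | X \in Ab L]|)%N =
     (\sum_(L in U) #|[set X in XX | X \in Ab L]|)%N); last first.
    under eq_bigr do rewrite -sum1_card big_set big_mkcondr /=.
    rewrite exchange_big /=; apply: eq_bigr => L _.
    rewrite -[RHS]sum1_card [RHS]big_set [RHS]big_mkcondr.
    by apply: eq_bigr.
  by rewrite natr_sum mulr_natl -sumr_const; apply: ler_sum => L /lowL.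
have : 0 < #|U|%:R * (theta * m ^+ r) by rewrite !mulr_gt0.
by move: (le_trans low up); lra.
Qed.

(** A deterministic substitute for a random absorbing family: each new set multiplies the number of
    uncovered roots by at most [1 - theta / 4]. *)
Lemma greedy_family i : (2 * (i * r))%:R <= theta * m ->
  exists F, [/\ trivIset F, cover F \subset W, (#|F| <= i)%N,
    forall X, X \in F -> #|X| = r /\ exists2 L, L \in Ls & X \in Ab L &
    #|uncovered F|%:R <= (1 - theta / 4) ^+ i * #|Ls|%:R].
Proof.
elim: i => [|i IHi] ismall.
  exists finset.set0; rewrite cards0 /cover big_set0 sub0set expr0 mul1r; split=> //.
  - by apply/trivIsetP => A B; rewrite inE.
  - by move=> X; rewrite inE.
  - by rewrite ler_nat; apply: subset_leq_card; apply/subsetP => L; rewrite inE => /andP[].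
have [|F [tF FW cF FP unc]] := IHi.
  by apply: le_trans ismall; rewrite ler_nat leq_mul2l leq_mul2r leqnSn !orbT.
have q0 : 0 <= 1 - theta / 4 by move: theta_gt0 theta_le1; lra.
have cY : (#|cover F| <= i * r)%N.
  apply: leq_trans (leq_card_cover F) _.
  rewrite (eq_bigr (fun=> r)); last by move=> X /FP[].
  by rewrite sum_nat_const leq_mul2r cF orbT.
have [U0|ne] := eqVneq (uncovered F) finset.set0.
  exists F; split=> //; first exact: leqW.
  by rewrite U0 cards0 mulr_ge0 ?exprn_ge0 ?ler0n.
have small : (2 * #|cover F|)%:R <= theta * m.
  apply: le_trans ismall; rewrite ler_nat leq_mul2l /=.
  by apply: leq_trans cY _; rewrite leq_mul2r leqnSn orbT.
have [X [XW cX dis XL gain]] := greedy_step tF FW small ne.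
exists (X |: F); split.
- exact: trivIset_setU1.
- by rewrite cover_setU1 subUset XW.
- by rewrite card_setU1_disjoint ?cX.
- by move=> Z; rewrite !inE => /orP[/eqP->|/FP].
apply: le_trans (_ : (1 - theta / 4) * #|uncovered F|%:R <= _); last first.
  by rewrite exprS -mulrA ler_wpM2l.
have : (#|uncovered (X |: F)| <= #|uncovered F :\: [set L in uncovered F | X \in Ab L]|)%N.
  apply: subset_leq_card; apply/subsetP => L; rewrite !inE => /andP[LLs /forall_inP all].
  have XA : X \notin Ab L by apply: all; rewrite setU11.
  have FA : [forall Z in F, Z \notin Ab L].
    by apply/forall_inP => Z ZF; apply: all; rewrite inE ZF orbT.
  by rewrite LLs FA (negPf XA).
rewrite cardsDS; last by apply/subsetP => L; rewrite inE => /andP[].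
rewrite -(ler_nat R) natrB; last first.
  by apply: subset_leq_card; apply/subsetP => L; rewrite inE => /andP[].
move=> h; apply: le_trans h _; rewrite mulrBl mul1r; move: gain; lra.
Qed.

End GreedyFamily.

(** * The parity obstruction *)

Section Parity.
Variables (V : finType) (k : nat) (A : {set V}) (tau : nat).
Implicit Types (Y Z : {set V}) (F : {set {set V}}).

(** Vanishes on edges of the typical parity [tau] and is additive on disjoint sets whose sizes are
    multiples of [k]; hence it obstructs covering by typical edges. *)
Definition parity Z : bool := odd (#|Z :&: A| + tau * (#|Z| %/ k)).

Lemma parity_set0 : parity finset.set0 = false.
Proof. by rewrite /parity set0I cards0 div0n muln0. Qed.

Lemma card_disjoint_setU Y Z : [disjoint Y & Z] -> #|Y :|: Z| = (#|Y| + #|Z|)%N.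
Proof. by move=> dis; rewrite cardsU disjoint_setI0 ?cards0 ?subn0. Qed.

Lemma parity_setU Y Z : [disjoint Y & Z] -> (k %| #|Y|)%N ->
  parity (Y :|: Z) = parity Y (+) parity Z.
Proof.
move=> dis kY; rewrite /parity -oddD setIUl card_disjoint_setU; last first.
  by apply: disjointW dis; apply: subsetIl.
rewrite (card_disjoint_setU dis) divnDl // mulnDr.
by congr odd; rewrite addnACA.
Qed.

Lemma dvdn_card_cover F : trivIset F -> (forall X, X \in F -> (k %| #|X|)%N) ->
  (k %| #|cover F|)%N.
Proof.
move=> tF kF; have -> : #|cover F| = (\sum_(X in F) #|X|)%N.
  by apply/esym/eqP; rewrite eq_sym; have := leq_card_cover F; rewrite tF => -[_ ->].
by apply: dvdn_sum => X /kF.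
Qed.

Lemma parity_cover F : trivIset F -> (forall X, X \in F -> (k %| #|X|)%N) ->
  parity (cover F) -> exists2 X, X \in F & parity X.
Proof.
elim: {F}#|F| {-2}F (erefl #|F|) => [|i IHi] F cF tF kF.
  by move/eqP: cF; rewrite cards_eq0 => /eqP->; rewrite /cover big_set0 parity_set0.
have /card_gt0P[X XF] : (0 < #|F|)%N by rewrite cF.
rewrite -{1}(setD1K XF) cover_setU1 parity_setU ?kF //; last exact: trivIset_setD1.
have [pX _|npX /=] := boolP (parity X); first by exists X.
case/(IHi (F :\ X)).
- by move: cF; rewrite (cardsD1 X) XF add1n => -[].
- by apply: trivIsetS tF; apply: subsetDl.
- by move=> Y; rewrite !inE => /andP[_ /kF].
- by move=> Y; rewrite !inE => /andP[_ YF] pY; exists Y.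
Qed.

End Parity.

(** Ensures that [m %/ q] greedy steps exhaust polynomially many roots: geometric decay in [m] beats
    every power of [m]. *)
Lemma expn_decay (R : realType) (x : R) (q a : nat) : 0 < x -> x <= 1 -> (0 < q)%N ->
  exists N, forall m, (N <= m)%N ->
    (1 - x) ^+ (m %/ q) * (m%:R + 1) ^+ a < 1.
Proof.
move=> x0 x1 q0; have qR : 0 < q%:R :> R by rewrite ltr0n.
have [|N NP] := @poly_le_expR_sqrt R a (2 * expR x) (x / q%:R); first by rewrite divr_gt0.
exists N.+1 => m Nm; have := NP m (ltnW Nm); set i := (m %/ q)%N => h.
have m1 : 1 <= m%:R :> R by rewrite ler1n (leq_trans _ Nm).
have sm : Num.sqrt m%:R <= m%:R :> R.
  rewrite -[leRHS]ger0_norm ?ler0n // -sqrtr_sqr ler_wsqrtr // expr2.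
  by rewrite -[leLHS]mulr1 ler_wpM2l //; lra.
have im : m%:R <= (i%:R + 1) * q%:R :> R.
  by rewrite natr1 -natrM ler_nat ltnW // ltn_ceil.
have e1 : (1 - x) ^+ i <= expR (- (x * i%:R)).
  rewrite mulrC -mulrN expRM_natl lerXn2r ?nnegrE ?expR_ge0 ?subr_ge0 //.
  exact: expR_ge1Dx.
have e2 : expR (x / q%:R * Num.sqrt m%:R) <= expR (x * (i%:R + 1)).
  rewrite ler_expR mulrAC ler_pdivrMr // -mulrA ler_wpM2l ?(ltW x0) //.
  exact: le_trans sm im.
have a0 : 0 <= (m%:R + 1) ^+ a :> R by rewrite exprn_ge0 //; lra.
apply: le_lt_trans (ler_wpM2r a0 e1) _.
have ei := expR_gt0 (- (x * i%:R)); have ex := expR_gt0 x.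
have : expR (- (x * i%:R)) * (2 * expR x * (m%:R + 1) ^+ a) <= expR x.
  apply: le_trans (ler_wpM2l (ltW ei) (le_trans h e2)) _.
  by rewrite -expRD ler_expR; lra.
move: (expR (- _)) ((m%:R + 1) ^+ a) ei => u v u0.
have -> : u * (2 * expR x * v) = (2 * (u * v)) * expR x by ring.
by rewrite -[leRHS]mul1r ler_pM2r //; lra.
Qed.

(* If the vertices left over by a near perfect matching have the wrong parity, some matching edge
   has the wrong parity too and is given up. *)
Lemma coverable_of_absorbers (R : realType) k r (theta : R) :
  (3 <= k)%N -> 0 < theta -> theta <= 1 -> (0 < r)%N -> (2 * k %| r)%N ->
  exists N, forall (V : finType) (E : {set {set V}}) (A : {set V}) tau (W : {set V}),
    (N <= #|W|)%N -> uniform k E -> (k %| #|W|)%N -> ~~ parity k A tau W ->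
    (forall S : {set V}, S \subset W -> #|S| = k.-1 ->
       2 / 5 * #|W|%:R <= #|[set x in W | x |: S \in E]|%:R :> R) ->
    (forall (L : {set V}) j, L \subset W -> (j <= k)%N -> #|L| = (j * k)%N ->
       odd #|L :&: A| = odd (tau * j) ->
       theta * #|W|%:R ^+ r <= #|[set X in absorbers E r A L | X \subset W]|%:R) ->
    coverable E W.
Proof.
move=> k3 th0 th1 r0 kr; have k0 : (0 < k)%N by apply: leq_trans k3.
have k2 : (2 <= k)%N by apply: leq_trans k3.
have [N0 N0P] := exists_nat_ge ((2 * r)%:R / theta).
rewrite ler_pdivrMr // in N0P.
(* With [|W| %/ q] absorbers, [15 * r] keeps their vertices below [|W| / 15], so the codegree left
   is at least [(2/5 - 1/15) * |W|], a third of [|W|], enough for [near_perfect_matching] as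
   [k >= 3]. The term [N0] meets the size condition of [greedy_family]. *)
pose q := (15 * r + N0)%N.
have q0 : (0 < q)%N by rewrite addn_gt0 muln_gt0 r0.
have [||N NP] := @expn_decay R (theta / 4) q (k * k) _ _ q0; [lra | lra |].
exists N.+1 => V E A tau W NW uniE kW parW codeg absb.
have W0 : (0 < #|W|)%N by apply: leq_trans NW.
set i := (#|W| %/ q)%N.
have iq : (i * q <= #|W|)%N by apply: leq_divM.
have i15 : (15 * (i * r) <= #|W|)%N.
  by apply: leq_trans iq; rewrite mulnCA leq_mul2l leq_addr orbT.
have ismall : (2 * (i * r))%:R <= theta * #|W|%:R.
  apply: le_trans (_ : theta * (i * q)%:R <= _); last first.
    by rewrite ler_wpM2l ?(ltW th0) // ler_nat.
  rewrite mulnCA [(i * (2 * r))%:R]natrM [(i * q)%:R]natrM [leRHS]mulrCA ler_wpM2l ?ler0n //.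
  apply: le_trans N0P _; rewrite mulrC ler_wpM2l ?(ltW th0) // ler_nat.
  exact: leq_addl.
pose Ls := [set L : {set V} | [&& L \subset W, (#|L| <= k * k)%N, (k %| #|L|)%N
  & ~~ parity k A tau L]].
pose Ab L := absorbers E r A L.
have cAb L X : X \in Ab L -> #|X| = r by rewrite inE => /andP[/eqP].
have manyAb L : L \in Ls ->
    theta * #|W|%:R ^+ r <= #|[set X in Ab L | X \subset W]|%:R.
  rewrite inE => /and4P[LW cL kL]; rewrite /parity oddD negb_add => /eqP pL.
  apply: (absb L (#|L| %/ k)%N) => //; last by rewrite divnK.
  by rewrite leq_divLR.
have [F [tF FW cF FP unc]] := greedy_family r0 W0 th0 th1 cAb manyAb ismall.
have LsF L : L \in Ls -> exists2 X, X \in F & X \in Ab L.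
  move=> LLs; suff : uncovered Ls Ab F == finset.set0.
    move=> /eqP/setP/(_ L); rewrite !inE; move: (LLs); rewrite inE => ->; rewrite andTb.
    by move/negbT/forall_inPn => [X XF]; rewrite negbK; exists X.
  (* Fewer than one root stays uncovered, hence none. *)
  rewrite -cards_eq0 -leqn0 -ltnS -(ltr_nat R); apply: le_lt_trans unc _.
  have cLs : (#|Ls| <= #|W|.+1 ^ (k * k))%N.
    apply: leq_trans (card_small_subsets W (k * k)); apply: subset_leq_card.
    by apply/subsetP => L'; rewrite !inE => /and4P[-> ->].
  have t0 : 0 <= 1 - theta / 4 by lra.
  apply: le_lt_trans (NP _ (ltnW NW)); rewrite ler_wpM2l ?exprn_ge0 //.
  by rewrite natr1 -natrX ler_nat.
pose Y := cover F; pose W' := W :\: Y.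
have kr' : (k %| r)%N by apply: dvdn_trans kr; apply: dvdn_mull.
have kX X : X \in F -> (k %| #|X|)%N by move=> /FP[->].
have kY : (k %| #|Y|)%N by apply: dvdn_card_cover.
have parX X : X \in F -> ~~ parity k A tau X.
  move=> /FP[cX [L _]]; rewrite inE => /and5P[_ _ ev _ _].
  rewrite /parity oddD (negPf ev) cX; move: kr => /dvdnP[t ->].
  by rewrite mulnA mulnK // !oddM !andbF.
have parY : ~~ parity k A tau Y.
  by apply/negP => /(parity_cover tF kX)[X XF]; rewrite (negPf (parX X XF)).
have YW' : [disjoint Y & W'] by rewrite disjoint_sym -setI_eq0 setIDAC setDIl setDv setI0.
have WE : W = Y :|: W' by rewrite -[LHS](setID W Y) (setIidPr FW).
have parW' : ~~ parity k A tau W'.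
  by move: parW; rewrite {1}WE parity_setU // (negPf parY).
have kW' : (k %| #|W'|)%N by rewrite cardsDS // dvdn_sub.
have cY : (#|Y| <= i * r)%N.
  apply: leq_trans (leq_card_cover F) _; rewrite (eq_bigr (fun=> r)).
    by rewrite sum_nat_const leq_mul2r cF orbT.
  by move=> X /FP[].
have [|M [ME tM cM left]] := @near_perfect_matching V k E k2 uniE W'.
  move=> S SW' cS; have SW := subset_trans SW' (subsetDl _ _).
  have := codeg S SW cS => low.
  have : (#|[set x in W | (x |: S) \in E]| <= #|[set x in W' | (x |: S) \in E]| + #|Y|)%N.
    apply: leq_trans (leq_card_setU _ _); apply: subset_leq_card.
    by apply/subsetP => x; rewrite !inE => /andP[-> ->]; rewrite !andbT orNb.
  set d := #|[set x in W' | _]|; rewrite -(ler_nat R) natrD => up.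
  rewrite -(ler_nat R) natrM.
  have W'W : #|W'|%:R <= #|W|%:R :> R by rewrite ler_nat subset_leq_card // subsetDl.
  have k3R : 3 <= k%:R :> R by rewrite ler_nat.
  have YR : 15 * #|Y|%:R <= #|W|%:R :> R.
    by rewrite -natrM ler_nat; apply: leq_trans i15; rewrite leq_mul2l cY.
  have : 3 * d%:R <= k%:R * d%:R :> R by rewrite ler_wpM2r.
  by move: low up W'W YR; lra.
set L0 := W' :\: cover M in left.
have W'E : W' = cover M :|: L0 by rewrite -[LHS](setID W' (cover M)) (setIidPr cM).
have ML0 : [disjoint cover M & L0] by rewrite disjoint_sym -setI_eq0 setIDAC setDIl setDv setI0.
have kM e : e \in M -> (k %| #|e|)%N by move=> /(subsetP ME)/(card_edge uniE)->.
have kcM : (k %| #|cover M|)%N by apply: dvdn_card_cover.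
have kL0 : (k %| #|L0|)%N by rewrite cardsDS // dvdn_sub.
have [M1 [L [M1E tM1 W'E1 dis1 [kL cL parL]]]] : exists (M1 : {set {set V}}) (L : {set V}), [/\ M1 \subset E,
    trivIset M1, W' = cover M1 :|: L, [disjoint cover M1 & L]
    & [/\ (k %| #|L|)%N, (#|L| <= k * k)%N & ~~ parity k A tau L]].
  have L0k : (#|L0| <= k * k)%N.
    by apply: leq_trans (ltnW left) _; rewrite leq_mul2l leq_pred orbT.
  have [pL0|pL0] := boolP (parity k A tau L0); last by exists M, L0.
  have pM : parity k A tau (cover M).
    by move: parW'; rewrite {1}W'E parity_setU // pL0 addbT negbK.
  have [e eM pe] := parity_cover tM kM pM.
  have ce : #|e| = k by apply: card_edge uniE _ (subsetP ME _ eM).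
  have eM1 : [disjoint e & cover (M :\ e)] by apply: trivIset_setD1.
  have cME : cover M = e :|: cover (M :\ e) by rewrite -cover_setU1 setD1K.
  have eL0 : [disjoint e & L0] by move: ML0; rewrite cME disjoint_setUl => /andP[].
  exists (M :\ e), (e :|: L0); split.
  - exact: subset_trans (subsetDl _ _) ME.
  - by apply: trivIsetS tM; apply: subsetDl.
  - by rewrite {1}W'E cME setUCA setUA.
  - rewrite disjoint_sym disjoint_setUl eM1 disjoint_sym.
    by move: ML0; rewrite cME disjoint_setUl => /andP[].
  split; last by rewrite parity_setU ?ce // pe pL0.
    by rewrite card_disjoint_setU // dvdn_add // ce.
  (* Origin of the bound [k * k] on absorbed sets: fewer than [k * (k - 1)] leftover vertices and
     one edge given up. *)
  rewrite card_disjoint_setU // ce; apply: leq_trans (_ : k + k * k.-1 <= _)%N.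
    by rewrite leq_add2l ltnW.
  by rewrite -mulnS prednK.
have YM1 : [disjoint cover M1 & Y].
  rewrite disjoint_sym; apply: disjointWr YW'.
  by rewrite W'E1; apply: subsetUl.
have YL : [disjoint L & Y].
  rewrite disjoint_sym; apply: disjointWr YW'.
  by rewrite W'E1; apply: subsetUr.
have LW : L \subset W by rewrite WE W'E1 setUA subsetUr.
have [X XF XL] : exists2 X, X \in F & X \in Ab L.
  by apply: LsF; rewrite inE LW cL kL parL.
move: (XL); rewrite inE => /and5P[_ _ _ _ covXL].
have covY' : coverable E (cover (F :\ X)).
  apply: coverable_family; first by apply: trivIsetS tF; apply: subsetDl.
  by move=> Z; rewrite !inE => /andP[_ /FP[_ [L' _]]]; rewrite inE => /and5P[].
have YE : Y = X :|: cover (F :\ X) by rewrite -cover_setU1 setD1K.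
have -> : W = cover M1 :|: (cover (F :\ X) :|: (X :|: L)).
  rewrite WE W'E1 YE; apply/setP => x; rewrite !inE.
  by case: (x \in cover M1); case: (x \in L); case: (x \in X);
    case: (x \in cover (F :\ X)).
have XY' : [disjoint X & cover (F :\ X)] by apply: trivIset_setD1.
have subY : cover (F :\ X) \subset Y by rewrite YE subsetUr.
apply: coverable_setU; [|exact: coverable_cover|apply: coverable_setU => //].
  rewrite disjoint_sym disjoint_setUl; apply/andP; split.
    by rewrite disjoint_sym; apply: disjointWr YM1.
  rewrite disjoint_setUl; apply/andP; split; last by rewrite disjoint_sym.
  by rewrite disjoint_sym; apply: disjointWr YM1; rewrite YE subsetUl.
by rewrite disjoint_sym disjoint_setUl XY' /=; exact: disjointWr subY YL.
Qed.

(* Extremal example: all [k]-sets meeting a fixed odd set of about [n / 2] vertices evenly. *)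
Lemma m_codegree_gt k n : (3 <= k)%N -> (k %| n)%N -> (4 * k <= n)%N ->
  (n./2 - k < m_ (k - 1) k n)%N.
Proof.
move=> k3 kn nk; have k0 : (0 < k)%N by apply: leq_trans k3.
rewrite ltnNge; apply/negP => mle.
pose a := (2 * (n %/ 4) + 1)%N.
have [an alow ahigh] : [/\ (a <= n)%N, (n./2 <= a + 1)%N & (n./2 <= n - a + 1)%N].
  have := divn_eq n 4; have : (n %% 4 < 4)%N by rewrite ltn_mod.
  by move: k3 nk; rewrite /a; clear; move: (n %/ 4)%N (n %% 4)%N => x y; split; lia.
pose A := [set i : 'I_n | (i < a)%N].
have cA : #|A| = a.
  have winj : injective (widen_ord an).
    by move=> i j /(congr1 (@nat_of_ord n)) /= ij; apply: val_inj.
  rewrite -[RHS]card_ord -(card_imset _ winj).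
  apply: eq_card => i; rewrite inE; apply/idP/imsetP => [ia|[j _ ->]].
    by exists (Ordinal ia) => //; apply: val_inj.
  exact: ltn_ord j.
pose E := [set e : {set 'I_n} | (#|e| == k) && ~~ odd #|e :&: A|].
have uniE : uniform k E by apply/forall_inP => e; rewrite inE => /andP[].
have [|M] := @m_forces (k - 1) k n 'I_n E (card_ord n) uniE.
  apply: leq_trans mle _; apply: min_degree_ge.
    by rewrite card_ord; move: k3 nk; clear; lia.
  (* [Z] consists of the vertices that complete [S] to a [k]-set of even trace. *)
  move=> S cS; pose Z := (if odd #|S :&: A| then A else ~: A) :\: S.
  have cZ : (n./2 - k <= #|Z|)%N.
    have cardA : (n./2 - 1 <= #|if odd #|S :&: A| then A else ~: A|)%N.
      case: ifP => _; last rewrite cardsCs setCK card_ord; rewrite cA; move: alow ahigh; clear; lia.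
    rewrite /Z; set B := if _ then _ else _ in cardA *.
    have := cardsID S B; have : (#|B :&: S| <= #|S|)%N by rewrite subset_leq_card ?subsetIr.
    move: cardA k0; rewrite cS; clear.
    by move: #|B| #|B :&: S| #|B :\: S| => x y z; lia.
  apply: leq_trans cZ _; rewrite -(@card_in_imset _ _ (fun x => x |: S)).
    apply: subset_leq_card; apply/subsetP => _ /imsetP[x xZ ->].
    move: xZ; rewrite !inE => /andP[xS xB]; rewrite subsetUr andbT.
    rewrite cardsU1 xS cS /= subn1 add1n prednK // eqxx /=.
    have -> : #|(x |: S) :&: A| = ((x \in A) + #|S :&: A|)%N.
      rewrite setIUl; have [xA|xA] := boolP (x \in A).
        by rewrite (setIidPl _) ?sub1set // cardsU1 inE (negPf xS).
      by rewrite disjoint_setI0 ?disjoints1 // set0U.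
    rewrite oddD; move: xB; case: (odd #|S :&: A|) => [xA|]; first by rewrite xA.
    by rewrite inE => /negPf->.
  move=> x y; rewrite !inE => /andP[xS _] /andP[yS _] /setP/(_ x).
  by rewrite !inE eqxx /= (negPf xS) orbF => /esym/eqP.
case/andP => /andP[ME tM]; rewrite card_ord => /eqP cM.
have covM : cover M = [set: 'I_n].
  apply/eqP; rewrite eqEcard subsetT cardsT card_ord.
  by rewrite (card_cover_edges k0 uniE ME tM) cM (divnK kn) /=.
have pT : parity k A 0 (cover M).
  by rewrite /parity covM setTI cA mul0n addn0 /a oddD oddM.
have [e|e eM] := parity_cover tM _ pT.
  by move=> /(subsetP ME)/(card_edge uniE)->.
rewrite /parity mul0n addn0; apply/negP.
by have := subsetP ME e eM; rewrite inE => /andP[].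
Qed.

(** * The hereditary condition for perfect matchings *)

Section PerfectMatchings.
Variables (R : realType) (V : finType) (k r : nat) (E : {set {set V}}).
Variables (A : {set V}) (tau : nat) (theta : R).
Hypotheses (k_ge3 : (3 <= k)%N) (uniE : uniform k E) (r_gt0 : (0 < r)%N).
Implicit Types (S X W Z : {set V}).

Definition absorbable S := [&& (#|S| <= k * k)%N, (k %| #|S|)%N & ~~ parity k A tau S].

(* One extension system encodes the codegree condition, on roots of size [k.-1], and the absorbers,
   on roots whose size is a multiple of [k]. *)
Definition pm_ext S : {set {set V}} :=
  if #|S| == k.-1 then [set X : {set V} | (#|X| == 1) && (X :|: S \in E)]
  else if absorbable S then absorbers E r A S else finset.set0.

Definition pm_ext_size S : nat := if #|S| == k.-1 then 1%N else r.

(** 44/100 and [theta / 2] lie below the densities 9/20 and [theta] available in [V], which leaves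
    room for the deletion of one edge. The value 0 makes the condition void for all other roots. *)
Definition pm_ext_density S : R :=
  if #|S| == k.-1 then 44 / 100 else if absorbable S then theta / 2 else 0.

Lemma pm_ext_size_range S : (0 < pm_ext_size S <= r)%N.
Proof. by rewrite /pm_ext_size; case: ifP; rewrite ?r_gt0 ?leqnn. Qed.

Lemma card_pm_ext S X : X \in pm_ext S -> #|X| = pm_ext_size S.
Proof.
rewrite /pm_ext /pm_ext_size; case: ifP => _; first by rewrite inE => /andP[/eqP].
by case: ifP => _; rewrite inE // => /andP[/eqP].
Qed.

Lemma card_single_ext S W : #|S| = k.-1 ->
  #|[set X in pm_ext S | X \subset W]| = #|[set x in W | x |: S \in E]|.
Proof.
move=> cS; rewrite /pm_ext cS eqxx -[RHS](card_imset _ set1_inj).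
apply: eq_card => X; rewrite !inE; apply/idP/imsetP => [|[x]].
  case/andP => /andP[/cards1P[x ->] xE] xW; exists x => //.
  by rewrite inE xE -sub1set xW.
by rewrite inE => /andP[xW xE] ->; rewrite cards1 eqxx xE sub1set.
Qed.

Lemma absorbable_neq S : absorbable S -> (#|S| == k.-1) = false.
Proof.
case/and3P => _ /dvdnP[j ->] _; apply/negbTE/eqP.
case: j => [|j]; first by move: k_ge3; clear; lia.
by rewrite mulSn => h; have : (k <= k.-1)%N; [rewrite -h leq_addr | move: k_ge3; clear; lia].
Qed.

Lemma pm_ext_absorbers S : absorbable S -> pm_ext S = absorbers E r A S.
Proof. by move=> aS; rewrite /pm_ext absorbable_neq // aS. Qed.

(** At most [k * |V| ^ (b - 1)] extensions meet [Z], which is less than the margin in the densities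
    for large [V]. *)
Lemma dense_remove Z W : W = ~: Z -> (#|Z| <= k)%N ->
  (forall S, #|S| = k.-1 ->
     9 / 20 * #|V|%:R <= #|[set x | x |: S \in E]|%:R :> R) ->
  (forall S, absorbable S -> theta * #|V|%:R ^+ r <= #|absorbers E r A S|%:R) ->
  0 <= theta -> k%:R <= 1 / 100 * #|V|%:R :> R -> k%:R <= theta / 2 * #|V|%:R ->
  dense_in r (k * k) pm_ext pm_ext_size pm_ext_density W.
Proof.
move=> WZ cZ codeg abs th0 large1 large2 S SW SD.
apply: le_trans (_ : pm_ext_density S * #|V|%:R ^+ pm_ext_size S <= _).
  have d0 : 0 <= pm_ext_density S.
    rewrite /pm_ext_density; case: ifP => _; first by lra.
    by case: ifP => _ //; lra.
  apply: le_trans (_ : pm_ext_density S * #|W|%:R ^+ pm_ext_size S <= _).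
    by rewrite ler_wpM2r ?exprn_ge0 ?ler0n // gerBl slack_ge0.
  rewrite ler_wpM2l // lerXn2r ?nnegrE ?ler0n // ler_nat.
  exact: max_card.
have key (B : {set {set V}}) b (t u : R) : (0 < b)%N -> (forall X, X \in B -> #|X| = b) ->
    t * #|V|%:R ^+ b <= #|B|%:R -> k%:R <= (t - u) * #|V|%:R ->
    u * #|V|%:R ^+ b <= #|[set X in B | X \subset W]|%:R.
  move=> b0 cB tB ktu.
  have split : (#|B| <= #|[set X in B | X \subset W]| + #|Z| * #|V| ^ b.-1)%N.
    have := card_sets_meeting b [set: V] Z; rewrite cardsT => meet.
    apply: leq_trans (leq_add (leqnn _) meet); apply: leq_trans (leq_card_setU _ _).
    apply: subset_leq_card; apply/subsetP => X XB; rewrite !inE XB subsetT (cB X XB) eqxx /=.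
    by rewrite WZ -disjoints_subset orbN.
  rewrite -(ler_nat R) natrD natrM natrX in split.
  have v0 : 0 <= #|V|%:R ^+ b.-1 :> R by rewrite exprn_ge0.
  have h1 : #|Z|%:R * #|V|%:R ^+ b.-1 <= k%:R * #|V|%:R ^+ b.-1 :> R.
    by rewrite ler_wpM2r // ler_nat.
  have h2 : k%:R * #|V|%:R ^+ b.-1 <= (t - u) * #|V|%:R * #|V|%:R ^+ b.-1 :> R.
    by rewrite ler_wpM2r.
  rewrite -mulrA -exprS prednK // in h2.
  by move: h1 h2 split tB; move: (_ ^+ b) => vb; lra.
rewrite /pm_ext_density; have [cS|cS] := eqVneq #|S| k.-1.
  have -> : pm_ext_size S = 1%N by rewrite /pm_ext_size cS eqxx.
  apply: (key _ _ (9 / 20)) => //; last by lra.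
    by move=> X /card_pm_ext; rewrite /pm_ext_size cS eqxx.
  rewrite expr1; apply: le_trans (codeg S cS) _; rewrite ler_nat.
  have := card_single_ext [set: V] cS; rewrite (_ : [set X in pm_ext S | _] = pm_ext S).
    by move=> ->; apply: subset_leq_card; apply/subsetP => x; rewrite !inE.
  by apply/setP => X; rewrite inE subsetT andbT.
have [aS|naS] := boolP (absorbable S); last by rewrite mul0r.
have -> : pm_ext_size S = r by rewrite /pm_ext_size (negPf cS).
rewrite pm_ext_absorbers //; apply: (key _ _ theta) => //.
- by move=> X; rewrite inE => /andP[/eqP].
- exact: abs.
- by lra.
Qed.

(** When [Z] is an edge, adding it back is injective, because no matching inside [W] contains
    [Z]. *)
Lemma inner_to_perfect Z W : W = ~: Z -> (Z == finset.set0) || (Z \in E) ->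
  (k %| #|V|)%N ->
  (#|inner_matchings k E W| <= num_perfect_matchings k E)%N.
Proof.
move=> WZ ZE kV; have k0 : (0 < k)%N by apply: leq_trans k_ge3.
rewrite /num_perfect_matchings.
have [Z0|Zn0] := eqVneq Z finset.set0.
  apply: subset_leq_card; apply/subsetP => M; rewrite WZ Z0 setC0 !inE cardsT.
  by case/and4P=> ME tM _ cM; rewrite /perfect_matching /optimal_matching /matching kV ME tM.
have {}ZE : Z \in E by move: ZE; rewrite (negPf Zn0).
have cZ := card_edge uniE ZE.
have dis M : M \in inner_matchings k E W -> [disjoint Z & cover M].
  rewrite inE => /and4P[_ _ cM _]; rewrite disjoint_sym disjoints_subset.
  by rewrite -WZ.
have ZM M : M \in inner_matchings k E W -> Z \notin M.
  move=> MW; apply/negP => ZM; have := dis M MW.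
  rewrite disjoint_sym disjoints_subset => /subsetP sub.
  have /card_gt0P[x xZ] : (0 < #|Z|)%N by rewrite cZ.
  by have := sub x; rewrite inE xZ /= => /(_ _)/negP[]; rewrite //; apply/bigcupP; exists Z.
rewrite -(@card_in_imset _ _ (fun M => Z |: M)); last first.
  move=> M1 M2 /ZM z1 /ZM z2 /(congr1 (fun M => M :\ Z)).
  by rewrite !setU1K.
apply: subset_leq_card; apply/subsetP => _ /imsetP[M MW ->].
have dM := dis M MW; move: (MW); rewrite inE => /and4P[ME tM cM /eqP nM].
rewrite inE /perfect_matching /optimal_matching /matching kV /=.
rewrite subUset sub1set ZE ME trivIset_setU1 //= cardsU1 (ZM M MW) nM WZ /=.
by rewrite cardsCs setCK cZ -{1}(mul1n k) -divnMDl // mul1n subnKC ?eqxx // -cZ max_card.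
Qed.

End PerfectMatchings.

(** Pays for deleting an edge: the tangent of [x ln x] at [n] bounds the loss by [k * ln n + k],
    hence by [2 * k * n]. *)
Lemma target_drop_le (R : realType) (k n n' : nat) (c : R) : (0 < k)%N -> 0 <= c ->
  (0 < n')%N -> (n' <= n)%N -> (n <= n' + k)%N ->
  (1 - 1 / k%:R) * n%:R * ln n%:R - (c + 2 * k%:R) * n%:R <=
  (1 - 1 / k%:R) * n'%:R * ln n'%:R - c * n'%:R.
Proof.
move=> k0 c0 n'0 n'n nn'.
have n0 : (0 < n)%N by apply: leq_trans n'n.
have nR : 1 <= n%:R :> R by rewrite ler1n.
have n'R : 0 < n'%:R :> R by rewrite ltr0n.
have kR : 1 <= k%:R :> R by rewrite ler1n.
have le1 : n'%:R <= n%:R :> R by rewrite ler_nat.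
have le2 : n%:R <= n'%:R + k%:R :> R by rewrite -natrD ler_nat.
pose kap : R := 1 - 1 / k%:R; rewrite -/kap.
have kap0 : 0 <= kap by rewrite subr_ge0 ler_pdivrMr ?mul1r //; lra.
have kap1 : kap <= 1 by rewrite /kap gerBl divr_ge0 ?ler0n.
have lnn : ln n%:R <= n%:R - 1 :> R.
  have := @le_ln1Dx R (n%:R - 1); rewrite addrCA subrr addr0; apply; lra.
have ln0 : 0 <= ln n%:R :> R by apply: ln_ge0.
have := @xlnx_ge R n'%:R n%:R n'R; rewrite ltr0n => /(_ n0).
set l := ln n%:R in lnn ln0 *; set l' := n'%:R * ln n'%:R => h.
have e1 : n%:R * l - n'%:R * l <= k%:R * n%:R.
  rewrite -mulrBl; apply: ler_pM; rewrite ?subr_ge0 //; lra.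
have e2 : n%:R * l - l' <= k%:R * n%:R + k%:R * n%:R.
  have : k%:R * 1 <= k%:R * n%:R :> R by rewrite ler_wpM2l.
  by move: e1 h; lra.
have e3 : kap * (n%:R * l - l') <= k%:R * n%:R + k%:R * n%:R.
  apply: le_trans (_ : kap * (k%:R * n%:R + k%:R * n%:R) <= _).
    by rewrite ler_wpM2l.
  by rewrite ler_piMl // addr_ge0 ?mulr_ge0.
have e4 : c * n'%:R <= c * n%:R by rewrite ler_wpM2l.
by rewrite -!mulrA -/l'; move: e3 e4; lra.
Qed.

Theorem perfect_matchings_count (R : realType) k : (3 <= k)%N ->
  exists (c : R) (n0 : nat), 0 < c /\ forall n, (n0 <= n)%N -> (k %| n)%N ->
    forall (V : finType) (E : {set {set V}}), #|V| = n -> uniform k E ->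
    (m_ (k - 1) k n <= min_degree (k - 1) E)%N ->
    expR ((1 - 1 / k%:R) * n%:R * ln n%:R - c * n%:R)
      <= (num_perfect_matchings k E)%:R.
Proof.
move=> k3; have k0 : (0 < k)%N by apply: leq_trans k3.
have [theta [r [N1 [th0 th1 r0 kr absP]]]] := absorbing_structure R k3.
have th40 : 0 < theta / 4 by rewrite divr_gt0.
have th41 : theta / 4 <= 1 by lra.
have [N2 N2P] := @coverable_of_absorbers R k r (theta / 4) k3 th40 th41 r0 kr.
(* With this slack the densities remain at least [44/100 - 1/100 > 2/5] and
   [theta / 2 - theta / 4 = theta / 4], as [coverable_of_absorbers] requires. *)
have [|N3 N3P] := @slack_small R r (Num.min (theta / 4) (1 / 100)).
  by rewrite lt_min th40; lra.
pose n0 := (N2 + N3 + 4)%N.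
have [|c c0 cP] := @inner_matchings_count R k 0 r (k * k) n0 k0 k0; first by rewrite leq_addl.
have [N4 N4P] := exists_nat_ge (100 * k%:R + k%:R / (theta / 2)).
exists (c + 2 * k%:R), (n0 + N1 + N4 + 40 * k)%N; split.
  by rewrite addr_gt0 // mulr_gt0 // ltr0n.
move=> n nbig kn V E cV uniE deg.
have [nn0 nN1 nN4 nk] : [/\ n0 + k <= n, N1 <= n, N4 <= n & 40 * k <= n]%N.
  by move: nbig; clear; move: n0 => n0; split; lia.
have [k1n kle] : (k.-1 <= k)%N /\ (k - 1 <= k)%N by rewrite leq_pred leq_subr.
have nR : 0 < n%:R :> R by rewrite ltr0n (leq_trans _ nn0) // addn_gt0 k0 orbT.
have big : 100 * k%:R + k%:R / (theta / 2) <= n%:R.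
  by apply: le_trans N4P _; rewrite ler_nat.
have kR : 0 <= k%:R :> R by rewrite ler0n.
have kth : 0 <= k%:R / (theta / 2) by rewrite divr_ge0 // divr_ge0 // ltW.
have large1 : k%:R <= 1 / 100 * #|V|%:R :> R by rewrite cV; move: big kth; lra.
have large2 : k%:R <= theta / 2 * #|V|%:R.
  rewrite cV mulrC -ler_pdivrMr ?divr_gt0 //; move: big kR; lra.
have codeg (S : {set V}) : #|S| = k.-1 ->
    9 / 20 * #|V|%:R <= #|[set x | x |: S \in E]|%:R :> R.
  move=> cS; have cS' : #|S| = (k - 1)%N by rewrite cS subn1.
  have dS : (n./2 - k < degree E S)%N.
    apply: leq_trans (m_codegree_gt k3 kn _) _.
      by apply: leq_trans nk; rewrite leq_mul2r orbT.
    exact: leq_trans deg (min_degree_le E cS').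
  have dE : degree E S = #|[set x | x |: S \in E]|.
    rewrite (degree_ext uniE kle cS') subKn // -[RHS](card_imset _ set1_inj).
    apply: eq_card => X; rewrite !inE; apply/idP/imsetP => [|[x]].
      by case/and3P => /cards1P[x ->] _ xE; exists x => //; rewrite inE.
    rewrite inE => xE ->; rewrite cards1 eqxx xE andbT /= disjoints1.
    apply/negP => xS; have := card_edge uniE xE; rewrite cardsU1 xS add0n cS.
    by move: k3; clear; lia.
  (* From [n >= 40 * k] the degree is at least [n / 2 - n / 40]; the strict inequality in [dS]
     absorbs the rounding of [n./2]. *)
  rewrite cV -dE; have : (9 * n <= 20 * degree E S)%N.
    by move: dS nk k3; clear; move: (degree E S) => d; lia.
  by rewrite -(ler_nat R) !natrM; lra.
have NV : (N1 <= #|V|)%N by rewrite cV.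
have [A [tau absL]] := absP V E NV uniE codeg.
have abs S : absorbable k A tau S -> theta * #|V|%:R ^+ r <= #|absorbers E r A S|%:R.
  case/and3P => cS kS; rewrite /parity oddD negb_add => /eqP pS.
  apply: (absL S (#|S| %/ k)%N) => //; last by rewrite divnK.
  by rewrite leq_divLR.
have [Z ZE parZ] : exists2 Z : {set V}, (Z == finset.set0) || (Z \in E)
    & ~~ parity k A tau (~: Z).
  have [pT|pT] := boolP (parity k A tau [set: V]); last first.
    by exists finset.set0; rewrite ?eqxx // setC0.
  have [M] := m_forces cV uniE deg; case/andP => /andP[ME tM]; rewrite cV => /eqP cM.
  have covM : cover M = [set: V].
    apply/eqP; rewrite eqEcard subsetT cardsT cV.
    by rewrite (card_cover_edges k0 uniE ME tM) cM (divnK kn) /=.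
  have [e|e eM pe] := parity_cover tM _ (etrans (congr1 (parity k A tau) covM) pT).
    by move=> /(subsetP ME)/(card_edge uniE)->.
  exists e; first by rewrite (subsetP ME _ eM) orbT.
  move: pT; rewrite -(setUCr e) parity_setU ?pe //; last first.
    by rewrite (card_edge uniE (subsetP ME _ eM)).
  by rewrite -setI_eq0 setICr.
have cZ : (#|Z| <= k)%N.
  by case/orP: ZE => [/eqP->|/(card_edge uniE)->//]; rewrite cards0.
have kZ : (k %| #|Z|)%N.
  by case/orP: ZE => [/eqP->|/(card_edge uniE)->//]; rewrite cards0.
set W := ~: Z in parZ.
have cW : (#|W| + #|Z| = n)%N by rewrite -cV -(cardsC Z) addnC.
have kW : (k %| #|W|)%N by move: kn; rewrite -cW dvdn_addl.
have Wn0 : (n0 <= #|W|)%N.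
  by move: nn0 cZ; rewrite -cW; clear; move: n0 #|W| #|Z| => a b d; lia.
have dW := dense_remove k3 r0 (erefl W) cZ codeg abs (ltW th0) large1 large2.
have dens1 (S : {set V}) : pm_ext_density k A tau theta S <= 1.
  by rewrite /pm_ext_density; case: ifP => _; last case: ifP => _; lra.
have base (X : {set V}) : (n0 <= #|X|)%N -> #|X| = 0 %[mod k] ->
    balanced k 0 A tau X ->
    dense_in r (k * k) (pm_ext k r E A tau) (pm_ext_size k r) (pm_ext_density k A tau theta) X ->
    (0 < #|inner_matchings k E X|)%N.
  move=> Xn0 Xk balX dX.
  have [XN2 XN3] : (N2 <= #|X|)%N /\ (N3 <= #|X|)%N.
    by move: Xn0; rewrite /n0; clear; move: #|X| => x; lia.
  have := N3P _ XN3; rewrite le_min => /andP[sl1 sl2].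
  apply: inner_matchings_of_coverable => //.
  apply: (N2P V E A tau X) => //.
  - by rewrite /dvdn Xk mod0n.
  - move=> S SX cS; rewrite -(card_single_ext r E A tau X cS).
    have SD : (#|S| <= k * k)%N by rewrite cS (leq_trans k1n) // leq_pmulr.
    have := dX S SX SD; rewrite /pm_ext_density /pm_ext_size cS eqxx expr1.
    apply: le_trans; rewrite ler_wpM2r ?ler0n //; lra.
  move=> L j LX jk cL parL.
  have aL : absorbable k A tau L.
    rewrite /absorbable cL leq_mul2r jk orbT dvdn_mull //=.
    by rewrite /parity oddD cL mulnK // parL addbb.
  have LD : (#|L| <= k * k)%N by case/and3P: aL.
  have := dX L LX LD; rewrite pm_ext_absorbers // /pm_ext_density /pm_ext_size.
  rewrite (absorbable_neq k3 aL) aL; apply: le_trans.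
  rewrite ler_wpM2r ?exprn_ge0 ?ler0n //; lra.
have := cP V E A tau _ _ _ uniE (@pm_ext_size_range V k r r0) (@card_pm_ext V k r E A tau)
  dens1 base W Wn0 _ _ dW.
have Wk : #|W| = 0 %[mod k] by rewrite mod0n; apply/eqP.
move=> /(_ Wk parZ) low.
have W0 : (0 < #|W|)%N by apply: leq_trans Wn0; rewrite /n0 addn_gt0 orbT.
apply: le_trans (_ : expR ((1 - 1 / k%:R) * #|W|%:R * ln #|W|%:R - c * #|W|%:R) <= _).
  rewrite ler_expR; apply: target_drop_le => //; first exact: ltW.
    by rewrite -cW leq_addr.
  by rewrite -cW leq_add2l.
apply: le_trans low _; rewrite ler_nat.
by apply: (inner_to_perfect k3 uniE (erefl W) ZE); rewrite cV.
Qed.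

Theorem corollary1p7 (R : realType) (k : nat) (gamma : R) :
  (3 <= k)%N -> (0 < gamma)%R -> (gamma < 1)%R ->
  exists (c : R) (n0 : nat), (0 < c)%R /\
    forall n : nat, (n0 <= n)%N ->
      (forall d s : nat, (1 <= d <= k - 1)%N -> (s < k)%N ->
         (n = s %[mod k])%N ->
         forall (V : finType) (E : {set {set V}}),
           #|V| = n -> uniform k E ->
           ((mu_sup R d k s + gamma%:E) * ('C(n - d, k - d)%:R : R)%:E
              <= ((min_degree d E)%:R : R)%:E)%E ->
           (expR ((1 - 1 / k%:R) * n%:R * ln n%:R - c * n%:R)
              <= (num_optimal_matchings k E)%:R :> R)%R)
      /\
      ((k %| n)%N ->
         forall (V : finType) (E : {set {set V}}),
           #|V| = n -> uniform k E ->
           (m_ (k - 1) k n <= min_degree (k - 1) E)%N ->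
           (expR ((1 - 1 / k%:R) * n%:R * ln n%:R - c * n%:R)
              <= (num_perfect_matchings k E)%:R :> R)%R).
Proof.
move=> k3 g0 g1; have [c2 [n2 [c20 P2]]] := perfect_matchings_count R k3.
(* [c] and [n0] have to serve all [d] and [s] at once: sums over the finitely many pairs dominate
   each summand. Pairs with [d = 0] receive the placeholder [(1, 0)]. *)
pose valid (p : 'I_k * 'I_k) := (1 <= p.1 <= k - 1)%N.
have /boolp.choice[f fP] (p : 'I_k * 'I_k) : exists cn : R * nat, 0 < cn.1 /\
    (valid p -> forall n, (cn.2 <= n)%N -> n = p.2 %[mod k] ->
    forall (V : finType) (E : {set {set V}}), #|V| = n -> uniform k E ->
    ((mu_sup R p.1 k p.2 + gamma%:E) * ('C(n - p.1, k - p.1)%:R : R)%:E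
       <= ((min_degree p.1 E)%:R : R)%:E)%E ->
    expR ((1 - 1 / k%:R) * n%:R * ln n%:R - cn.1 * n%:R)
      <= (num_optimal_matchings k E)%:R).
  have [v|] := boolP (valid p); last by exists (1, 0%N).
  have [c [n0 [c0 H]]] := optimal_matchings_count k3 g0 g1 v (ltn_ord p.2).
  by exists (c, n0); split=> // _; apply: H.
pose c := c2 + \sum_p (f p).1; pose n0 := (n2 + \sum_p (f p).2)%N.
have sum0 : 0 <= \sum_p (f p).1 by apply: sumr_ge0 => p _; apply/ltW/(fP p).1.
have weaken (c' : R) (n : nat) (y : R) : c' <= c ->
    expR ((1 - 1 / k%:R) * n%:R * ln n%:R - c' * n%:R) <= y ->
    expR ((1 - 1 / k%:R) * n%:R * ln n%:R - c * n%:R) <= y.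
  move=> cc'; apply: le_trans; rewrite ler_expR lerD2l lerN2.
  by rewrite ler_wpM2r ?ler0n.
exists c, n0; split; first by rewrite ltr_wpDr.
move=> n nn0; split=> [d s dk sk ns V E cV uniE hdeg|kn V E cV uniE hdeg].
  have dltk : (d < k)%N by lia.
  pose p := (Ordinal dltk, Ordinal sk).
  have fn : ((f p).2 <= n)%N.
    by apply: leq_trans nn0; rewrite /n0 (bigD1 p) //= addnCA leq_addr.
  apply: (weaken (f p).1); last exact: ((fP p).2 dk n fn ns V E cV uniE hdeg).
  rewrite /c (bigD1 p) //= addrCA lerDl addr_ge0 ?(ltW c20) //.
  by apply: sumr_ge0 => p' _; apply/ltW/(fP p').1.
apply: (weaken c2); first by rewrite /c lerDl.
by apply: P2 => //; apply: leq_trans nn0; rewrite leq_addr.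
Qed.
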